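(* Let $\tau\in\mathfrak M_{1,c}(\mathrm{Rat})$ with $J_{\ker}(G_\tau)=\emptyset$ and $J(G_\tau)\ne\emptyset$. Then there is $\alpha_0>0$ such that for every $\alpha\in(0,\alpha_0)$: $\mathrm{LS}(\mathcal U_{f,\tau}(\hat{\mathbb C}))\subset C^\alpha(\hat{\mathbb C})$; there is a constant $E_\alpha>0$ with $\|\pi_\tau(\varphi)\|_\alpha\le E_\alpha\|\varphi\|_\infty$ for all $\varphi\in C^\alpha(\hat{\mathbb C})$; and $T_{L,\tau}\in C^\alpha(\hat{\mathbb C})$ for every $L\in\mathrm{Min}(G_\tau,\hat{\mathbb C})$.
   Context: $\hat{\mathbb C}$, spherical distance $d$; $\mathrm{Rat}$ = non-constant rational maps with $\kappa(f,g)=\sup_zd(f(z),g(z))$; $\langle\Gamma\rangle$, $F(G)$ (equicontinuity set), $J(G)$, $J_{\ker}(G)=\bigcap_{g\in G}g^{-1}(J(G))$, $\mathrm{Min}(G,\hat{\mathbb C})$ (inclusion-minimal non-empty compact $G$-forward-invariant sets), $\gamma_{n,1}=\gamma_n\circ\cdots\circ\gamma_1$. $\mathfrak M_{1,c}(\mathrm{Rat})$ = compactly supported Borel probability measures; $\Gamma_\tau=\mathrm{supp}\,\tau$, $G_\tau=\langle\Gamma_\tau\rangle$, $\tilde\tau=\bigotimes_{j\ge1}\tau$ on $\Gamma_\tau^{\mathbb N}$, $M_\tau\varphi(z)=\int\varphi(g(z))d\tau(g)$. $\mathcal U_{f,\tau}(\hat{\mathbb C})$ = non-zero $\varphi\in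 C(\hat{\mathbb C})$ with $M_\tau\varphi=a\varphi$, $|a|=1$; LS = linear span. Known: under the hypotheses, $C(\hat{\mathbb C})=\mathrm{LS}(\mathcal U_{f,\tau}(\hat{\mathbb C}))\oplus\{\varphi:\|M^n_\tau\varphi\|_\infty\to0\}$, first summand finite-dimensional; $\pi_\tau$ = projection onto it. $T_{L,\tau}(z)=\tilde\tau(\{\gamma:d(\gamma_{n,1}(z),L)\to0\})$. $C^\alpha(\hat{\mathbb C})$ = $\alpha$-Hölder functions (w.r.t. $d$) with norm $\|\varphi\|_\alpha=\sup|\varphi|+\sup_{x\ne y}|\varphi(x)-\varphi(y)|/d(x,y)^\alpha$. *)

(* Defs.v *)
From HB Require Import structures.
From mathcomp Require Import all_boot all_order all_algebra.
From mathcomp Require Import all_classical all_reals all_analysis.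
From mathcomp.real_closed Require Import complex.

Set Implicit Arguments.
Unset Strict Implicit.
Unset Printing Implicit Defensive.

Import Order.TTheory GRing.Theory Num.Theory.
Local Open Scope classical_set_scope.
Local Open Scope ring_scope.

Section Defs.
Variable R : realType.

Definition cabs (z : R[i]) : R := Num.sqrt (complex.Re z ^+ 2 + complex.Im z ^+ 2).

(* Riemann sphere: None is the point at infinity *)
Definition sphere := option R[i].

(* chordal distance (stereographic projection to the unit sphere of R^3) *)
Definition chordal (z w : sphere) : R :=
  match z, w with
  | Some a, Some b =>
      2 * cabs (a - b) / Num.sqrt ((1 + cabs a ^+ 2) * (1 + cabs b ^+ 2))
  | Some a, None | None, Some a => 2 / Num.sqrt (1 + cabs a ^+ 2)
  | None, None => 0
  end.

(* spherical (great-circle) distance d on the unit sphere *)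
Definition sdist (z w : sphere) : R := 2 * asin (chordal z w / 2).

Definition mopen {T : Type} (dist : T -> T -> R) (U : set T) : Prop :=
  forall x, U x -> exists2 r : R, 0 < r & forall y, dist x y < r -> U y.

Definition mcompact {T : Type} (dist : T -> T -> R) (K : set T) : Prop :=
  forall (F : set (set T)), (forall U, F U -> mopen dist U) ->
    K `<=` \bigcup_(U in F) U ->
    exists s : seq (set T), (forall U, U \in s -> F U) /\
      K `<=` (fun x => exists2 U, U \in s & U x).

Definition ratfun (P Q : {poly R[i]}) (z : sphere) : sphere :=
  match z with
  | Some a => if Q.[a] != 0 then Some (P.[a] / Q.[a]) else None
  | None =>
      if (size Q < size P)%N then None
      else if (size P < size Q)%N then Some 0
      else Some (lead_coef P / lead_coef Q)
  end.

Definition isRat (f : sphere -> sphere) : Prop :=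
  exists P Q : {poly R[i]}, coprimep P Q /\ ((1 < size P)%N \/ (1 < size Q)%N)
                            /\ f = ratfun P Q.

Lemma isRat_id : isRat id.
Proof.
exists 'X, 1; split; first exact: coprimep1.
split; first by left; rewrite size_polyX.
apply: funext => -[a|] /=.
  by rewrite hornerC oner_neq0 hornerX divr1.
by rewrite size_polyX size_poly1.
Qed.

End Defs.

Definition RatT (R : realType) := {f : sphere R -> sphere R | isRat f}.

HB.instance Definition _ (R : realType) := gen_eqMixin (RatT R).
HB.instance Definition _ (R : realType) := gen_choiceMixin (RatT R).
HB.instance Definition _ (R : realType) :=
  isPointed.Build (RatT R) (exist _ id (@isRat_id R)).

Section RatDefs.
Variable R : realType.
Local Notation sphere := (sphere R).
Local Notation d := (@sdist R).

Definition kappa (f g : RatT R) : R := sup [set d (sval f z) (sval g z) | z in [set: sphere]].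

Definition kopen : set (set (RatT R)) := [set U | mopen kappa U].
End RatDefs.

Notation RatM R := (g_sigma_algebraType (@kopen R)).

Notation SeqM R := (g_sigma_algebraType
  [set C : set (nat -> RatM R) | exists (n : nat) (A : nat -> set (RatM R)),
      (forall i, measurable (A i)) /\
      C = [set g | forall i, (i < n)%N -> A i (g i)]]).

Section Dynamics.
Variable R : realType.
Local Notation sphere := (sphere R).
Local Notation d := (@sdist R).

Inductive gen_semigroup (Gam : set (sphere -> sphere)) : set (sphere -> sphere) :=
| gen_base g : Gam g -> gen_semigroup Gam g
| gen_comp g h : gen_semigroup Gam g -> gen_semigroup Gam h ->
                 gen_semigroup Gam (g \o h).

Definition sball (z : sphere) (r : R) : set sphere := [set w | d z w < r].

Definition equicont_on (G : set (sphere -> sphere)) (U : set sphere) : Prop :=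
  forall x, U x -> forall e : R, 0 < e -> exists2 dl : R, 0 < dl &
    forall y, U y -> d x y < dl -> forall g, G g -> d (g x) (g y) < e.

Definition Fatou (G : set (sphere -> sphere)) : set sphere :=
  [set z | exists2 r : R, 0 < r & equicont_on G (sball z r)].
Definition Julia (G : set (sphere -> sphere)) : set sphere := ~` Fatou G.
Definition Jker (G : set (sphere -> sphere)) : set sphere :=
  [set z | forall g, G g -> Julia G (g z)].

Definition fwd_inv (G : set (sphere -> sphere)) (K : set sphere) : Prop :=
  forall g, G g -> forall z, K z -> K (g z).
Definition Minset (G : set (sphere -> sphere)) (L : set sphere) : Prop :=
  [/\ L !=set0, mcompact d L, fwd_inv G L &
      forall K, K `<=` L -> K !=set0 -> mcompact d K -> fwd_inv G K -> K = L].

Variable tau : probability (RatM R) R.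

Definition Gamma_tau : set (RatT R) :=
  [set f | forall r : R, 0 < r -> (0 < tau [set g : RatM R | (kappa f g < r)%R])%E].
Definition G_tau : set (sphere -> sphere) :=
  gen_semigroup [set sval f | f in Gamma_tau].

Definition cint (F : RatM R -> R[i]) : R[i] :=
  (Rintegral tau setT (fun g => complex.Re (F g)) +i*
   Rintegral tau setT (fun g => complex.Im (F g)))%C.
Definition Mtau (phi : sphere -> R[i]) : sphere -> R[i] :=
  fun z => cint (fun g : RatM R => phi (sval g z)).

Definition ccont (phi : sphere -> R[i]) : Prop :=
  forall x (e : R), 0 < e -> exists2 dl : R, 0 < dl &
    forall y, d x y < dl -> cabs (phi x - phi y) < e.

Definition Utau (phi : sphere -> R[i]) : Prop :=
  [/\ ccont phi, phi <> (fun=> 0) &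
      exists2 a : R[i], cabs a = 1 & Mtau phi = (fun z => a * phi z)].

Definition LS (S : set (sphere -> R[i])) : set (sphere -> R[i]) :=
  [set psi | exists s : seq (R[i] * (sphere -> R[i])),
     (forall p, p \in s -> S p.2) /\
     psi = (fun z => \sum_(p <- s) p.1 * p.2 z)].

Definition supnorm {V : zmodType} (nrm : V -> R) (phi : sphere -> V) : \bar R :=
  ereal_sup [set (nrm (phi z))%:E | z in [set: sphere]].

Definition B0 : set (sphere -> R[i]) :=
  [set phi | ccont phi /\ forall e : R, 0 < e -> exists N : nat,
     forall n, (N <= n)%N -> (supnorm (@cabs R) (iter n Mtau phi) <= e%:E)%E].

Definition hnorm {V : zmodType} (nrm : V -> R) (a : R) (phi : sphere -> V) : \bar R :=
  (supnorm nrm phi +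
   ereal_sup [set (nrm (phi xy.1 - phi xy.2) / powR (d xy.1 xy.2) a)%:E
             | xy in [set xy : sphere * sphere | xy.1 <> xy.2]])%E.
Definition holder {V : zmodType} (nrm : V -> R) (a : R) (phi : sphere -> V) : Prop :=
  (hnorm nrm a phi < +oo)%E.

(* gamma_{n,1}(z) = gamma_n o ... o gamma_1 (z), sequences indexed from 0 *)
Fixpoint itcomp (g : nat -> RatM R) (n : nat) (z : sphere) : sphere :=
  match n with
  | O => z
  | S m => sval (g m) (itcomp g m z)
  end.

Definition distset (z : sphere) (L : set sphere) : R := inf [set d z w | w in L].

Definition is_prod_tau (P : probability (SeqM R) R) : Prop :=
  forall (n : nat) (A : nat -> set (RatM R)), (forall i, measurable (A i)) ->
    P [set g : SeqM R | forall i, (i < n)%N -> A i (g i)] =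
    (\prod_(i < n) tau (A i))%E.

Definition Ttau (P : probability (SeqM R) R) (L : set sphere) (z : sphere) : R :=
  fine (P [set g : SeqM R | forall e : R, 0 < e -> exists N : nat,
               forall n, (N <= n)%N -> distset (itcomp g n z) L < e]).

End Dynamics.

(* Main.v *)
Require Import Defs.
From HB Require Import structures.
From mathcomp Require Import all_boot all_order all_algebra.
From mathcomp Require Import all_classical all_reals all_analysis measurable_realfun.
From mathcomp.real_closed Require Import complex.
From mathcomp Require Import ring lra.
Import Order.TTheory GRing.Theory Num.Theory.
Import numFieldNormedType.Exports.
Set Implicit Arguments.
Unset Strict Implicit.
Unset Printing Implicit Defensive.
Local Open Scope classical_set_scope.
Local Open Scope ring_scope.

(** Write [e] for a bounded function on pairs of points which is dominated by its own average
    [e x y <= \int e (f x) (f y) d tau f] and is small at pairs that the whole semigroup keeps close.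
    Every such [e] satisfies [e x y <= c * sup e * d(x,y)^a], with [a] and [c] depending on [tau] only.
    Indeed [e] vanishes near the diagonal over the Fatou set, because there the semigroup brings
    nearby points arbitrarily close together, while by emptiness of the kernel Julia set and compactness
    a random word sends any two sufficiently close points into that region with a probability bounded
    below after boundedly many steps.  Each such block of steps multiplies the bound on [e] by some
    [q < 1] and the distance by at most a constant Lipschitz factor, which gives Hölder decay.

    The contraction over the Fatou set is proved without hyperbolic geometry: if some limit map in a
    minimal closed invariant set of the pointwise closure of the semigroup were non-constant near a
    Fatou point, its image would contain a ball on which the semigroup is recurrent; the points near
    which almost-identity on a finite set forces almost-identity would then form a non-empty open and
    closed set, and the semigroup would be normal everywhere, contradicting that the Julia set is
    non-empty.

    For a combination [psi = \sum c_i phi_i] of unimodular eigenfunctions with eigenvalues [a_i], take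
    [e x y = sup_n |Theta_n x - Theta_n y|] with [Theta_n = \sum c_i a_i^-n phi_i], so that
    [M Theta_(n+1) = Theta_n]; recurrence of [(a_i^n)] bounds [Theta_n] by the sup norm of [phi] whenever
    [M^n (phi - psi)] tends to [0].  For [T_L], take for [e x y] the probability that the orbits of [x]
    and [y] are infinitely often [1/k] apart, and let [k] tend to infinity. *)

(** * The chordal metric *)

(** Estimates are made in the chordal metric, which is algebraic in homogeneous coordinates,
    invariant under inversion and satisfies [chordal <= sdist <= 2 * chordal]. Since every map in
    sight is rational, function theory reduces to pole-free quotients of polynomials on discs, and
    the constants must be uniform over the whole semigroup. Limits of semigroup elements exist only
    pointwise and may be discontinuous at Julia points. Compactness therefore comes from Tychonoff,
    and a limit map is only ever tested on finite sets of points. The main obstacle is that the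
    semigroup is not equicontinuous at a Julia point p. Precomposition removes it: emptiness of the
    kernel gives w in G with w p normal, so the family of all g o w is equicontinuous at p. If
    members of this family come arbitrarily close to the identity on a ball around p, normality
    passes to p itself. The dynamical part sees the measure only through the masses of uniform
    neighbourhoods of generators. The exponent is ln(1/q) / ln K with K = Lam^N, where N is the
    block length, Lam a common Lipschitz constant of the generators and 1 - q the probability gained
    per block. *)

Section Cabs.
Variable R : realType.
Implicit Types (z w : R[i]).

Lemma cabsE z : cabs z = Normc.normc z.
Proof. by case: z. Qed.
Lemma cabs_ge0 z : 0 <= cabs z.
Proof. exact: sqrtr_ge0. Qed.
Lemma cabsM z w : cabs (z * w) = cabs z * cabs w.
Proof. by rewrite !cabsE Normc.normcM. Qed.
Lemma cabsV z : cabs z^-1 = (cabs z)^-1.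
Proof. by rewrite !cabsE Normc.normcV. Qed.
Lemma cabs0 : cabs (0 : R[i]) = 0.
Proof. by rewrite cabsE Normc.normc0. Qed.
Lemma cabs1 : cabs (1 : R[i]) = 1.
Proof. by rewrite cabsE Normc.normc1. Qed.
Lemma cabs_eq0 z : (cabs z == 0) = (z == 0).
Proof.
apply/eqP/eqP => [|->]; last exact: cabs0.
by rewrite cabsE => /Normc.eq0_normc.
Qed.
Lemma cabs_gt0 z : (0 < cabs z) = (z != 0).
Proof. by rewrite lt_def cabs_ge0 andbT cabs_eq0. Qed.
Lemma cabsD z w : cabs (z + w) <= cabs z + cabs w.
Proof. by rewrite !cabsE; exact: le_normcD. Qed.
Lemma cabsN z : cabs (- z) = cabs z.
Proof. by rewrite !cabsE normcN. Qed.
Lemma cabsB z w : cabs (z - w) = cabs (w - z).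
Proof. by rewrite -cabsN opprB. Qed.
Lemma cabs_tri v z w : cabs (z - w) <= cabs (z - v) + cabs (v - w).
Proof. by apply: le_trans (cabsD _ _); rewrite addrA subrK. Qed.
Lemma cabs_lb z w : cabs z - cabs w <= cabs (z - w).
Proof. by rewrite lerBlDr; apply: le_trans (cabsD _ _); rewrite subrK. Qed.
Lemma cabsX z n : cabs (z ^+ n) = cabs z ^+ n.
Proof. by elim: n => [|n IH]; rewrite ?expr0 ?cabs1 // !exprS cabsM IH. Qed.
Lemma cabs_real (t : R) : cabs (t%:C)%C = `|t|.
Proof. by rewrite /cabs /= expr0n /= addr0 sqrtr_sqr. Qed.
Lemma cabs_sum I (s : seq I) (P : pred I) (F : I -> R[i]) :
  cabs (\sum_(i <- s | P i) F i) <= \sum_(i <- s | P i) cabs (F i).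
Proof.
elim/big_ind2 : _ => [|x1 x2 y1 y2 h1 h2|//]; first by rewrite cabs0.
by apply: le_trans (cabsD _ _) _; apply: lerD.
Qed.
Lemma cabs_conj z : cabs (z^*)%C = cabs z.
Proof. by case: z => a b; rewrite /cabs /= sqrrN. Qed.
Lemma cabs_sqr z : cabs z ^+ 2 = complex.Re z ^+ 2 + complex.Im z ^+ 2.
Proof. by rewrite sqr_sqrtr // addr_ge0 // sqr_ge0. Qed.
Lemma mul_conj z : (z^*)%C * z = ((cabs z ^+ 2)%:C)%C.
Proof.
case: z => a b; rewrite cabs_sqr /=; apply/eqP; rewrite eq_complex /=.
by apply/andP; split; apply/eqP; ring.
Qed.
Lemma cabs_le_Re_Im z : cabs z <= `|complex.Re z| + `|complex.Im z|.
Proof.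
case: z => a b.
have -> : (a +i* b)%C = (a%:C)%C + 'i%C * (b%:C)%C.
  by apply/eqP; rewrite eq_complex /=; apply/andP; split; apply/eqP; ring.
apply: le_trans (cabsD _ _) _; rewrite cabsM !cabs_real /=.
have -> : cabs ('i%C : R[i]) = 1 by rewrite /cabs /= expr0n expr1n add0r sqrtr1.
by rewrite !(mul0r, mul1r, mulr0, subr0, addr0, add0r).
Qed.
Lemma Re_le_cabs z : `|complex.Re z| <= cabs z.
Proof.
by rewrite -sqrtr_sqr ler_wsqrtr // lerDl sqr_ge0.
Qed.
Lemma Im_le_cabs z : `|complex.Im z| <= cabs z.
Proof.
by rewrite -sqrtr_sqr ler_wsqrtr // lerDr sqr_ge0.
Qed.
End Cabs.

Section Chordal.
Variable R : realType.
Local Notation S := (sphere R).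

Definition hnum (p : S) : R[i] := if p is Some z then z else 1.
Definition hden (p : S) : R[i] := if p is Some _ then 1 else 0.
Definition pnorm (a b : R[i]) : R := Num.sqrt (cabs a ^+ 2 + cabs b ^+ 2).

Lemma pnorm_ge0 a b : 0 <= pnorm a b.
Proof. exact: sqrtr_ge0. Qed.
Lemma pnorm_sqr a b : pnorm a b ^+ 2 = cabs a ^+ 2 + cabs b ^+ 2.
Proof. by rewrite sqr_sqrtr // addr_ge0 // exprn_ge0 // cabs_ge0. Qed.
Lemma hpnorm_ge1 (p : S) : 1 <= pnorm (hnum p) (hden p).
Proof.
rewrite -(@ler_pXn2r _ 2) ?nnegrE ?pnorm_ge0 // pnorm_sqr expr1n.
by case: p => [z|] /=; rewrite cabs1 expr1n ?cabs0 ?expr0n /= ?addr0 ?lerDr ?sqr_ge0.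
Qed.
Lemma hpnorm_gt0 (p : S) : 0 < pnorm (hnum p) (hden p).
Proof. exact: lt_le_trans (hpnorm_ge1 p). Qed.

(* homogeneous coordinates (hnum p : hden p) make the formula uniform in the point at infinity *)
Lemma chordalE (p q : S) : chordal p q =
  2 * cabs (hnum p * hden q - hnum q * hden p) /
    (pnorm (hnum p) (hden p) * pnorm (hnum q) (hden q)).
Proof.
rewrite /pnorm -sqrtrM ?addr_ge0 ?sqr_ge0 //.
case: p => [a|]; case: q => [b|] /=;
  rewrite ?cabs1 ?cabs0 ?expr1n ?expr0n /= ?mulr1 ?mul1r ?mulr0 ?mul0r ?addr0 ?subr0 ?sub0r ?subrr ?cabsN ?cabs0 ?cabs1 ?mulr0 ?mul0r ?mulr1 //.
- by rewrite ![_ + 1]addrC.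
- by rewrite addrC.
- by rewrite mul1r addrC.
Qed.

Lemma chordal_ge0 (p q : S) : 0 <= chordal p q.
Proof.
by rewrite chordalE divr_ge0 ?mulr_ge0 ?cabs_ge0 ?pnorm_ge0.
Qed.
Lemma chordalxx (p : S) : chordal p p = 0.
Proof. by rewrite chordalE subrr cabs0 mulr0 mul0r. Qed.
Lemma chordalC (p q : S) : chordal p q = chordal q p.
Proof. by rewrite !chordalE cabsB [X in _ / X]mulrC. Qed.
Lemma chordal_eq0 (p q : S) : chordal p q = 0 -> p = q.
Proof.
rewrite chordalE => /eqP; rewrite mulf_eq0 invr_eq0 mulf_eq0 pnatr_eq0 /= cabs_eq0.
have := mulr_gt0 (hpnorm_gt0 p) (hpnorm_gt0 q) => /gt_eqF ->; rewrite orbF subr_eq0.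
case: p => [a|]; case: q => [b|] /=; rewrite ?mulr1 ?mul0r ?mulr0 //.
- by move/eqP->.
- by rewrite eq_sym oner_eq0.
- by rewrite oner_eq0.
Qed.

(** Cauchy-Schwarz in C^2; after the triangle inequality it is Lagrange's identity for the four
    moduli. *)
Lemma pnorm_cs (a b c d : R[i]) :
  cabs (a * c + b * d) <= pnorm a b * pnorm c d.
Proof.
apply: le_trans (cabsD _ _) _; rewrite !cabsM.
rewrite -(@ler_pXn2r _ 2) ?nnegrE ?mulr_ge0 ?pnorm_ge0 ?addr_ge0 ?mulr_ge0 ?cabs_ge0 //.
rewrite exprMn !pnorm_sqr.
move: (cabs a) (cabs b) (cabs c) (cabs d) => x y u v.
rewrite -subr_ge0.
have -> : (x ^+ 2 + y ^+ 2) * (u ^+ 2 + v ^+ 2) - (x * u + y * v) ^+ 2 = (x * v - y * u) ^+ 2 by ring.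
exact: sqr_ge0.
Qed.

Lemma pnorm_conj (a b : R[i]) : pnorm (a^*)%C (b^*)%C = pnorm a b.
Proof. by rewrite /pnorm !cabs_conj. Qed.

Lemma chordal_le2 (p q : S) : chordal p q <= 2.
Proof.
rewrite chordalE ler_pdivrMr ?mulr_gt0 ?hpnorm_gt0 // ler_pM2l //.
have -> : hnum p * hden q - hnum q * hden p = hnum p * hden q + hden p * (- hnum q) by ring.
apply: le_trans (pnorm_cs _ _ _ _) _.
by rewrite [X in _ * X]/pnorm cabsN [X in Num.sqrt X]addrC.
Qed.

(** The Plücker-type identity in [key] writes (af - eb) |(c,d)|^2 as a combination of the two other
    determinants, with Hermitian products as coefficients; Cauchy-Schwarz bounds these
    coefficients. *)
Lemma chordal_triangle (q p r : S) : chordal p r <= chordal p q + chordal q r.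
Proof.
rewrite !chordalE.
set a := hnum p; set b := hden p; set c := hnum q; set d := hden q; set e := hnum r; set f := hden r.
have Np := hpnorm_gt0 p; have Nq := hpnorm_gt0 q; have Nr := hpnorm_gt0 r.
rewrite -/a -/b in Np; rewrite -/c -/d in Nq; rewrite -/e -/f in Nr.
have key : cabs (a * f - e * b) * pnorm c d ^+ 2 <=
   cabs (a * d - c * b) * (pnorm c d * pnorm e f) + cabs (c * f - e * d) * (pnorm c d * pnorm a b).
  have -> : cabs (a * f - e * b) * pnorm c d ^+ 2 =
     cabs ((a * d - c * b) * ((c^*)%C * e + (d^*)%C * f) + (c * f - e * d) * ((c^*)%C * a + (d^*)%C * b)).
    have -> : (a * d - c * b) * ((c^*)%C * e + (d^*)%C * f) + (c * f - e * d) * ((c^*)%C * a + (d^*)%C * b) =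
      (a * f - e * b) * ((c^*)%C * c + (d^*)%C * d) by ring.
    rewrite cabsM !mul_conj pnorm_sqr -rmorphD /= cabs_real ger0_norm //.
    by rewrite addr_ge0 ?sqr_ge0.
  apply: le_trans (cabsD _ _) _; rewrite !cabsM.
  by apply: lerD; apply: ler_wpM2l; rewrite ?cabs_ge0 // -(pnorm_conj c d); exact: pnorm_cs.
move: key Np Nq Nr; move: (pnorm a b) (pnorm c d) (pnorm e f) => x y z key x0 y0 z0.
move: (cabs (a * f - e * b)) (cabs (a * d - c * b)) (cabs (c * f - e * d)) key => A B C key.
have -> : 2 * A / (x * z) = 2 * (A * y ^+ 2) / (x * z * y ^+ 2).
  by field; rewrite !gt_eqF.
have -> : 2 * B / (x * y) + 2 * C / (y * z) = 2 * (B * (y * z) + C * (y * x)) / (x * z * y ^+ 2).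
  by field; rewrite !gt_eqF.
by rewrite ler_pM2r ?invr_gt0 ?mulr_gt0 ?exprn_gt0 // ler_pM2l.
Qed.

HB.instance Definition _ := Choice.copy S (option R[i]).
HB.instance Definition _ := isMetric.Build R S chordalxx chordal_eq0 chordalC chordal_triangle.

Lemma sphere_ballE (p : S) (e : R) : ball p e = [set q | chordal p q < e].
Proof. exact: ballEmdist. Qed.

Lemma chordal_le_cabs (z w : R[i]) : chordal (Some z) (Some w) <= 2 * cabs (z - w).
Proof.
rewrite chordalE /= !mulr1 ler_pdivrMr ?mulr_gt0 ?hpnorm_gt0 //.
  rewrite ler_peMr ?mulr_ge0 ?cabs_ge0 //.
  exact: mulr_ege1 (hpnorm_ge1 (Some z)) (hpnorm_ge1 (Some w)).
exact: (hpnorm_gt0 (Some z)).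
exact: (hpnorm_gt0 (Some w)).
Qed.

(** For modulus at most K the norm of (z, 1) is at most 1 + K; the factor 2 of the chordal formula
    is given away. *)
Lemma cabs_le_chordal (K : R) (z w : R[i]) : cabs z <= K -> cabs w <= K ->
  cabs (z - w) <= (1 + K) ^+ 2 * chordal (Some z) (Some w).
Proof.
move=> zK wK.
have K0 : 0 <= K by apply: le_trans zK; exact: cabs_ge0.
have H x : cabs x <= K -> pnorm x 1 <= 1 + K.
  move=> xK; rewrite -(@ler_pXn2r _ 2) ?nnegrE ?pnorm_ge0 ?addr_ge0 // pnorm_sqr cabs1.
  have := cabs_ge0 x; nra.
have z1 := hpnorm_gt0 (Some z); have w1 := hpnorm_gt0 (Some w); rewrite /= in z1 w1.
rewrite chordalE /= !mulr1.
have := H _ zK; have := H _ wK; have := cabs_ge0 (z - w).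
move: z1 w1; move: (pnorm z 1) (pnorm w 1) (cabs (z - w)) => x y A x0 y0 A0 yK xK.
rewrite mulrA ler_pdivlMr ?mulr_gt0 //.
have : x * y <= (1 + K) ^+ 2 by rewrite expr2; apply: ler_pM => //; apply: ltW.
have : 0 <= (1 + K) ^+ 2 by exact: sqr_ge0.
move: (x * y) ((1 + K) ^+ 2) => u v v0 uv.
apply: le_trans (ler_wpM2l A0 uv) _.
have := mulr_ge0 A0 v0; lra.
Qed.

Lemma nbhs_chordal (p : S) (A : set S) :
  nbhs p A <-> exists2 e : R, 0 < e & forall q, chordal p q < e -> A q.
Proof.
split => [/nbhs_ballP[e /= e0 h]|[e e0 h]].
  by exists e => // q pq; apply: h; rewrite sphere_ballE.
by apply/nbhs_ballP; exists e => //= q; rewrite sphere_ballE; exact: h.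
Qed.

Lemma continuous_chordal (T : topologicalType) (f : T -> S) :
  (forall t (e : R), 0 < e -> \forall t' \near t, chordal (f t) (f t') < e) -> continuous f.
Proof.
move=> h t; apply/cvg_ballP => e e0.
by have := h t e e0; apply: filterS => x; rewrite sphere_ballE.
Qed.

Definition sinv (p : S) : S :=
  if p is Some z then (if z == 0 then None else Some z^-1) else Some 0.

Lemma sinvK : involutive sinv.
Proof.
case=> [z|] /=; last by rewrite eqxx.
by have [->//|z0] := eqVneq z 0; rewrite /= invr_eq0 (negbTE z0) invrK.
Qed.

(** Inversion swaps the homogeneous coordinates up to a common scalar, and the determinant and the
    norms scale alike. Thus [sinv] serves as a second, isometric chart around infinity. *)
Lemma chordal_sinv p q : chordal (sinv p) (sinv q) = chordal p q.
Proof.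
rewrite !chordalE.
have H (x : S) : exists2 l : R[i], l != 0 & hnum (sinv x) * l = hden x /\ hden (sinv x) * l = hnum x.
  case: x => [z|] /=; last by exists 1; rewrite ?oner_neq0 // mul0r mul1r.
  have [->|z0] /= := eqVneq z 0; first by exists 1; rewrite ?oner_neq0 // mul0r mul1r.
  by exists z => //; rewrite mulVf // mul1r.
have [l l0 [<- <-]] := H p; have [m m0 [<- <-]] := H q.
move: (hnum (sinv p)) (hden (sinv p)) (hpnorm_gt0 (sinv p)) => a b ab.
move: (hnum (sinv q)) (hden (sinv q)) (hpnorm_gt0 (sinv q)) => c d cd.
have K x y z : pnorm (x * z) (y * z) = cabs z * pnorm y x.
  rewrite /pnorm !cabsM !exprMn -mulrDl sqrtrM ?addr_ge0 ?sqr_ge0 //.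
  by rewrite sqrtr_sqr ger0_norm ?cabs_ge0 // mulrC addrC.
rewrite !K.
have -> : b * l * (c * m) - d * m * (a * l) = (l * m) * (- (a * d - c * b)) by ring.
rewrite !cabsM cabsN.
by field; rewrite !cabs_eq0 l0 m0 !gt_eqF.
Qed.

Lemma sinv_chart (p : S) : exists z, cabs z <= 1 /\ (p = Some z \/ p = sinv (Some z)).
Proof.
case: p => [z|]; last by exists 0; rewrite cabs0 ler01 /= eqxx; split; [|right].
have [z1|z1] := lerP (cabs z) 1; first by exists z; split; [|left].
have z0 : z != 0 by rewrite -cabs_gt0; exact: lt_trans z1.
exists z^-1; split; first by rewrite cabsV invf_le1 ?ltW // cabs_gt0.
by right; rewrite /= invr_eq0 (negbTE z0) invrK.
Qed.

Lemma sinv_continuous : continuous sinv.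
Proof.
apply: continuous_chordal => t e e0; apply/nbhs_chordal; exists e => // q.
by rewrite chordal_sinv.
Qed.

(** The two unit-disc charts present the sphere as the union of two continuous images of the square
    [-1, 1]^2. *)
Lemma sphere_compact : compact [set: S].
Proof.
pose j (p : R * R) : S := Some (p.1 +i* p.2)%C.
have jc : continuous j.
  apply: continuous_chordal => t e e0.
  have e40 : 0 < e / 4 by rewrite divr_gt0.
  apply/nbhs_ballP; exists (e / 4) => //= q [/= q1 q2].
  apply: le_lt_trans (chordal_le_cabs _ _) _.
  apply: le_lt_trans (ler_wpM2l (ler0n _ 2) (cabs_le_Re_Im _)) _.
  rewrite /ball /= in q1 q2; rewrite /=; lra.
have cj : compact (j @` (`[-1, 1] `*` `[-1, 1])).
  apply: continuous_compact; last by apply: compact_setX; exact: segment_compact.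
  exact: continuous_subspaceT.
have ci : compact (sinv @` (j @` (`[-1, 1] `*` `[-1, 1]))).
  apply: continuous_compact => //.
  by apply: continuous_subspaceT; exact: sinv_continuous.
have -> : [set: S] = j @` (`[-1, 1] `*` `[-1, 1]) `|` sinv @` (j @` (`[-1, 1] `*` `[-1, 1])).
  apply/seteqP; split => // p _.
  have [z [z1 zp]] := sinv_chart p.
  have jz : (j @` (`[-1, 1] `*` `[-1, 1])) (Some z).
    exists (complex.Re z, complex.Im z); last by rewrite /j; case: (z).
    by split; rewrite /= in_itv /= -ler_norml; [apply: le_trans (Re_le_cabs z) _ | apply: le_trans (Im_le_cabs z) _].
  by case: zp => ->; [left|right; exists (Some z)].
exact: compactU.
Qed.
End Chordal.

(** * Rational functions on discs *)

Section Disc.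
Variable R : realType.
Local Notation C := R[i].
Local Notation S := (sphere R).
Implicit Types (c z w : C) (r M : R).

Lemma poly_bound (p : {poly C}) (K : R) :
  exists2 M : R, 0 < M & forall z, cabs z <= K -> cabs p.[z] <= M.
Proof.
elim/poly_ind: p => [|p a [M M0 h]].
  by exists 1 => // z _; rewrite horner0 cabs0.
exists (M * `|K| + cabs a + 1).
  have := cabs_ge0 a; have := mulr_ge0 (ltW M0) (normr_ge0 K); lra.
move=> z zK; rewrite hornerMXaddC; apply: le_trans (cabsD _ _) _; rewrite cabsM.
have : cabs p.[z] * cabs z <= M * `|K|.
  by apply: ler_pM; rewrite ?cabs_ge0 ?h // (le_trans zK) // ler_norm.
lra.
Qed.

Lemma poly_divdiff (p : {poly C}) (a : C) :
  exists q : {poly C}, forall z, p.[z] - p.[a] = (z - a) * q.[z].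
Proof.
have /factor_theorem[q Eq] : root (p - p.[a]%:P) a by rewrite rootE !hornerE subrr.
exists q => z; have := congr1 (fun u => u.[z]) Eq; rewrite !hornerE => ->.
by rewrite mulrC.
Qed.

Lemma poly_cont (p : {poly C}) (a : C) (e : R) : 0 < e ->
  exists2 d : R, 0 < d & forall z, cabs (z - a) < d -> cabs (p.[z] - p.[a]) < e.
Proof.
move=> e0; have [q qE] := poly_divdiff p a.
have [M M0 qM] := poly_bound q (cabs a + 1).
exists (Num.min 1 (e / M)); first by rewrite lt_min ltr01 divr_gt0.
move=> z; rewrite lt_min => /andP[z1 z2]; rewrite qE cabsM.
have zM : cabs q.[z] <= M.
  by apply: qM; have := cabs_lb z a; lra.
apply: le_lt_trans (ler_wpM2l (cabs_ge0 _) zM) _.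
by rewrite -ltr_pdivlMr.
Qed.

(** Plays the role of holomorphic functions on a closed disc. The class is stable under divided
    differences, so the maximum principle and the Schwarz lemma become polynomial algebra, with
    neither power series nor integrals. *)
Definition ratdisc c r (f : C -> C) : Prop :=
  exists P Q : {poly C}, forall z, cabs (z - c) <= r -> Q.[z] != 0 /\ f z = P.[z] / Q.[z].

Lemma ratdisc_sub c r c' r' f : (forall z, cabs (z - c') <= r' -> cabs (z - c) <= r) ->
  ratdisc c r f -> ratdisc c' r' f.
Proof. by move=> h [P [Q H]]; exists P, Q => z /h; exact: H. Qed.

Lemma ratdisc_shrink c r a t f : cabs (a - c) + t <= r -> ratdisc c r f -> ratdisc a t f.
Proof.
move=> h; apply: ratdisc_sub => z zt; apply: le_trans (cabs_tri a _ _) _; lra.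
Qed.

Lemma ratdisc_inv c r f : ratdisc c r f -> (forall z, cabs (z - c) <= r -> f z != 0) ->
  ratdisc c r (fun z => (f z)^-1).
Proof.
move=> [P [Q H]] f0; exists Q, P => z zr; have [Qz fz] := H z zr.
by have := f0 z zr; rewrite fz mulf_eq0 invr_eq0 negb_or => /andP[P0 _]; rewrite invfM invrK mulrC.
Qed.

Lemma ratdisc_sub_poly c r f (p : {poly C}) : ratdisc c r f -> ratdisc c r (fun z => f z - p.[z]).
Proof.
move=> [P [Q H]]; exists (P - p * Q), Q => z zr; have [Qz fz] := H z zr; split => //.
by rewrite fz !hornerE; field.
Qed.

Lemma ratdisc_subC c r f w : ratdisc c r f -> ratdisc c r (fun z => f z - w).
Proof.
move=> /(ratdisc_sub_poly (w%:P)) [P [Q H]]; exists P, Q => z /H.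
by rewrite hornerC.
Qed.

Lemma ratdisc_divdiff c r f a : cabs (a - c) <= r -> ratdisc c r f ->
  exists2 h, ratdisc c r h & forall z, cabs (z - c) <= r -> f z - f a = (z - a) * h z.
Proof.
move=> ar [P [Q H]]; have [Qa fa] := H a ar.
have [q qE] := poly_divdiff (P * (Q.[a])%:P - Q * (P.[a])%:P) a.
exists (fun z => q.[z] / (Q * (Q.[a])%:P).[z]).
  exists q, (Q * (Q.[a])%:P) => z /H[Qz _]; split => //.
  by rewrite !hornerE mulf_neq0.
move=> z zr; have [Qz fz] := H z zr; rewrite fz fa mulrA -qE !hornerE; field.
by rewrite Qa Qz.
Qed.

Lemma ratdisc_cont c r f a : cabs (a - c) <= r -> ratdisc c r f -> forall e : R, 0 < e ->
  exists2 d : R, 0 < d & forall z, cabs (z - c) <= r -> cabs (z - a) < d -> cabs (f z - f a) < e.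
Proof.
move=> ar [P [Q H]] e e0; have [Qa fa] := H a ar.
have Q0 : 0 < cabs Q.[a] by rewrite cabs_gt0.
have [d1 d10 h1] := @poly_cont Q a (cabs Q.[a] / 2) (divr_gt0 Q0 (ltr0n _ 2)).
have e1 : 0 < e * cabs Q.[a] ^+ 2 / 2 by rewrite divr_gt0 ?mulr_gt0 // exprn_gt0.
have [d2 d20 h2] := poly_cont (P * (Q.[a])%:P - Q * (P.[a])%:P) a e1.
exists (Num.min d1 d2); first by rewrite lt_min d10.
move=> z zr; rewrite lt_min => /andP[z1 z2]; have [Qz fz] := H z zr.
have {}h1 := h1 _ z1; have {h2} := h2 _ z2; rewrite !(hornerD, hornerN, hornerM, hornerC) => h2.
have Qz2 : cabs Q.[a] / 2 < cabs Q.[z].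
  have := cabs_lb Q.[a] Q.[z]; rewrite cabsB; lra.
have Qz0 : 0 < cabs Q.[z] by rewrite cabs_gt0.
rewrite fz fa.
have -> : P.[z] / Q.[z] - P.[a] / Q.[a] =
   (P.[z] * Q.[a] - Q.[z] * P.[a] - (P.[a] * Q.[a] - Q.[a] * P.[a])) / (Q.[z] * Q.[a]).
  by field; rewrite Qa Qz.
rewrite cabsM cabsV cabsM ltr_pdivrMr ?mulr_gt0 //; apply: (lt_trans h2).
have : e * (cabs Q.[a] / 2 * cabs Q.[a]) < e * (cabs Q.[z] * cabs Q.[a]).
  by rewrite ltr_pM2l // ltr_pM2r.
by apply: le_lt_trans; rewrite le_eqVlt; apply/orP; left; apply/eqP; field.
Qed.

(** The disc is closed in the compact sphere: a finite outside point is kept away by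
    [cabs_le_chordal], and infinity by the bound on the modulus in the disc. *)
Lemma disc_max c r (f : C -> R) : 0 <= r ->
  (forall a, cabs (a - c) <= r -> forall e : R, 0 < e ->
    exists2 d : R, 0 < d & forall z, cabs (z - c) <= r -> cabs (z - a) < d -> `|f z - f a| < e) ->
  exists2 a, cabs (a - c) <= r & forall z, cabs (z - c) <= r -> f z <= f a.
Proof.
move=> r0 fc.
pose A : set S := [set p | exists2 z, p = Some z & cabs (z - c) <= r].
pose F (p : S) : R := if p is Some z then f z else 0.
have K z : cabs (z - c) <= r -> cabs z <= cabs c + r.
  by move=> h; have := cabs_lb z c; lra.
have A0 : A !=set0 by exists (Some c), c => //; rewrite subrr cabs0.
have cA : closed A.
  rewrite -[A]setCK; apply: open_closedC; rewrite openE => p pA; apply/nbhs_chordal.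
  case: p pA => [z|] pA.
    have rz : r < cabs (z - c).
      by rewrite ltNge; apply/negP => h; apply: pA; exists z.
    exists ((cabs (z - c) - r) / (1 + (cabs z + (cabs c + r))) ^+ 2).
      rewrite divr_gt0 ?subr_gt0 // exprn_gt0 //.
      by have := cabs_ge0 z; have := cabs_ge0 c; lra.
    move=> q qz [w qw wr]; move: qz; rewrite {}qw ltr_pdivlMr; last first.
      rewrite exprn_gt0 //; by have := cabs_ge0 z; have := cabs_ge0 c; lra.
    rewrite mulrC => h.
    have := le_lt_trans (@cabs_le_chordal _ (cabs z + (cabs c + r)) z w _ _) h.
    have wK := K _ wr; have := cabs_tri w z c; have := cabs_ge0 z; have := cabs_ge0 w.
    move=> w0 z0 tri /(_ _ _)/wrap[]; [lra|lra|lra].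
  pose KK := cabs c + r.
  exists (2 / (1 + KK)).
    by rewrite divr_gt0 // /KK; have := cabs_ge0 c; lra.
  move=> q qz [w qw wr]; move: qz; rewrite {}qw /chordal.
  rewrite ltNge => /negP; apply.
  rewrite ler_pM2l // lef_pV2 ?posrE; last 2 first.
  - by rewrite /KK; have := cabs_ge0 c; lra.
  - by rewrite sqrtr_gt0; have := sqr_ge0 (cabs w); lra.
  rewrite -(@ler_pXn2r _ 2) ?nnegrE ?sqrtr_ge0 //; last by rewrite /KK; have := cabs_ge0 c; lra.
  rewrite sqr_sqrtr; last by have := sqr_ge0 (cabs w); lra.
  have := K _ wr; rewrite -/KK; have := cabs_ge0 w; nra.
have cptA : compact A by apply: subclosed_compact cA (@sphere_compact R) _.
have cF : {within A, continuous F}.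
  apply/subspace_continuousP => p [a pa ar]; apply/cvgrPdist_lt => e e0.
  have [d d0 fd] := fc a ar e e0.
  rewrite /within /=; apply/nbhs_chordal.
  have K1 : 0 < 1 + (cabs c + r) by have := cabs_ge0 c; lra.
  exists (d / (1 + (cabs c + r)) ^+ 2).
    by rewrite divr_gt0 // exprn_gt0.
  move=> q; rewrite pa => qa [w qw wr]; move: qa; rewrite {}qw => qa /=.
  rewrite distrC; apply: fd => //.
  rewrite cabsB; apply: le_lt_trans (cabs_le_chordal (K _ ar) (K _ wr)) _.
  by rewrite mulrC -ltr_pdivlMr ?exprn_gt0.
have [p pA pmax] := compact_EVT_max A0 cptA cF.
move: pA; rewrite inE => -[a pa ar]; exists a => // z zr.
have := pmax (Some z); rewrite pa /=; apply.
by rewrite inE; exists z.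
Qed.

Lemma rootc (k : nat) (x : C) : (0 < k)%N -> exists y : C, y ^+ k = x.
Proof. by move=> k0; exists (k.-root x); rewrite rootCK. Qed.

(** If the maximum point z0 had modulus above M, then f = f(z0) (1 + (z - z0)^k g(z)) with g(z0)
    nonzero, and a small step in a direction that makes the added term nearly positive would
    increase the modulus. *)
Lemma max_modulus c r f M : 0 < r -> ratdisc c r f ->
  (forall z, cabs (z - c) = r -> cabs (f z) <= M) ->
  forall z, cabs (z - c) <= r -> cabs (f z) <= M.
Proof.
move=> r0 rf fM.
have [z0 z0r z0max] : exists2 a, cabs (a - c) <= r & forall z, cabs (z - c) <= r -> cabs (f z) <= cabs (f a).
  apply: disc_max (ltW r0) _ => a ar e e0.
  have [d d0 h] := ratdisc_cont ar rf e0; exists d => // z zr zd.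
  apply: le_lt_trans (h z zr zd); rewrite ler_norml.
  have := cabs_lb (f z) (f a); have := cabs_lb (f a) (f z); rewrite cabsB; lra.
suff h : cabs (f z0) <= M by move=> z /z0max /le_trans; apply.
rewrite leNgt; apply/negP => Mz0.
have cr : cabs (c + (r%:C)%C - c) = r.
  by rewrite addrC addKr cabs_real ger0_norm // ltW.
have M0 : 0 <= M by apply: le_trans (fM _ cr); exact: cabs_ge0.
have z0lt : cabs (z0 - c) < r.
  rewrite lt_neqAle z0r andbT; apply/eqP => /fM; lra.
have [P [Q H]] := rf; have [Q0 f0] := H z0 z0r.
have fz0 : f z0 != 0 by rewrite -cabs_gt0; exact: le_lt_trans Mz0.
have P0 : P.[z0] != 0 by apply: contra fz0; rewrite f0 => /eqP->; rewrite mul0r.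
(* [N] is the numerator of f/f(z0) - 1. If it vanishes identically, f is constant on the disc and
   the boundary bound is violated; otherwise k is the order of its zero at z0. *)
pose N := P * (Q.[z0])%:P - Q * (P.[z0])%:P.
have fN z : cabs (z - c) <= r -> f z = f z0 * (1 + N.[z] / (P.[z0] * Q.[z])).
  move=> /H[Qz ->]; rewrite f0 /N !hornerE; field; by rewrite Q0 P0 Qz.
have [N0|N0] := eqVneq N 0.
  have := fM _ cr; rewrite fN ?cr // N0 horner0 mul0r addr0 mulr1; lra.
have [k [T /implyP/(_ N0) T0 NE]] := multiplicity_XsubC N z0.
have k0 : (0 < k)%N.
  case: k NE => // NE; move: T0; rewrite rootE => /negP[].
  have : N.[z0] = 0 by rewrite /N !hornerE mulrC subrr.
  by rewrite NE expr0 mulr1 => ->.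
pose g z := T.[z] / (P.[z0]%:P * Q).[z].
have rg : ratdisc c r g.
  exists T, (P.[z0]%:P * Q) => z /H[Qz _]; split => //.
  by rewrite !hornerE mulf_neq0.
have g0 : g z0 != 0.
  by rewrite /g !hornerE mulf_neq0 // invr_eq0 mulf_neq0.
have tau0 : 0 < cabs (g z0) by rewrite cabs_gt0.
(* The direction [om] is unimodular and turns om^k g(z0) into the positive number |g(z0)|. *)
have [om oE] := rootc ((g z0)^-1 * ((cabs (g z0))%:C)%C) k0.
have ok : om ^+ k * g z0 = ((cabs (g z0))%:C)%C by rewrite oE mulrAC mulVf // mul1r.
have o1 : cabs om ^+ k = 1.
  by rewrite -cabsX oE cabsM cabsV cabs_real ger0_norm ?cabs_ge0 // mulVf // gt_eqF.
have o1' : cabs om = 1.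
  by apply/eqP; rewrite -(@pexpr_eq1 _ _ k) ?cabs_ge0 // o1.
have [d d0 gd] := ratdisc_cont z0r rg (divr_gt0 tau0 (ltr0n _ 2)).
pose t : R := Num.min (d / 2) (r - cabs (z0 - c)).
have t0 : 0 < t by rewrite lt_min subr_gt0 z0lt divr_gt0.
pose z := z0 + (t%:C)%C * om.
have zz0 : cabs (z - z0) = t.
  by rewrite /z addrC addKr cabsM o1' mulr1 cabs_real ger0_norm // ltW.
have zr : cabs (z - c) <= r.
  have := cabs_tri z0 z c; rewrite zz0.
  have : t <= r - cabs (z0 - c) by rewrite ge_min lexx orbT.
  lra.
have {}gd : cabs (g z - g z0) < cabs (g z0) / 2.
  apply: gd => //; rewrite zz0.
  have : t <= d / 2 by rewrite ge_min lexx.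
  lra.
have := z0max _ zr; rewrite leNgt => /negP; apply.
rewrite (fN z) // cabsM ltr_pMr ?cabs_gt0 //.
have -> : N.[z] / (P.[z0] * Q.[z]) = (z - z0) ^+ k * g z.
  have -> : N.[z] = T.[z] * (z - z0) ^+ k by rewrite NE !hornerE.
  by rewrite /g hornerM hornerC mulrA [X in _ = X / _]mulrC.
have -> : (z - z0) ^+ k = ((t ^+ k)%:C)%C * om ^+ k.
  by rewrite /z addrC addKr exprMn rmorphXn.
have -> : 1 + ((t ^+ k)%:C)%C * om ^+ k * g z =
   ((1 + t ^+ k * cabs (g z0))%:C)%C + ((t ^+ k)%:C)%C * om ^+ k * (g z - g z0).
  rewrite rmorphD rmorphM /= -ok; ring.
have tk : 0 < t ^+ k by rewrite exprn_gt0.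
have E1 : cabs (((t ^+ k)%:C)%C * om ^+ k * (g z - g z0)) < t ^+ k * (cabs (g z0) / 2).
  rewrite (cabsM (_ * _)) (cabsM _ (om ^+ k)) cabs_real cabsX o1' expr1n mulr1 (ger0_norm (ltW tk)).
  by rewrite (ltr_pM2l tk).
have E2 := cabs_lb (((1 + t ^+ k * cabs (g z0))%:C)%C) (- (((t ^+ k)%:C)%C * om ^+ k * (g z - g z0))).
rewrite cabsN cabs_real opprK ger0_norm in E2; last by have := mulr_gt0 tk tau0; lra.
have := mulr_gt0 tk tau0; lra.
Qed.

(* Schwarz lemma for the divided differences *)
Lemma ratdisc_schwarz c r f M a : 0 < r -> ratdisc c r f ->
  (forall z, cabs (z - c) <= r -> cabs (f z) <= M) -> cabs (a - c) <= r / 2 ->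
  exists2 h, ratdisc c r h & forall z, cabs (z - c) <= r ->
    f z - f a = (z - a) * h z /\ cabs (h z) <= 4 * M / r.
Proof.
move=> r0 rf fM ar2; have ar : cabs (a - c) <= r by lra.
have [h rh hE] := ratdisc_divdiff ar rf; exists h => // z zr; split; first exact: hE.
apply: max_modulus zr => // w wr.
have wr' : cabs (w - c) <= r by rewrite wr.
have := congr1 (@cabs R) (hE w wr'); rewrite cabsM => E.
have wa : r / 2 <= cabs (w - a) by have := cabs_tri a w c; lra.
have : cabs (w - a) * cabs (h w) <= 2 * M.
  rewrite -E; apply: le_trans (cabsD _ _) _; rewrite cabsN.
  by have := fM _ wr'; have := fM _ ar; lra.
rewrite ler_pdivlMr //; have := cabs_ge0 (h w); nra.
Qed.

Lemma ratdisc_lipschitz c r f M a b : 0 < r -> ratdisc c r f ->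
  (forall z, cabs (z - c) <= r -> cabs (f z) <= M) ->
  cabs (a - c) <= r / 2 -> cabs (b - c) <= r ->
  cabs (f b - f a) <= 4 * M / r * cabs (b - a).
Proof.
move=> r0 rf fM ar br; have [h _ H] := ratdisc_schwarz r0 rf fM ar.
have [-> hb] := H b br; rewrite cabsM mulrC; apply: ler_wpM2r => //; exact: cabs_ge0.
Qed.

(* n-th step of the induction: f is split off its Taylor polynomial of degree n *)
Lemma ratdisc_two_disc_aux c r r0 n : 0 < r0 -> r0 <= r -> exists2 K, 0 <= K & forall f M e,
  ratdisc c r f ->
  (forall z, cabs (z - c) <= r -> cabs (f z) <= M) ->
  (forall z, cabs (z - c) <= r0 -> cabs (f z) <= e) ->
  forall z, cabs (z - c) <= r / 4 -> cabs (f z) <= M / 2 ^+ n + K * e.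
Proof.
move=> r00 r0r; have rp : 0 < r by exact: lt_le_trans r0r.
elim: n => [|n [K K0 IH]].
  exists 0 => // f M e _ fM _ z zr; rewrite expr0 divr1 mul0r addr0; apply: fM; lra.
exists (1 + r / 4 * (K * (2 / r0))).
  by rewrite addr_ge0 ?mulr_ge0 ?invr_ge0 // ltW.
move=> f M e rf fM fe z zr.
have cc : cabs (c - c) <= r by rewrite subrr cabs0 ltW.
have [h rh hE] := ratdisc_divdiff cc rf.
have fce : cabs (f c) <= e by apply: fe; rewrite subrr cabs0 ltW.
have bnd s B : 0 < s -> s <= r -> (forall w, cabs (w - c) <= s -> cabs (f w) <= B) ->
   forall w, cabs (w - c) <= s -> cabs (h w) <= 2 * B / s.
  move=> s0 sr fB; apply: max_modulus => //.
    by apply: ratdisc_sub rh => w ws; exact: le_trans sr.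
  move=> w ws; have wr : cabs (w - c) <= r by rewrite ws.
  have := congr1 (@cabs R) (hE w wr); rewrite cabsM ws => E.
  rewrite ler_pdivlMr // mulrC -E; apply: le_trans (cabsD _ _) _; rewrite cabsN.
  have := fB w; rewrite ws lexx => /(_ isT); have := fB c; rewrite subrr cabs0 => /(_ (ltW s0)); lra.
have IHh := IH h _ _ rh (bnd r M rp (lexx r) fM) (bnd r0 e r00 r0r fe) z zr.
have zr' : cabs (z - c) <= r by lra.
have -> : f z = f c + (z - c) * h z by rewrite -hE // addrC subrK.
apply: le_trans (cabsD _ _) _; rewrite cabsM.
(* The divided difference is bounded by 2M/r, and |z - c| <= r/4 turns this into M/2: each step of
   the induction halves the dependence on M. *)
have : cabs (z - c) * cabs (h z) <= r / 4 * (2 * M / r / 2 ^+ n + K * (2 * e / r0)).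
  by apply: ler_pM; rewrite ?cabs_ge0.
have -> : r / 4 * (2 * M / r / 2 ^+ n + K * (2 * e / r0)) = M / 2 ^+ n.+1 + r / 4 * (K * (2 / r0)) * e.
  rewrite exprS; field; by rewrite !gt_eqF // exprn_gt0.
by move=> H; rewrite mulrDl mul1r; lra.
Qed.

(** A quantitative identity principle, uniform in f: first n is chosen to make M / 2^n at most e/2,
    then [e1] to absorb the constant K belonging to that n. *)
Lemma ratdisc_two_disc c r r0 M e : 0 < r0 -> r0 <= r -> 0 < e -> exists2 e1, 0 < e1 & forall f,
  ratdisc c r f ->
  (forall z, cabs (z - c) <= r -> cabs (f z) <= M) ->
  (forall z, cabs (z - c) <= r0 -> cabs (f z) <= e1) ->
  forall z, cabs (z - c) <= r / 4 -> cabs (f z) <= e.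
Proof.
move=> r00 r0r e0.
have [n nE] : exists n : nat, M / 2 ^+ n <= e / 2.
  exists (Num.bound (`|M| / (e / 2))); set n := Num.bound _.
  have h : `|M| / (e / 2) < n%:R by apply: archi_boundP; rewrite divr_ge0 // ltW // divr_gt0.
  have h2 : n%:R <= 2 ^+ n :> R by rewrite -natrX ler_nat ltnW // ltn_expl.
  rewrite ler_pdivrMr ?exprn_gt0 // mulrC -ler_pdivrMr ?divr_gt0 //.
  apply: le_trans (le_trans (ltW h) h2).
  by apply: ler_wpM2r; [rewrite invr_ge0 ltW // divr_gt0 | exact: ler_norm].
have [K K0 H] := ratdisc_two_disc_aux c n r00 r0r.
exists (e / 2 / (K + 1)); first by rewrite !divr_gt0 // ltr_wpDl.
move=> f rf fM fe z zr; apply: le_trans (H f M _ rf fM fe z zr) _.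
have : K * (e / 2 / (K + 1)) <= e / 2.
  rewrite mulrA ler_pdivrMr ?ltr_wpDl // mulrC ler_pM2l ?divr_gt0 //; lra.
lra.
Qed.

(** If w were omitted, 1/(f - w) would be pole-free, at most 2/m on the circle and larger than 2/m
    at the centre, against the maximum principle. *)
Lemma ratdisc_open c r f m w : 0 < r -> 0 < m -> ratdisc c r f ->
  (forall z, cabs (z - c) = r -> m <= cabs (f z - f c)) -> cabs (w - f c) < m / 2 ->
  exists2 z, cabs (z - c) <= r & f z = w.
Proof.
move=> r0 m0 rf fm wm; apply: contrapT => h.
have fw z : cabs (z - c) <= r -> f z - w != 0.
  by move=> zr; rewrite subr_eq0; apply/eqP => E; apply: h; exists z.
have := max_modulus (M := 2 / m) r0 (ratdisc_inv (ratdisc_subC w rf) fw) _ (z := c).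
have cc : cabs (c - c) <= r by rewrite subrr cabs0 ltW.
have p0 : 0 < cabs (f c - w) by rewrite cabs_gt0 fw.
rewrite cc => /(_ _ isT)/wrap[z zr|].
  have := fm z zr; have zr' : cabs (z - c) <= r by rewrite zr.
  have := cabs_tri w (f z) (f c); have : 0 < cabs (f z - w) by rewrite cabs_gt0 fw.
  rewrite cabsV => q0 h1 h2; rewrite -[2 / m]invrK lef_pV2 ?posrE ?invr_gt0 ?divr_gt0 //.
  by rewrite invf_div; lra.
rewrite cabsV -[2 / m]invrK lef_pV2 ?posrE ?invr_gt0 ?divr_gt0 // invf_div cabsB; lra.
Qed.

(* Along a fine enough subdivision of [a, b] some divided difference is large, and it stays large
   on a small circle, so that ratdisc_open applies. *)
Lemma ratdisc_image_ball r M m : 0 < r -> 0 < M -> 0 < m -> exists2 s, 0 < s & forall c f a b,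
  ratdisc c r f -> (forall z, cabs (z - c) <= r -> cabs (f z) <= M) ->
  cabs (a - c) <= r / 4 -> cabs (b - c) <= r / 4 -> m <= cabs (f a - f b) ->
  exists2 a', cabs (a' - c) <= r / 4 & forall w, cabs (w - f a') < s ->
    exists2 z, cabs (z - c) <= r / 2 & f z = w.
Proof.
move=> r0 M0 m0.
(* [q] bounds a divided difference from below: some step of the subdivision moves f by m/n while the
   argument moves by at most r/(2n). [K] is the Lipschitz constant of the divided difference, from
   applying the Schwarz bound twice. The number of steps makes 4Kt <= q, so at least q/2 survives on
   the circle of radius t. *)
pose q := 2 * m / r; pose K := 16 * M / r ^+ 2.
have q0 : 0 < q by rewrite divr_gt0 ?mulr_gt0.
have K0 : 0 < K by rewrite divr_gt0 ?mulr_gt0 ?exprn_gt0.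
pose n := (Num.bound (2 * K * r / q)).+2.
have nB : 2 * K * r / q < n%:R.
  have : 2 * K * r / q < (Num.bound (2 * K * r / q))%:R.
    by apply: archi_boundP; apply: ltW; apply: divr_gt0 => //; apply: mulr_gt0 => //; apply: mulr_gt0.
  by move/lt_trans; apply; rewrite ltr_nat.
have n0 : 0 < n%:R :> R by rewrite ltr0n.
have n2 : 2 <= n%:R :> R by rewrite ler_nat.
exists (m * r / (4 * M * n%:R) * q / 4).
  by rewrite !(divr_gt0, mulr_gt0).
move=> c f a b rf fM ar br fab.
have ab_up : cabs (b - a) <= r / 2 by have := cabs_tri c b a; rewrite (cabsB c a); lra.
have ab_lo : m * r / (4 * M) <= cabs (b - a).
  have ar2 : cabs (a - c) <= r / 2 by lra.
  have br2 : cabs (b - c) <= r by lra.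
  have := ratdisc_lipschitz r0 rf fM ar2 br2; rewrite cabsB => /(le_trans fab).
  rewrite mulrAC ler_pdivlMr // ler_pdivrMr ?mulr_gt0 //; lra.
have ab0 : 0 < cabs (b - a) by apply: lt_le_trans ab_lo; rewrite divr_gt0 ?mulr_gt0.
pose t := cabs (b - a) / n%:R.
have t0 : 0 < t by rewrite divr_gt0.
have t_up : t <= r / 4 by rewrite ler_pdivrMr //; nra.
have t_K : 4 * K * t <= q.
  rewrite /t mulrA ler_pdivrMr //; move: nB; rewrite ltr_pdivrMr //.
  have := ler_wpM2l (ltW K0) ab_up; lra.
pose A i : C := a + ((i%:R / n%:R)%:C)%C * (b - a).
have Ar i : (i <= n)%N -> cabs (A i - c) <= r / 4.
  move=> ni; pose x := i%:R / n%:R : R.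
  have x0 : 0 <= x by rewrite divr_ge0.
  have x1 : x <= 1 by rewrite ler_pdivrMr // mul1r ler_nat.
  have -> : A i - c = ((1 - x)%:C)%C * (a - c) + (x%:C)%C * (b - c).
    by rewrite /A -/x rmorphB rmorph1; ring.
  apply: le_trans (cabsD _ _) _; rewrite !cabsM !cabs_real !ger0_norm ?subr_ge0 //.
  have := ler_wpM2l x0 br; have := ler_wpM2l (_ : 0 <= 1 - x) ar; rewrite subr_ge0 => /(_ x1); lra.
have AS i : cabs (A i.+1 - A i) = t.
  have -> : A i.+1 - A i = ((n%:R^-1)%:C)%C * (b - a).
    rewrite /A -[i.+1%:R]natr1 mulrDl rmorphD /= div1r; ring.
  by rewrite cabsM cabs_real ger0_norm ?invr_ge0 // mulrC.
have [i ni fi] : exists2 i, (i < n)%N & m / n%:R <= cabs (f (A i.+1) - f (A i)).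
  apply: contrapT => hn.
  have lt i : (i < n)%N -> cabs (f (A i.+1) - f (A i)) < m / n%:R.
    by move=> ni; rewrite ltNge; apply/negP => h; apply: hn; exists i.
  have A0 : A 0%N = a by rewrite /A mul0r rmorph0 mul0r addr0.
  have An : A n = b by rewrite /A divff ?gt_eqF // rmorph1 mul1r addrC subrK.
  have : forall j, (j <= n)%N -> (0 < j)%N -> cabs (f (A j) - f (A 0%N)) < j%:R * (m / n%:R).
    elim=> // -[|j] IH jn _; first by rewrite mul1r; exact: lt.
    have := cabs_tri (f (A j.+1)) (f (A j.+2)) (f (A 0%N)).
    have := lt j.+1 jn; have := IH (ltnW jn) isT.
    rewrite -[j.+2%:R]natr1 mulrDl mul1r; lra.
  move=> /(_ n (leqnn n) isT); rewrite A0 An mulrCA divff ?gt_eqF // mulr1 cabsB; lra.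
have Air := Ar i (ltnW ni); have AiSr := Ar i.+1 ni.
have Air2 : cabs (A i - c) <= r / 2 by lra.
have [h rh hE] := ratdisc_schwarz r0 rf fM Air2.
have rle z : cabs (z - c) <= r / 2 -> cabs (z - c) <= r by lra.
have hlip x y : cabs (x - c) <= r / 2 -> cabs (y - c) <= r / 2 -> cabs (h x - h y) <= K * cabs (x - y).
  move=> xr yr; have := ratdisc_lipschitz r0 rh (fun z zr => proj2 (hE z zr)) yr (rle _ xr).
  have -> // : 4 * (4 * M / r) / r = K by rewrite /K; field; rewrite gt_eqF.
have hq : q <= cabs (h (A i.+1)).
  have AiSr2 : cabs (A i.+1 - c) <= r / 2 by lra.
  have := fi; rewrite (proj1 (hE _ (rle _ AiSr2))) cabsM AS /t mulrAC ler_pM2r ?invr_gt0 //.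
  rewrite /q ler_pdivrMr // => h1; have := cabs_ge0 (h (A i.+1)); nra.
exists (A i) => // w ws.
have rfi : ratdisc (A i) t f by apply: ratdisc_shrink rf; lra.
have circ z : cabs (z - A i) = t -> t * (q / 2) <= cabs (f z - f (A i)).
  move=> zt; have zr2 : cabs (z - c) <= r / 2 by have := cabs_tri (A i) z c; lra.
  have AiSr2 : cabs (A i.+1 - c) <= r / 2 by lra.
  rewrite (proj1 (hE _ (rle _ zr2))) cabsM zt ler_pM2l //.
  have := hlip _ _ AiSr2 zr2; have := cabs_lb (h (A i.+1)) (h z).
  have := cabs_tri (A i) (A i.+1) z; rewrite AS (cabsB (A i) z) zt => h1 h2 h3.
  have := ler_wpM2l (ltW K0) h1; lra.
have tq : 0 < t * (q / 2) by apply: mulr_gt0 => //; apply: divr_gt0.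
have ws' : cabs (w - f (A i)) < t * (q / 2) / 2.
  apply: lt_le_trans ws _.
  have -> : m * r / (4 * M * n%:R) * q / 4 = m * r / (4 * M) * (q / (4 * n%:R)).
    by field; rewrite !gt_eqF.
  have -> : t * (q / 2) / 2 = cabs (b - a) * (q / (4 * n%:R)).
    by rewrite /t; field; rewrite !gt_eqF.
  apply: ler_wpM2r => //; apply: ltW; apply: divr_gt0 => //; exact: mulr_gt0.
have [z zt fz] := ratdisc_open t0 tq rfi circ ws'.
by exists z => //; have := cabs_tri (A i) z c; lra.
Qed.
End Disc.

(** * Rational maps of the sphere *)

Section RationalMaps.
Variable R : realType.
Local Notation C := R[i].
Local Notation S := (sphere R).

Definition hpt (a b : C) : S := if b == 0 then None else Some (a / b).

Definition hform n (P : {poly C}) (a b : C) : C := \sum_(i < n.+1) P`_i * (a ^+ i * b ^+ (n - i)).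

(** A pair of binary forms of one degree without common zero; in this shape infinity is an ordinary
    point. *)
Definition form_rational (f : S -> S) : Prop :=
  exists (n : nat) (P Q : {poly C}), forall a b, ~~ ((a == 0) && (b == 0)) ->
    ~~ ((hform n P a b == 0) && (hform n Q a b == 0)) /\
    f (hpt a b) = hpt (hform n P a b) (hform n Q a b).

(** Retains only what the disc estimates use: polynomial numerator and denominator without common
    zero in each of the two charts. Composition with a [form_rational] map on the left preserves it,
    and so does [sinv] on either side. *)
Definition chart_rational (f : S -> S) : Prop :=
  exists A B A' B' : {poly C}, forall z,
    [/\ ~~ ((A.[z] == 0) && (B.[z] == 0)), f (Some z) = hpt A.[z] B.[z],
        ~~ ((A'.[z] == 0) && (B'.[z] == 0)) & f (sinv (Some z)) = hpt A'.[z] B'.[z]].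

Lemma chart_rational_id : chart_rational id.
Proof.
exists 'X, 1, 1, 'X => z; rewrite !hornerX !hornerC oner_eq0 /=; split=> //.
- by rewrite andbF.
- by rewrite /hpt oner_eq0 divr1.
- by rewrite /sinv /hpt div1r.
Qed.

Lemma chart_rational_form_comp f h :
  form_rational f -> chart_rational h -> chart_rational (f \o h).
Proof.
move=> [n [P [Q H]]] [A [B [A' [B' K]]]].
pose Fc (T U V : {poly C}) := \sum_(i < n.+1) T`_i *: (U ^+ i * V ^+ (n - i)).
have FcE T U V z : (Fc T U V).[z] = hform n T U.[z] V.[z].
  by rewrite horner_sum; apply: eq_bigr => i _; rewrite !hornerE.
exists (Fc P A B), (Fc Q A B), (Fc P A' B'), (Fc Q A' B') => z.
have [k1 k2 k3 k4] := K z; rewrite !FcE /= k2 k4.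
have [h1 h2] := H _ _ k1; have [h3 h4] := H _ _ k3; by split.
Qed.

Lemma hformE n (P : {poly C}) a b : (size P <= n.+1)%N -> b != 0 ->
  hform n P a b = b ^+ n * P.[a / b].
Proof.
move=> sP b0; rewrite (horner_coef_wide _ sP) mulr_sumr; apply: eq_bigr => i _.
have le : (i <= n)%N by rewrite -ltnS.
have bn : b ^+ n = b ^+ (n - i) * b ^+ i by rewrite -exprD subnK.
rewrite expr_div_n bn; field.
by rewrite expf_neq0.
Qed.

Lemma hform0 n (P : {poly C}) a : hform n P a 0 = P`_n * a ^+ n.
Proof.
rewrite /hform big_ord_recr /= subnn expr0 mulr1 big1 ?add0r // => i _.
by rewrite expr0n subn_eq0 leqNgt ltn_ord /= !mulr0.
Qed.

Lemma hpt_scale l a b : l != 0 -> hpt (l * a) (l * b) = hpt a b.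
Proof.
move=> l0; rewrite /hpt mulf_eq0 (negbTE l0) /=; case: eqVneq => // b0.
by congr Some; field; rewrite l0 b0.
Qed.

Lemma isRat_form_rational f : isRat f -> form_rational f.
Proof.
move=> [P [Q [cPQ [sPQ ->]]]].
(* [n] is the degree of the map. In degree n the value at infinity is read off the two top
   coefficients, which matches the size comparison in [ratfun]. *)
pose n := (maxn (size P) (size Q)).-1.
have nE : n.+1 = maxn (size P) (size Q).
  by rewrite /n prednK // leq_max; case: sPQ => /ltnW ->; rewrite ?orbT.
have sP : (size P <= n.+1)%N by rewrite nE leq_maxl.
have sQ : (size Q <= n.+1)%N by rewrite nE leq_maxr.
exists n, P, Q => a b; have [->|b0] := eqVneq b 0.
  rewrite andbT => a0; rewrite !hform0 /hpt eqxx /=.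
  have an : a ^+ n != 0 by rewrite expf_neq0.
  rewrite !mulf_eq0 (negbTE an) !orbF.
  have lc (p q : {poly C}) : (size q < size p)%N -> maxn (size p) (size q) = n.+1 ->
      p`_n = lead_coef p /\ p`_n != 0 /\ q`_n = 0.
    move=> qp; rewrite (maxn_idPl (ltnW qp)) => E.
    have pn : p`_n = lead_coef p by rewrite lead_coefE E.
    split => //; rewrite pn lead_coef_eq0 -size_poly_eq0 -lt0n (leq_ltn_trans _ qp) //.
    by split => //; apply: nth_default; rewrite -ltnS -E.
  have [lt|gt|eq] := ltngtP (size P) (size Q).
  - have [e1 [e2 e3]] := lc _ _ lt (etrans (maxnC _ _) (esym nE)).
    by rewrite e3 eqxx (negbTE e2) mul0r mul0r; split.
  - by have [e1 [e2 e3]] := lc _ _ gt (esym nE); rewrite e3 eqxx (negbTE e2); split.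
  have PE : P`_n = lead_coef P by rewrite lead_coefE; congr (_`_ _); rewrite /n eq maxnn.
  have QE : Q`_n = lead_coef Q by rewrite lead_coefE; congr (_`_ _); rewrite /n eq maxnn.
  have Q0 : Q`_n != 0.
    rewrite QE lead_coef_eq0 -size_poly_eq0 -lt0n; case: sPQ => /ltnW //; by rewrite eq.
  rewrite (negbTE Q0) andbF -PE -QE; split => //; congr Some; field.
  by rewrite an Q0.
move=> _; rewrite !hformE // hpt_scale ?expf_neq0 // !mulf_eq0 !(negbTE (expf_neq0 _ b0)) /=.
split; last by rewrite /hpt (negbTE b0) /=; case: eqP.
apply/negP => /andP[/eqP p0 /eqP q0].
have /(coprimep_root cPQ) : root P (a / b) by rewrite rootE p0.
by rewrite q0 eqxx.
Qed.

Lemma sinv_hpt a b : ~~ ((a == 0) && (b == 0)) -> sinv (hpt a b) = hpt b a.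
Proof.
rewrite /hpt; case: (eqVneq b 0) => [->|b0] /=.
  by rewrite andbT => a0; rewrite (negbTE a0) mul0r.
by rewrite mulf_eq0 invr_eq0 (negbTE b0) orbF; case: (eqVneq a 0) => // a0; rewrite invf_div.
Qed.

Lemma chart_rational_sinvl f : chart_rational f -> chart_rational (@sinv R \o f).
Proof.
move=> [A [B [A' [B' K]]]]; exists B, A, B', A' => z; have [k1 k2 k3 k4] := K z.
by rewrite /= k2 k4 !sinv_hpt // [(B.[z] == 0) && _]andbC [(B'.[z] == 0) && _]andbC.
Qed.

Lemma chart_rational_sinvr f : chart_rational f -> chart_rational (f \o @sinv R).
Proof.
move=> [A [B [A' [B' K]]]]; exists A', B', A, B => z; have [k1 k2 k3 k4] := K z.
by rewrite /= -!/(sinv (Some z)) sinvK.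
Qed.

Definition coord (p : S) : C := if p is Some z then z else 0.

Lemma chart_rational_ratdisc c r f : chart_rational f ->
  (forall z, cabs (z - c) <= r -> f (Some z) <> None) ->
  ratdisc c r (fun z => coord (f (Some z))).
Proof.
move=> [A [B [A' [B' K]]]] fz; exists A, B => z /fz; have [_ -> _ _] := K z.
by rewrite /hpt; case: ifPn.
Qed.

(** A point of modulus at most K is at distance at least 2/(1 + K) from infinity, so a point within
    half of that stays 1/(1 + K) away from infinity and has bounded modulus. *)
Lemma near_finite (K : R) (w : C) (q : S) : cabs w <= K -> chordal (Some w) q <= (1 + K)^-1 ->
  exists2 v, q = Some v & cabs v <= 2 * (1 + K).
Proof.
move=> wK; have K0 : 0 <= K by apply: le_trans wK; exact: cabs_ge0.
have K1 : 0 < 1 + K by lra.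
have wN : 2 / (1 + K) <= chordal (Some w) None.
  rewrite /= ler_pM2l // lef_pV2 ?posrE //; last by rewrite sqrtr_gt0; have := sqr_ge0 (cabs w); lra.
  rewrite -(@ler_pXn2r _ 2) ?nnegrE ?sqrtr_ge0 ?(ltW K1) //.
  rewrite sqr_sqrtr; last by have := sqr_ge0 (cabs w); lra.
  have := cabs_ge0 w; nra.
case: q => [v|] h; last by have := invr_gt0 (1 + K); rewrite K1; lra.
exists v => //; have := chordal_triangle (Some v) (Some w) None.
move=> tr; have {tr} : (1 + K)^-1 <= chordal (Some v) None by lra.
rewrite /= ler_pdivlMr; last by rewrite sqrtr_gt0; have := sqr_ge0 (cabs v); lra.
move=> tr; have : Num.sqrt (1 + cabs v ^+ 2) <= 2 * (1 + K).
  by move: tr; rewrite mulrC ler_pdivrMr.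
apply: le_trans.
rewrite -[leLHS]ger0_norm ?cabs_ge0 // -sqrtr_sqr ler_wsqrtr // lerDr; lra.
Qed.

Lemma near_finite_dist (K : R) (w : C) (q : S) : cabs w <= K -> chordal (Some w) q <= (1 + K)^-1 ->
  exists v, [/\ q = Some v, cabs v <= 2 * (1 + K) & cabs (v - w) <= (3 + 2 * K) ^+ 2 * chordal (Some w) q].
Proof.
move=> wK h; have [v qv vK] := near_finite wK h; exists v; split => //.
have K0 : 0 <= K by apply: le_trans wK; exact: cabs_ge0.
rewrite qv cabsB; have -> : 3 + 2 * K = 1 + 2 * (1 + K) by ring.
apply: cabs_le_chordal => //; lra.
Qed.

Definition is_chart (phi : S -> S) := phi = id \/ phi = @sinv R.

Lemma chart_invol phi : is_chart phi -> involutive phi.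
Proof. by case=> -> //; exact: sinvK. Qed.
Lemma chart_isometry phi p q : is_chart phi -> chordal (phi p) (phi q) = chordal p q.
Proof. by case=> -> //; exact: chordal_sinv. Qed.
Lemma chart_conj phi psi f : is_chart phi -> is_chart psi -> chart_rational f ->
  chart_rational (psi \o f \o phi).
Proof.
move=> h1 h2 hf.
have {hf} : chart_rational (psi \o f) by case: h2 => ->; [exact: hf|exact: chart_rational_sinvl].
by case: h1 => ->; [|exact: chart_rational_sinvr].
Qed.
Lemma chart_exists (p : S) : exists c phi, [/\ cabs c <= 1, is_chart phi & phi (Some c) = p].
Proof.
have [z [z1 [->|->]]] := sinv_chart p.
  by exists z, id; split => //; left.
by exists z, (@sinv R); split => //; right.
Qed.

Lemma sphere_near (c : C) (q : S) : cabs c <= 1 -> chordal (Some c) q <= 1 / 2 ->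
  exists v, [/\ q = Some v, cabs v <= 4 & cabs (v - c) <= 25 * chordal (Some c) q].
Proof.
move=> c1 h; have [|v [-> h1 h2]] := near_finite_dist (q := q) c1.
  by rewrite -[1 + 1]/(2%:R) -div1r.
exists v; split => //; first lra; apply: le_trans h2 _.
rewrite ler_wpM2r ?chordal_ge0 //; lra.
Qed.

Lemma chart_rational_continuous f : chart_rational f -> continuous f.
Proof.
move=> rf; apply: continuous_chordal => p e e0.
have [c [phi [c1 hphi pE]]] := chart_exists p.
have [w [psi [w1 hpsi fpE]]] := chart_exists (f p).
have [A [B [A' [B' K]]]] := chart_conj hphi hpsi rf.
have E0 : psi (f (phi (Some c))) = Some w by rewrite pE -fpE chart_invol.
have Bc : B.[c] != 0.
  by have [_ /=] := K c; rewrite E0 /hpt; case: ifPn.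
have B0 : 0 < cabs B.[c] by rewrite cabs_gt0.
have [d d0 hd] := poly_cont B c B0.
have rG : ratdisc c (d / 2) (fun z => coord (psi (f (phi (Some z))))).
  exists A, B => z zd; have [_ /= -> _ _] := K z.
  have Bz : B.[z] != 0.
    apply/eqP => Bz; have := hd z; rewrite Bz sub0r cabsN => /(_ _)/wrap[|]; last lra.
    by apply: le_lt_trans zd _; lra.
  by rewrite /hpt (negbTE Bz).
have cc : cabs (c - c) <= d / 2 by rewrite subrr cabs0 ltW // divr_gt0.
have [d1 d10 hd1] := ratdisc_cont cc rG (divr_gt0 e0 (ltr0n _ 2)).
apply/nbhs_chordal; exists (Num.min (1 / 2) (Num.min (d / 2) d1 / 26)).
  by rewrite lt_min divr_gt0 //= divr_gt0 // lt_min d10 divr_gt0.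
move=> q; rewrite lt_min => /andP[q1 q2].
have qd : chordal (Some c) (phi q) = chordal p q by rewrite -pE -{2}[q](chart_invol hphi) chart_isometry.
have [|v [qv _ vc]] := @sphere_near c (phi q) c1; first by rewrite qd ltW.
have vc' : cabs (v - c) < Num.min (d / 2) d1.
  apply: le_lt_trans vc _; rewrite qd; have := chordal_ge0 p q; lra.
move: vc'; rewrite lt_min => /andP[v1 v2].
have := hd1 v (ltW v1) v2; rewrite E0 -qv chart_invol //=.
have : psi (f q) <> None.
  have [_ /= h _ _] := K v; move: h; rewrite -qv chart_invol // /hpt => ->.
  case: ifPn => // /eqP Bv; have vd : cabs (v - c) < d by lra.
  by have := hd v vd; rewrite Bv sub0r cabsN ltxx.
case E : (psi (f q)) => [u|] //= _ uw.
rewrite -(chart_isometry _ _ hpsi) -pE E0 E; apply: le_lt_trans (chordal_le_cabs _ _) _.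
by rewrite cabsB; lra.
Qed.

(* The value 1/8 only has to be small enough for f to stay inside one chart. *)
Definition controlled (f : S -> S) (p : S) (d : R) :=
  forall q, chordal p q < d -> chordal (f p) (f q) < 1 / 8.

(** Replaces a controlled map by a function bounded by 4 on a disc whose radius depends on d only;
    the target chart may depend on f. Since chordal distance is at most twice the Euclidean one,
    radius d/4 remains inside the controlled ball. *)
Lemma controlled_chart f c phi d : cabs c <= 1 -> is_chart phi -> 0 < d ->
  chart_rational f -> controlled f (phi (Some c)) d ->
  exists psi F, [/\ is_chart psi, ratdisc c (d / 4) F &
    forall z, cabs (z - c) <= d / 4 -> f (phi (Some z)) = psi (Some (F z)) /\ cabs (F z) <= 4].
Proof.
move=> c1 hphi d0 rf cf.
have [w [psi [w1 hpsi fpE]]] := chart_exists (f (phi (Some c))).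
have fz z : cabs (z - c) <= d / 4 -> exists2 v, psi (f (phi (Some z))) = Some v & cabs v <= 4.
  move=> zc; have [|v [h1 h2 h3]] := @sphere_near w (psi (f (phi (Some z)))) w1; last by exists v.
  rewrite -(chart_isometry _ _ hpsi) fpE chart_invol //.
  apply: le_trans (ltW (cf _ _)) _; last lra.
  rewrite chart_isometry //; apply: le_lt_trans (chordal_le_cabs _ _) _.
  rewrite cabsB; lra.
exists psi, (fun z => coord (psi (f (phi (Some z))))); split => //.
  apply: (chart_rational_ratdisc (chart_conj hphi hpsi rf)) => z /fz[v /= -> //].
move=> z /fz[v E v4]; rewrite E /= -E chart_invol //.
Qed.

(** Cauchy-type estimate: mere control of the oscillation at p gives a Lipschitz bound near p, with
    constants independent of f. *)
Lemma controlled_lipschitz p d : 0 < d -> exists2 rho, 0 < rho & exists2 Lam, 0 < Lam &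
  forall f, chart_rational f -> controlled f p d ->
  forall a b, chordal p a < rho -> chordal p b < rho -> chordal (f a) (f b) <= Lam * chordal a b.
Proof.
move=> d0; have [c [phi [c1 hphi pE]]] := chart_exists p.
exists (Num.min (1 / 2) (d / 20 / 10)); first by rewrite lt_min !divr_gt0.
exists (2 * (64 / d * 25)); first by rewrite !mulr_gt0 // invr_gt0.
move=> f rf; rewrite -pE => cf a b.
have [psi [F [hpsi rF FE]]] := controlled_chart c1 hphi d0 rf cf.
have aux x : chordal (phi (Some c)) x < Num.min (1 / 2) (d / 20 / 10) ->
    exists v, [/\ x = phi (Some v), cabs v <= 4 & cabs (v - c) <= d / 8].
  rewrite lt_min -{1 2}[x](chart_invol hphi) !chart_isometry // => /andP[x1 x2].
  have [v [v1 v2 v3]] := sphere_near c1 (ltW x1).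
  by exists v; split => //; [rewrite -v1 chart_invol|lra].
move=> /aux[u [-> u4 uc]] /aux[v [-> v4 vc]].
have ur : cabs (u - c) <= d / 4 by lra.
have vr : cabs (v - c) <= d / 4 by lra.
have [-> _] := FE u ur; have [-> _] := FE v vr.
rewrite !chart_isometry //; apply: le_trans (chordal_le_cabs _ _) _.
have d4 : 0 < d / 4 by rewrite divr_gt0.
have FM z : cabs (z - c) <= d / 4 -> cabs (F z) <= 4 by move=> /FE[].
have uc' : cabs (u - c) <= d / 4 by lra.
have vc' : cabs (v - c) <= d / 4 / 2 by lra.
have := ratdisc_lipschitz d4 rF FM vc' uc'.
have := cabs_le_chordal u4 v4.
have -> : 4 * 4 / (d / 4) = 64 / d by field; rewrite gt_eqF.
have d64 : 0 < 64 / d by rewrite divr_gt0.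
move=> h1 h2; apply: le_trans (ler_wpM2l (ler0n _ 2) h2) _.
have := ler_wpM2l (ltW d64) h1.
have -> : (1 + 4) ^+ 2 = 25 :> R by ring.
rewrite mulrA; lra.
Qed.

(* A quantitative Vitali theorem for convergence to the identity. *)
Lemma controlled_vitali p d : 0 < d -> exists2 rho, 0 < rho &
  forall p' rho' e, chordal p p' < rho -> 0 < rho' -> 0 < e -> exists2 e1, 0 < e1 &
  forall f, chart_rational f -> controlled f p d ->
    (forall q, chordal p' q < rho' -> chordal (f q) q < e1) ->
    forall q, chordal p q < rho -> chordal (f q) q < e.
Proof.
move=> d0'; have [c [phi [c1 hphi pE]]] := chart_exists p.
(* Capping d by 1 keeps the working disc inside |z| <= 2. *)
pose d1 := Num.min d 1.
have d0 : 0 < d1 by rewrite lt_min d0' ltr01.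
have d11 : d1 <= 1 by rewrite ge_min lexx orbT.
have d1d : d1 <= d by rewrite ge_min lexx.
exists (Num.min (1 / 16) (d1 / 64 / 64)); first by rewrite lt_min !divr_gt0.
move=> p' rho' e pp' rho'0 e0.
have aux x : chordal p x < Num.min (1 / 16) (d1 / 64 / 64) ->
    exists v, [/\ x = phi (Some v), cabs v <= 4 & cabs (v - c) <= d1 / 128].
  rewrite -pE lt_min -{1 2}[x](chart_invol hphi) !chart_isometry // => /andP[x1 x2].
  have x1' : chordal (Some c) (phi x) <= 1 / 2 by lra.
  have [v [v1 v2 v3]] := sphere_near c1 x1'.
  by exists v; split => //; [rewrite -v1 chart_invol|lra].
have [v [p'E v4 vc]] := aux _ pp'.
pose r := d1 / 4; have r0 : 0 < r by rewrite divr_gt0.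
pose r1 := Num.min (rho' / 4) (r / 2).
have r10 : 0 < r1 by rewrite lt_min !divr_gt0.
have r1r : r1 <= r / 2 by rewrite ge_min lexx orbT.
have r1rho : r1 <= rho' / 4 by rewrite ge_min lexx.
have e40 : 0 < e / 4 by rewrite divr_gt0.
have [e2 e20 He2] := @ratdisc_two_disc R v (r / 2) r1 6 (e / 4) r10 r1r e40.
exists (Num.min (1 / 16) (e2 / 25)); first by rewrite lt_min !divr_gt0.
move=> f rf cf fid.
have fp' : chordal (f p') p' < 1 / 16.
  by have := fid p'; rewrite chordalxx lt_min => /(_ rho'0)/andP[].
have pp'1 : chordal p p' < 1 / 16 by move: pp'; rewrite lt_min => /andP[].
have pp'd : chordal p p' < d.
  apply: lt_le_trans pp' _; rewrite ge_min; apply/orP; right; lra.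
(* Because f almost fixes p', which is near p, its values stay in the chart of the source. Hence
   F(z) - z makes sense, and it is bounded by 4 + 2 = 6. *)
have fz z : cabs (z - c) <= r -> exists2 w, phi (f (phi (Some z))) = Some w & cabs w <= 4.
  move=> zc; have [|w [h1 h2 h3]] := @sphere_near c (phi (f (phi (Some z)))) c1; last by exists w.
  rewrite -(chart_isometry _ _ hphi) chart_invol // pE.
  have h1 := chordal_triangle p' p (f (phi (Some z))).
  have h2 := chordal_triangle (f p') p' (f (phi (Some z))).
  have h3 := chordal_triangle (f p) (f p') (f (phi (Some z))).
  have h4 := cf _ pp'd; have h5 : chordal (f p) (f (phi (Some z))) < 1 / 8.
    apply: cf; rewrite -pE chart_isometry //; apply: le_lt_trans (chordal_le_cabs _ _) _.
    rewrite cabsB; apply: le_lt_trans (ler_wpM2l (ler0n _ 2) zc) _; apply: lt_le_trans d1d; rewrite /r; clear -d0; lra.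
  rewrite (chordalC p' (f p')) in h2; rewrite (chordalC (f p') (f p)) in h3; clear - h1 h2 h3 h4 h5 fp' pp'1; lra.
pose F z := coord (phi (f (phi (Some z)))).
have rF : ratdisc c r F.
  apply: (chart_rational_ratdisc (chart_conj hphi hphi rf)) => z /fz[w /= -> //].
have FE z : cabs (z - c) <= r -> f (phi (Some z)) = phi (Some (F z)) /\ cabs (F z) <= 4.
  by move=> /fz[w E w4]; rewrite /F E /= -E chart_invol.
have sub z : cabs (z - v) <= r / 2 -> cabs (z - c) <= r.
  by move=> zv; have := cabs_tri v z c; rewrite /r in zv *; lra.
have znorm z : cabs (z - c) <= r -> cabs z <= 2.
  by move=> zc; have := cabs_lb z c; rewrite /r in zc; lra.
have rH : ratdisc v (r / 2) (fun z => F z - 'X.[z]).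
  by apply: ratdisc_sub_poly; apply: ratdisc_sub rF.
have HM z : cabs (z - v) <= r / 2 -> cabs (F z - 'X.[z]) <= 6.
  move=> /sub zc; rewrite hornerX; have := cabsD (F z) (- z); rewrite cabsN.
  by have := znorm _ zc; have [_] := FE _ zc; lra.
have Hs z : cabs (z - v) <= r1 -> cabs (F z - 'X.[z]) <= e2.
  move=> zv; have zc : cabs (z - c) <= r by apply: sub; lra.
  have [E F4] := FE _ zc; rewrite hornerX.
  have z4 : cabs z <= 4 by have := znorm _ zc; lra.
  apply: le_trans (cabs_le_chordal F4 z4) _.
  rewrite -(chart_isometry (Some (F z)) _ hphi) -E.
  have := fid (phi (Some z)); rewrite p'E chart_isometry // => /(_ _)/wrap[|].
    apply: le_lt_trans (chordal_le_cabs _ _) _; rewrite cabsB; lra.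
  rewrite lt_min => /andP[_ ]; have -> : (1 + 4) ^+ 2 = 25 :> R by ring.
  lra.
move=> q /aux[u [-> u4 uc]].
have uv : cabs (u - v) <= r / 2 / 4.
  by have := cabs_tri c u v; rewrite (cabsB c v) /r; lra.
have uc' : cabs (u - c) <= r by rewrite /r; lra.
have := He2 _ rH HM Hs u uv; rewrite hornerX => h.
have [-> _] := FE _ uc'; rewrite chart_isometry //.
apply: le_lt_trans (chordal_le_cabs _ _) _; lra.
Qed.

(** A uniform open mapping theorem: the radius s depends only on p, d and the variation m, whereas
    the centre depends on the map. *)
Lemma controlled_image_ball p d : 0 < d -> exists2 rho, 0 < rho &
  forall m, 0 < m -> exists2 s, 0 < s &
  forall f a b, chart_rational f -> controlled f p d ->
    chordal p a < rho -> chordal p b < rho -> m <= chordal (f a) (f b) ->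
    exists q, forall w, chordal q w < s -> exists2 y, chordal p y < d / 2 & f y = w.
Proof.
move=> d0; have [c [phi [c1 hphi pE]]] := chart_exists p.
exists (Num.min (1 / 2) (d / 20 / 20)); first by rewrite lt_min !divr_gt0.
move=> m m0.
have r0 : 0 < d / 4 by rewrite divr_gt0.
have m20 : 0 < m / 2 by rewrite divr_gt0.
have [s s0 Hs] := ratdisc_image_ball r0 (ltr0n R 4 : 0 < 4) m20.
(* 1/5 and 121 = (3 + 2 * 4)^2 are the constants of [near_finite_dist] for modulus at most 4. *)
exists (Num.min (1 / 5) (s / 122)); first by rewrite lt_min !divr_gt0.
move=> f a b rf; rewrite -pE => cf.
have [psi [F [hpsi rF FE]]] := controlled_chart c1 hphi d0 rf cf.
have aux x : chordal (phi (Some c)) x < Num.min (1 / 2) (d / 20 / 20) ->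
    exists v, [/\ x = phi (Some v), cabs v <= 4 & cabs (v - c) <= d / 4 / 4].
  rewrite lt_min -{1 2}[x](chart_invol hphi) !chart_isometry // => /andP[x1 x2].
  have [v [v1 v2 v3]] := sphere_near c1 (ltW x1).
  by exists v; split => //; [rewrite -v1 chart_invol|lra].
move=> /aux[u [-> u4 uc]] /aux[v [-> v4 vc]].
have ur : cabs (u - c) <= d / 4 by lra.
have vr : cabs (v - c) <= d / 4 by lra.
have [-> _] := FE u ur; have [-> _] := FE v vr.
rewrite !chart_isometry // => mF.
have {}mF : m / 2 <= cabs (F u - F v) by have := chordal_le_cabs (F u) (F v); lra.
have FM z : cabs (z - c) <= d / 4 -> cabs (F z) <= 4 by move=> /FE[].
have [a' a'r Ha'] := Hs c F u v rF FM uc vc mF.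
exists (psi (Some (F a'))) => w.
rewrite -{1}[w](chart_invol hpsi) chart_isometry // lt_min => /andP[w1 w2].
have a'4 : cabs (F a') <= 4 by apply: FM; lra.
have [|w' [wE w'K w'd]] := @near_finite_dist 4 (F a') (psi w) a'4.
  have -> : (1 + 4)^-1 = 1 / 5 :> R by field.
  exact: ltW.
have [|z zr Fz] := Ha' w'.
  apply: le_lt_trans w'd _; have -> : (3 + 2 * 4) ^+ 2 = 121 :> R by ring.
  have := chordal_ge0 (Some (F a')) (psi w); lra.
exists (phi (Some z)).
  rewrite chart_isometry //; apply: le_lt_trans (chordal_le_cabs _ _) _.
  rewrite cabsB; lra.
have zr' : cabs (z - c) <= d / 4 by lra.
have [-> _] := FE z zr'.
by rewrite Fz -wE chart_invol.
Qed.
End RationalMaps.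

(** * Contraction over the Fatou set *)

Lemma compact_cover_seq (T : topologicalType) (A : set T) (U : T -> set T) :
  compact A -> (forall p, A p -> nbhs p (U p)) ->
  exists l : seq T, (forall p, p \in l -> A p) /\ forall q, A q -> exists2 p, p \in l & U p q.
Proof.
move=> cA hU; apply: contrapT => hn.
pose D := [set l : seq T | forall p, p \in l -> A p].
pose B (l : seq T) := A `\` [set q | exists2 p, p \in l & U p q].
have PF : ProperFilter (filter_from D B).
  apply: filter_from_proper.
    apply: filter_from_filter; first by exists [::].
    move=> l1 l2 D1 D2; exists (l1 ++ l2).
      by move=> p; rewrite mem_cat => /orP[/D1|/D2].
    move=> q [Aq nq]; split; split => // -[p pl Upq]; apply: nq; exists p => //.
      by rewrite mem_cat pl.
    by rewrite mem_cat pl orbT.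
  move=> l Dl; apply: contrapT => h; apply: hn; exists l; split => // q Aq.
  by apply: contrapT => nq; apply: h; exists q.
have [|q [Aq clq]] := cA _ PF; first by exists [::] => // q [].
have [|y [[_ ny] Uy]] := clq (B [:: q]) (U q) _ (hU q Aq).
  by exists [:: q] => // p; rewrite inE => /eqP->.
by apply: ny; exists q; rewrite ?mem_head.
Qed.

(** Zorn's lemma is applied to complements: a maximal open backward-invariant set that does not
    cover [K0] leaves a minimal closed invariant remainder. Compactness ensures that the union of a
    chain still fails to cover. *)
Lemma minimal_closed_invariant (T : topologicalType) (act : set (T -> T)) (K0 : set T) :
  compact K0 -> closed K0 -> K0 !=set0 -> (forall g, act g -> forall x, K0 x -> K0 (g x)) ->
  exists M : set T, [/\ M !=set0, M `<=` K0, closed M, (forall g, act g -> forall x, M x -> M (g x)) & forall K : set T, K !=set0 -> K `<=` M -> closed K ->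
     (forall g, act g -> forall x, K x -> K (g x)) -> M `<=` K].
Proof.
move=> cK0 clK0 K00 iK0.
pose P (U : set T) := [/\ open U, forall g, act g -> forall x, U (g x) -> U x & ~ (K0 `<=` U)].
have [|U [[oU iU nU] Umax]] := @Zorn_bigcup T P.
  move=> F FP tF.
  have [F0|/set0P F0] := eqVneq F set0.
    split; rewrite F0 bigcup_set0; first exact: open0.
      by move=> g _ x [].
    by move=> h; have [x /h] := K00.
  split.
  - by apply: bigcup_open => X /FP[].
  - by move=> g ag x [X FX Xgx]; exists X => //; have [_ iX _] := FP _ FX; exact: (iX g ag).
  move=> cov.
  have PF : ProperFilter (filter_from F (fun X => K0 `\` X)).
    apply: filter_from_proper.
      apply: filter_from_filter; first by have [X FX] := F0; exists X.
      move=> X Y FX FY; have [XY|YX] := tF X Y FX FY.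
        by exists Y => // x [K0x nY]; split; split => //; apply: contra_not nY => /XY.
      by exists X => // x [K0x nX]; split; split => //; apply: contra_not nX => /YX.
    move=> X /FP[_ _ nX]; apply: contrapT => h; apply: nX => x K0x.
    by apply: contrapT => nX; apply: h; exists x.
  have [|p [K0p clp]] := cK0 _ PF.
    by have [X FX] := F0; exists X => // x [].
  have [X FX Xp] := cov _ K0p.
  have [oX _ _] := FP _ FX.
  have [|y [[_ +]]] := clp (K0 `\` X) X _ (open_nbhs_nbhs (conj oX Xp)); last by [].
  by exists X.
exists (K0 `\` U); split.
- apply: contrapT => h; apply: nU => x K0x.
  by apply: contrapT => nX; apply: h; exists x.
- by move=> x [].
- by apply: closedI => //; exact: open_closedC.
- by move=> g ag x [K0x nUx]; split; [exact: iK0|apply: contra_not nUx; exact: (iU g ag)].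
move=> K [y Ky] KU clK iK x [K0x nUx]; apply: contrapT => nKx.
apply: (Umax (~` K)).
  split; first by move=> z Uz /KU[].
  by move=> h; apply: nUx; exact: h.
split; first exact: closed_openC.
  by move=> g ag z nKgz Kz; apply: nKgz; exact: iK.
by move=> h; have [/h] := KU _ Ky.
Qed.

(** * Compactness and connectedness of the sphere and of its pointwise maps *)

Section SphereCompact.
Variable R : realType.
Local Notation S := (sphere R).

Lemma sphere_net (e : R) : 0 < e -> exists l : seq S, forall p, exists2 q, q \in l & chordal p q < e.
Proof.
move=> e0; have [|l [_ H]] := @compact_cover_seq _ [set: S] (fun p q => chordal q p < e) (@sphere_compact R).
  by move=> p _; apply/nbhs_chordal; exists e => // q; rewrite chordalC.
by exists l => p; exact: H.
Qed.

Lemma seq_min_gt0 (T : eqType) (l : seq T) (F : T -> R) : (forall x, x \in l -> 0 < F x) ->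
  exists2 d : R, 0 < d & forall x, x \in l -> d <= F x.
Proof.
elim: l => [|a l IH] H; first by exists 1.
have [|d d0 hd] := IH; first by move=> x xl; apply: H; rewrite inE xl orbT.
have Fa : 0 < F a by apply: H; rewrite mem_head.
exists (Num.min (F a) d); first by rewrite lt_min Fa.
move=> x; rewrite inE => /orP[/eqP->|/hd]; first by rewrite ge_min lexx.
by rewrite ge_min => ->; rewrite orbT.
Qed.

Lemma continuous_uniform (f : S -> S) : continuous f -> forall e : R, 0 < e ->
  exists2 d : R, 0 < d & forall p q, chordal p q < d -> chordal (f p) (f q) < e.
Proof.
move=> cf e e0.
have H p : exists d : R, 0 < d /\ forall q, chordal p q < d -> chordal (f p) (f q) < e / 2.
  have /cvg_ballP/(_ (e / 2) (divr_gt0 e0 (ltr0n _ 2))) := cf p.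
  by move/nbhs_chordal => [d d0 h]; exists d; split => // q /h; rewrite sphere_ballE.
have [d hd] := choice H.
have [|l [_ Hl]] := @compact_cover_seq _ [set: S] (fun p q => chordal p q < d p / 2) (@sphere_compact R).
  by move=> p _; apply/nbhs_chordal; exists (d p / 2) => //; rewrite divr_gt0 //; case: (hd p).
have [|m m0 hm] := @seq_min_gt0 _ l (fun p => d p / 2).
  by move=> p _; rewrite divr_gt0 //; case: (hd p).
exists m => // p q pq; have [a al pa] := Hl p I; have [da ha] := hd a.
have := ha p; have := ha q; have := chordal_triangle a (f p) (f q).
have := hm a al; have := chordal_triangle p a q; have := chordal_triangle (f a) (f p) (f q).
rewrite (chordalC (f p) (f a)) => h1 h2 h3 _ h4 h5.
have {}h4 : chordal (f a) (f q) < e / 2 by apply: h4; lra.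
have {}h5 : chordal (f a) (f p) < e / 2 by apply: h5; lra.
lra.
Qed.

(** Limit maps are handled only through this criterion; the topology itself serves for Tychonoff and
    for minimal closed sets. *)
Lemma ptws_closureP (A : set {ptws S -> S}) (k : {ptws S -> S}) :
  closure A k <-> forall (E : seq S) (e : R), 0 < e ->
     exists2 f, A f & forall x, x \in E -> chordal (k x) (f x) < e.
Proof.
split=> [clk E e e0|H B kB].
  have : nbhs k [set f : {ptws S -> S} | forall x, x \in E -> chordal (k x) (f x) < e].
    elim: E => [|x E IH]; first by apply: filterS (filterT : nbhs k setT) => f _ x.
    have hx : nbhs k [set f : {ptws S -> S} | chordal (k x) (f x) < e].
      have H0 : {ptws, nbhs k --> k} by exact: cvg_id.
      have H1 := (pointwise_cvgP k (nbhs_filter k)).1 H0 x.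
      by apply: (H1 [set y | chordal (k x) y < e]); apply/nbhs_chordal; exists e.
    apply: filterS (filterI hx IH) => f [h1 h2] y.
    by rewrite inE => /orP[/eqP->|/h2].
  by move=> /clk[f [Af hf]]; exists f.
pose Fk := filter_from [set p : seq S * R | 0 < p.2]
  (fun p => [set f : {ptws S -> S} | forall x, x \in p.1 -> chordal (k x) (f x) < p.2]).
have FF : Filter Fk.
  apply: filter_from_filter; first by exists ([::], 1) => /=.
  move=> [E1 e1] [E2 e2] /= e10 e20; exists (E1 ++ E2, Num.min e1 e2) => /=.
    by rewrite lt_min e10.
  by move=> f h; split => x xE; have := h x; rewrite mem_cat xE ?orbT lt_min => /(_ isT)/andP[].
have cv : {ptws, Fk --> k}.
  apply/pointwise_cvgP => x; apply/cvg_ballP => e e0.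
  exists ([:: x], e) => //= f /(_ x (mem_head _ _)) h.
  have hb : ball (k x) e (f x) by rewrite sphere_ballE.
  exact: hb.
have [[E e] /= e0 hE] := cv _ kB.
by have [f Af hf] := H E e e0; exists f; split => //; exact: hE.
Qed.

Lemma ptws_compact : compact [set: {ptws S -> S}].
Proof.
have := @tychonoff S (fun=> S) (fun=> setT) (fun=> @sphere_compact R).
by congr (compact _); apply/seteqP; split.
Qed.

(** Finite points are joined by straight segments, and infinity is a limit of finite points. *)
Lemma sphere_connected (W : set S) : W !=set0 ->
  (forall p, W p -> exists2 r : R, 0 < r & forall q, chordal p q < r -> W q) ->
  (forall p, (forall r : R, 0 < r -> exists2 q, W q & chordal p q < r) -> W p) ->
  forall p, W p.
Proof.
move=> [p0 Wp0] oW cW.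
have big (r : R) : 0 < r -> exists v : R[i], chordal None (Some v) < r.
  move=> r0; exists (((2 / r)%:C)%C); rewrite /= cabs_real ger0_norm ?divr_ge0 // ?ltW //.
  have r2 : 0 < 2 / r by rewrite divr_gt0.
  rewrite ltr_pdivrMr ?sqrtr_gt0; last by have := sqr_ge0 (2 / r); lra.
  rewrite -ltr_pdivrMl // mulrC -[ltLHS]ger0_norm ?(ltW r2) // -sqrtr_sqr ltr_sqrt; first lra.
  by have := sqr_ge0 (2 / r); lra.
have [a Wa] : exists a : R[i], W (Some a).
  case: p0 Wp0 => [a|] Wp; first by exists a.
  by have [r r0 hr] := oW _ Wp; have [v vr] := big r r0; exists v; exact: hr.
have Wfin b : W (Some b).
  pose g (t : R) : S := Some (a + (t%:C)%C * (b - a)).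
  have gd s t : chordal (g s) (g t) <= 2 * (`|s - t| * cabs (b - a)).
    apply: le_trans (chordal_le_cabs _ _) _.
    have -> : a + (s%:C)%C * (b - a) - (a + (t%:C)%C * (b - a)) = ((s - t)%:C)%C * (b - a).
      by rewrite rmorphB /=; ring.
    by rewrite cabsM cabs_real.
  have near s (e : R) : 0 < e -> exists2 d : R, 0 < d & forall t, `|s - t| < d -> chordal (g s) (g t) < e.
    move=> e0; have D0 : 0 < 2 * cabs (b - a) + 1 by have := cabs_ge0 (b - a); lra.
    exists (e / (2 * cabs (b - a) + 1)); first by rewrite divr_gt0.
    move=> t; rewrite ltr_pdivlMr // => st; apply: le_lt_trans (gd s t) _.
    by apply: le_lt_trans st; rewrite mulrDr mulr1 mulrCA; have := normr_ge0 (s - t); lra.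
  have cR : connected [set: R].
    by apply/connected_intervalP => x y z.
  have g1 : g 1 = Some b by rewrite /g rmorph1 mul1r addrC subrK.
  suff : [set t | W (g t)] = setT by move/seteqP => [_ /(_ 1 I)] /=; rewrite g1.
  apply: cR.
  - by exists 0; rewrite /= /g rmorph0 mul0r addr0.
  - exists [set t | W (g t)]; last by rewrite setTI.
    rewrite openE => s /= Ws; have [r r0 hr] := oW _ Ws.
    have [d d0 hd] := near s r r0.
    by apply/nbhs_ballP; exists d => //= t; rewrite /ball /= => /hd/hr.
  - exists [set t | W (g t)]; last by rewrite setTI.
    move=> s hs; apply: cW => r r0; have [d d0 hd] := near s r r0.
    have [|t [Wt st]] := hs (ball s d); first by apply/nbhs_ballP; exists d.
    by exists (g t) => //; apply: hd.
case=> [b|]; first exact: Wfin.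
by apply: cW => r /big[v vr]; exists (Some v).
Qed.
End SphereCompact.

Section Contraction.
Variable R : realType.
Local Notation S := (sphere R).
Variable G : set (S -> S).
Hypothesis G_rat : forall g, G g -> chart_rational g.
Hypothesis G_comp : forall g h, G g -> G h -> G (g \o h).

(** One fixed oscillation bound suffices in place of equicontinuity, by [controlled_lipschitz];
    [fatou_normal] identifies these points with the Fatou set. *)
Definition normal_at (p : S) := exists2 d : R, 0 < d & forall g, G g -> controlled g p d.

Hypothesis G_kernel : forall p, exists2 g, G g & normal_at (g p).
Hypothesis G_julia : exists p, ~ normal_at p.

Lemma G_unif g (e : R) : G g -> 0 < e ->
  exists2 d : R, 0 < d & forall p q, chordal p q < d -> chordal (g p) (g q) < e.
Proof.
by move=> Gg; apply: continuous_uniform; apply: chart_rational_continuous; exact: G_rat.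
Qed.

Lemma normal_lipschitz p : normal_at p -> exists2 r : R, 0 < r & exists2 L : R, 0 < L &
  forall g, G g -> forall a b, chordal p a < r -> chordal p b < r ->
  chordal (g a) (g b) <= L * chordal a b.
Proof.
move=> [d d0 hd]; have [r r0 [L L0 H]] := controlled_lipschitz p d0.
by exists r => //; exists L => // g Gg; apply: H; [exact: G_rat|exact: hd].
Qed.

(** This gives a controlled family at any point p, Julia points included, as soon as w moves p to a
    normal point. *)
Lemma normal_at_comp w p : G w -> normal_at (w p) ->
  exists2 d : R, 0 < d & forall g, G g -> controlled (g \o w) p d.
Proof.
move=> Gw [d d0 hd]; have [d1 d10 h1] := G_unif Gw d0; exists d1 => // g Gg q /h1.
exact: hd.
Qed.

(* The maps h o g o w, g o w close to id, are equicontinuous at p because w p is a normal point,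
   and they approximate h. *)
Lemma normal_at_of_return w p (r : R) : G w -> normal_at (w p) -> 0 < r ->
  (forall e : R, 0 < e -> exists2 g, G g & forall q, chordal p q < r -> chordal (g (w q)) q < e) ->
  normal_at p.
Proof.
move=> Gw nwp r0 ret; have [r1 r10 [L L0 HL]] := normal_lipschitz nwp.
(* Three errors of 1/24 add up to the 1/8 in [controlled]: h against h o g o w at p, the same at q,
   and the variation of h o g o w between p and q. *)
have e0 : 0 < Num.min r1 (24 * L)^-1 by rewrite lt_min r10 invr_gt0 mulr_gt0.
have [d d0 hd] := G_unif Gw e0.
exists (Num.min d r); first by rewrite lt_min d0.
move=> h Gh q; rewrite lt_min => /andP[/hd + qr]; rewrite lt_min => /andP[q1 q2].
have e1 : 0 < 1 / 24 :> R by rewrite divr_gt0.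
have [d1 d10 hd1] := G_unif Gh e1.
have [g Gg hg] := ret d1 d10.
have pp : chordal p p < r by rewrite chordalxx.
have A := hd1 _ _ (hg p pp); have B := hd1 _ _ (hg q qr).
have wp : chordal (w p) (w p) < r1 by rewrite chordalxx.
have C := HL _ (G_comp Gh Gg) (w p) (w q) wp q1.
have D : L * chordal (w p) (w q) < 1 / 24.
  by rewrite -ltr_pdivlMl // div1r -invfM mulrC.
have := chordal_triangle (h (g (w p))) (h p) (h q).
have := chordal_triangle (h (g (w q))) (h (g (w p))) (h q).
rewrite (chordalC (h p) (h (g (w p)))) /= in C *; lra.
Qed.

(** * Recurrence on a dense subset of a ball contradicts a non-empty Julia set *)

Section Recurrence.
Variables (T : set S) (v0 : S) (rv : R).
Hypothesis rv0 : 0 < rv.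
Hypothesis T_dense : forall w, chordal v0 w < rv -> forall e : R, 0 < e -> exists2 y, T y & chordal w y < e.
Hypothesis T_rec : forall u, G u -> forall (E : seq S) (e : R), (forall v, v \in E -> T v) -> 0 < e ->
  exists2 g, G g & forall v, v \in E -> chordal (g (u v)) v < e.

Lemma dense_net (e : R) : 0 < e -> exists2 E : seq S, (forall v, v \in E -> T v) &
  forall w, chordal v0 w < rv -> exists2 v, v \in E & chordal w v < e.
Proof.
move=> e0; have e3 : 0 < e / 3 by rewrite divr_gt0.
have [l hl] := sphere_net e3.
have v0v : chordal v0 v0 < rv by rewrite chordalxx.
have [t0 Tt0 _] := T_dense v0v e0.
(* Each net point q is replaced by a nearby point of [T]; when there is none, the default [t0] keeps
   the list inside [T]. *)
pose P q := [set y | T y /\ chordal q y < 2 * (e / 3)].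
pose t q := xget t0 (P q).
exists [seq t q | q <- l].
  by move=> v /mapP[q _ ->]; rewrite /t; case: xgetP => // y _ [].
move=> w wv; have [q ql wq] := hl w; exists (t q); first exact: map_f.
have [y Ty wy] := T_dense wv e3.
have [_ tq] : P q (t q).
  apply: (xgetPex t0); exists y; split => //.
  by have := chordal_triangle w q y; rewrite (chordalC q w); lra.
by have := chordal_triangle q w (t q); lra.
Qed.

Definition near_id (p : S) (r : R) := forall e : R, 0 < e -> exists (E : seq S) (d : R),
  [/\ 0 < d, forall v, v \in E -> T v & forall f, G f -> (forall v, v \in E -> chordal (f v) v < d) ->
    forall q, chordal p q < r -> chordal (f q) q < e].

(** Stated for a subfamily F since it is used twice: first for the maps g o w, whose control at [v0]
    is known, and then for G itself, once [v0] is known to be normal. A Lipschitz bound spreads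
    closeness to the identity from a net in [T] to a ball. *)
Lemma recurrence_center : exists2 r : R, 0 < r & forall F : set (S -> S),
  (forall f, F f -> G f) ->
  (exists2 d : R, 0 < d & forall f, F f -> controlled f v0 d) ->
  exists2 r : R, 0 < r & forall e : R, 0 < e -> exists (E : seq S) (d : R),
  [/\ 0 < d, forall v, v \in E -> T v & forall f, F f -> (forall v, v \in E -> chordal (f v) v < d) ->
    forall q, chordal v0 q < r -> chordal (f q) q < e].
Proof.
exists 1 => // F FG [d d0 hd].
have [r r0 [L L0 H]] := controlled_lipschitz v0 d0.
exists (Num.min (r / 2) rv); first by rewrite lt_min divr_gt0.
move=> e e0.
have e10 : 0 < Num.min (r / 2) (Num.min (e / 3) (e / 3 / L)) by rewrite !lt_min !divr_gt0.
have [E ET hE] := dense_net e10.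
exists E, (e / 3); split; [by rewrite divr_gt0|by []|].
move=> f Ff fE q; rewrite lt_min => /andP[q1 q2]; have [v vE] := hE q q2.
rewrite !lt_min => /andP[v1 /andP[v2 v3]].
have fv := fE v vE.
have vr : chordal v0 v < r by have := chordal_triangle q v0 v; lra.
have qr : chordal v0 q < r by lra.
have := H f (G_rat (FG _ Ff)) (hd _ Ff) q v qr vr.
have : L * chordal q v < e / 3 by rewrite mulrC -ltr_pdivlMr.
have := chordal_triangle (f v) (f q) q; have := chordal_triangle v (f v) q.
rewrite (chordalC v q); lra.
Qed.

Lemma normal_center : normal_at v0.
Proof.
have [w Gw nw] := G_kernel v0.
have [_ _ H] := recurrence_center.
have [|| r r0 hr] := H [set f | exists2 g, G g & f = g \o w].
- by move=> _ [g Gg ->]; exact: G_comp.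
- by have [d d0 hd] := normal_at_comp Gw nw; exists d => // _ [g Gg ->]; exact: hd.
apply: (normal_at_of_return Gw nw r0) => e e0.
have [E [d [d0 ET hE]]] := hr e e0.
have [g Gg hg] := T_rec Gw ET d0.
by exists g => // q qr; apply: (hE (g \o w)) => //; exists g.
Qed.

Lemma near_id_center : exists2 r : R, 0 < r & near_id v0 r.
Proof.
have [_ _ H] := recurrence_center.
have [//||r r0 hr] := H G; last by exists r.
exact: normal_center.
Qed.

(** The maps g o w are controlled at p. Recurrence makes one of them almost the identity near some
    [near_id] point p', and Vitali carries this over to a fixed ball around p, where
    [normal_at_of_return] applies. *)
Lemma near_id_vitali p : (forall s : R, 0 < s -> exists2 q, chordal p q < s & exists2 r : R, 0 < r & near_id q r) ->
  normal_at p.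
Proof.
move=> hp; have [w Gw nw] := G_kernel p.
have [d d0 hd] := normal_at_comp Gw nw.
have [r r0 V] := controlled_vitali p d0.
have [p' pp' [r' r'0 np']] := hp r r0.
apply: (normal_at_of_return Gw nw r0) => e e0.
have [e1 e10 he1] := V p' r' e pp' r'0 e0.
have [E [d1 [d10 ET hE]]] := np' e1 e10.
have [g Gg hg] := T_rec Gw ET d10.
exists g => //; apply: (he1 (g \o w)); first by apply: G_rat; exact: G_comp.
  exact: hd.
exact: (hE (g \o w) (G_comp Gg Gw)).
Qed.

(** Normality of p, obtained in the preceding lemma, permits Vitali for all of G instead of only the
    maps g o w. *)
Lemma near_id_closed p : (forall s : R, 0 < s -> exists2 q, chordal p q < s & exists2 r : R, 0 < r & near_id q r) ->
  exists2 r : R, 0 < r & near_id p r.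
Proof.
move=> hp; have [d d0 hd] := near_id_vitali hp.
have [r r0 V] := controlled_vitali p d0.
have [p' pp' [r' r'0 np']] := hp r r0.
exists r => // e e0.
have [e1 e10 he1] := V p' r' e pp' r'0 e0.
have [E [d1 [d10 ET hE]]] := np' e1 e10.
exists E, d1; split => // f Gf fE; apply: he1; [exact: G_rat|exact: hd|exact: hE].
Qed.

Lemma no_recurrence : False.
Proof.
have [p np] := G_julia; apply: np; apply: near_id_vitali => s s0.
exists p; first by rewrite chordalxx.
apply: (@sphere_connected R [set p | exists2 r : R, 0 < r & near_id p r]).
- by exists v0; exact: near_id_center.
- move=> q [r r0 nq]; exists (r / 2); first by rewrite divr_gt0.
  move=> q' qq'; exists (r / 2); first by rewrite divr_gt0.
  move=> e e0; have [E [d [d0 ET hE]]] := nq e e0; exists E, d; split => // f Gf fE x q'x.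
  by apply: (hE f Gf fE); have := chordal_triangle q' q x; lra.
- move=> q hq; apply: near_id_closed => t t0; have [q' nq' qq'] := hq t t0.
  by exists q'.
Qed.
End Recurrence.

(** If k separates two points near p, then elements of G close to k have images containing balls of
    one fixed radius, so the range of k is dense in some ball. The second hypothesis on k is
    recurrence on that range, and [no_recurrence] gives the contradiction. *)
Lemma minimal_constant (M : set {ptws S -> S}) (p : S) : normal_at p -> exists2 r : R, 0 < r &
  forall k : S -> S,
  (forall (E : seq S) (e : R), 0 < e -> exists2 g, G g & forall x, x \in E -> chordal (k x) (g x) < e) ->
  (forall u, G u -> forall (E : seq S) (e : R), 0 < e ->
     exists2 g, G g & forall x, x \in E -> chordal (k x) (g (u (k x))) < e) ->
  forall a b, chordal p a < r -> chordal p b < r -> k a = k b.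
Proof.
move=> np; have [d d0 hd] := np.
have [r1 r10 [L L0 HL]] := normal_lipschitz np.
have d'0 : 0 < Num.min d r1 by rewrite lt_min d0.
have [r r0 HI] := controlled_image_ball p d'0.
exists r => // k kcl krec a b pa pb; apply: contrapT => kab.
have m0 : 0 < chordal (k a) (k b) / 3.
  rewrite divr_gt0 // lt_def chordal_ge0 andbT; apply/eqP => /chordal_eq0; exact: kab.
have [s s0 Hs] := HI _ m0.
(* Otherwise every ball of radius s/2 has a hole in the range of k. Finitely many centres give holes
   of a common size e; an element g close to k on a sufficiently fine net takes the centre of a hole
   as a value, and the Lipschitz bound then puts a value of k into the hole. *)
have [q hq] : exists q, forall w, chordal q w < s / 2 -> forall e : R, 0 < e -> exists y, chordal (k y) w < e.
  apply: contrapT => hn.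
  have hq q : exists we : S * R, [/\ chordal q we.1 < s / 2, 0 < we.2 & forall y, we.2 <= chordal (k y) we.1].
    apply: contrapT => hq; apply: hn; exists q => w qw e e0; apply: contrapT => hy.
    apply: hq; exists (w, e); split => //= y; rewrite leNgt; apply/negP => h; apply: hy.
    by exists y.
  have [we hwe] := choice hq.
  have s20 : 0 < s / 2 by rewrite divr_gt0.
  have [l hl] := sphere_net s20.
  have [|e e0 he] := @seq_min_gt0 R _ l (fun q => (we q).2); first by move=> x _; have [] := hwe x.
  have eL0 : 0 < Num.min (r1 - r1 / 2) (e / 4 / L) by rewrite lt_min subr_gt0 !divr_gt0 // ltr_pdivrMr //; lra.
  have [n hnet] := sphere_net eL0.
  have em0 : 0 < Num.min (e / 4) (chordal (k a) (k b) / 3) by rewrite lt_min divr_gt0.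
  have [g Gg hg] := kcl [:: a, b & n] _ em0.
  have [||q0 hq0] := Hs g a b (G_rat Gg) _ pa pb.
  - move=> x; rewrite lt_min => /andP[xd _]; exact: hd.
  - have := hg a; have := hg b; rewrite !inE !eqxx orbT !lt_min => /(_ isT)/andP[_ h1] /(_ isT)/andP[_ h2].
    have := chordal_triangle (g a) (k a) (k b); have := chordal_triangle (g b) (g a) (k b).
    rewrite (chordalC (g b)); lra.
  have [q1 q1l q01] := hl q0.
  have [w1 w2 w3] := hwe q1.
  have q0w : chordal q0 (we q1).1 < s by have := chordal_triangle q1 q0 (we q1).1; lra.
  have [y py gy] := hq0 _ q0w.
  have [y' y'n yy'] := hnet y.
  move: yy'; rewrite lt_min => /andP[y1 y2].
  have pyr : chordal p y < r1 / 2.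
    apply: lt_le_trans py _; rewrite ler_pM2r ?invr_gt0 // ge_min lexx orbT //.
  have py'r : chordal p y' < r1 by have := chordal_triangle y p y'; lra.
  have pyr1 : chordal p y < r1 by lra.
  have := HL g Gg y' y py'r pyr1.
  have : L * chordal y' y < e / 4 by rewrite chordalC mulrC -ltr_pdivlMr.
  have := hg y'; rewrite !inE y'n !orbT lt_min => /(_ isT)/andP[h1 _].
  have := w3 y'; have := he q1 q1l; rewrite -gy.
  have := chordal_triangle (g y') (k y') (g y); lra.
have s20 : 0 < s / 2 by rewrite divr_gt0.
apply: (@no_recurrence (range k) q (s / 2) s20).
  move=> w qw e e0; have [y ky] := hq w qw e e0; exists (k y); first by exists y.
  by rewrite chordalC.
move=> u Gu E e ET e0.
have H v : exists x, v \in E -> k x = v.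
  case: (boolP (v \in E)) => [/ET[x _ <-]|_]; first by exists x.
  by exists p.
have [x hx] := choice H.
have [g Gg hg] := krec u Gu (map x E) e e0; exists g => // v vE.
by have := hg (x v) (map_f _ vE); rewrite hx // chordalC.
Qed.

Lemma G_nonempty : exists g, G g.
Proof. by have [g Gg _] := G_kernel None; exists g. Qed.

(** A limit map h sends (a, b) to (x, y). A map k in a minimal closed invariant subset of the orbit
    closure of h is constant near p, so k a = k b is the common target c, and k is approximated by
    elements u o h. *)
Lemma orbit_contraction p : normal_at p -> exists2 r : R, 0 < r &
  forall a b, chordal p a < r -> chordal p b < r ->
  forall x y, (forall e : R, 0 < e -> exists2 g, G g & chordal x (g a) < e /\ chordal y (g b) < e) ->
  exists c, forall e : R, 0 < e -> exists2 u, G u & chordal (u x) c < e /\ chordal (u y) c < e.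
Proof.
move=> np; have [r r0 Hr] := minimal_constant setT np; exists r => // a b pa pb x y xy.
have [h hcl [hx hy]] : exists2 h : {ptws S -> S}, closure (G : set {ptws S -> S}) h & h a = x /\ h b = y.
  pose D := [set e : R | 0 < e].
  pose B (e : R) := [set g : {ptws S -> S} | [/\ G g, chordal x (g a) < e & chordal y (g b) < e]].
  have PF : ProperFilter (filter_from D B).
    apply: filter_from_proper.
      apply: filter_from_filter; first by exists 1; rewrite /D /=.
      move=> e1 e2 e10 e20; exists (Num.min e1 e2); first by rewrite /D /= lt_min e10.
      by move=> g [Gg]; rewrite !lt_min => /andP[? ?] /andP[? ?]; split.
    by move=> e e0; have [g Gg []] := xy e e0; exists g.
  have [|h [_ hcl]] := @ptws_compact R _ PF; first exact: filterT.
  have clB e : 0 < e -> closure (B e) h by move=> e0 U nU; apply: hcl => //; exists e.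
  exists h.
    apply/ptws_closureP => E e e0; have /ptws_closureP/(_ E e e0)[f [Gf _ _] hf] := clB 1 ltr01.
    by exists f.
  have aux (z : S) (s : S) : (forall e : R, 0 < e -> chordal s z <= e) -> s = z.
    move=> hz; apply: chordal_eq0; apply/eqP; rewrite eq_le chordal_ge0 andbT.
    by apply/ler_addgt0Pl => e e0; rewrite addr0; exact: hz.
  split; apply: aux => e e0; have e20 : 0 < e / 2 by rewrite divr_gt0.
    have /ptws_closureP/(_ [:: a] _ e20)[f [_ f1 _] /(_ a)] := clB _ e20.
    rewrite mem_head => /(_ isT); have := chordal_triangle (f a) (h a) x; rewrite (chordalC x) in f1; lra.
  have /ptws_closureP/(_ [:: b] _ e20)[f [_ _ f1] /(_ b)] := clB _ e20.
  rewrite mem_head => /(_ isT); have := chordal_triangle (f b) (h b) y; rewrite (chordalC y) in f1; lra.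
pose O (k : {ptws S -> S}) : set {ptws S -> S} :=
  closure ([set f | exists2 g, G g & f = g \o k] : set {ptws S -> S}).
have Oinv k : forall T, [set T | exists2 g, G g & T = (fun f : {ptws S -> S} => g \o f : {ptws S -> S})] T ->
    forall f, O k f -> O k (T f).
  move=> _ [g Gg ->] f /ptws_closureP fO; apply/ptws_closureP => E e e0.
  have [d d0 hd] := G_unif Gg e0.
  have [_ [g' Gg' ->] hg'] := fO E d d0.
  exists (g \o (g' \o k)); first by exists (g \o g') => //; exact: G_comp.
  by move=> z zE; apply: hd; exact: hg'.
have Oclosed k : closed (O k) by exact: closed_closure.
have One k : O k !=set0.
  by have [g Gg] := G_nonempty; exists (g \o k); apply: subset_closure; exists g.
have Osub k k' : O k k' -> O k' `<=` O k.
  move=> kk' f /ptws_closureP fO; apply/ptws_closureP => E e e0.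
  have e20 : 0 < e / 2 by rewrite divr_gt0.
  have [_ [g Gg ->] hg] := fO E _ e20.
  have [d d0 hd] := G_unif Gg e20.
  have /ptws_closureP/(_ E d d0)[_ [g' Gg' ->] hg'] := kk'.
  exists (g \o (g' \o k)); first by exists (g \o g') => //; exact: G_comp.
  move=> z zE; have := hg z zE; have := hd _ _ (hg' z zE); rewrite /=.
  have := chordal_triangle (g (k' z)) (f z) (g (g' (k z))); lra.
have [|M [[k Mk] MO Mcl Minv Mmin]] := minimal_closed_invariant _ (Oclosed h) (One h) (Oinv h).
  exact: subclosed_compact (Oclosed h) (@ptws_compact R) _.
have kO : O h k by exact: MO.
have Osub_cl f : O h f -> closure (G : set {ptws S -> S}) f.
  move=> /ptws_closureP fO; apply/ptws_closureP => E e e0.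
  have e20 : 0 < e / 2 by rewrite divr_gt0.
  have [_ [g Gg ->] hg] := fO E _ e20.
  have [d d0 hd] := G_unif Gg e20.
  have /ptws_closureP/(_ E d d0)[g' Gg' hg'] := hcl.
  exists (g \o g'); first exact: G_comp.
  move=> z zE; have := hg z zE; have := hd _ _ (hg' z zE); rewrite /=.
  have := chordal_triangle (g (h z)) (f z) (g (g' z)); lra.
have kab : k a = k b.
  apply: (Hr k) => //; first by move=> E e e0; have /ptws_closureP := Osub_cl _ kO; exact.
  move=> u Gu E e e0.
  (* Minimality: the orbit closure of u o k is invariant and lies in M, hence equals M and contains
     k. This is exactly the recurrence required by [minimal_constant]. *)
  have Muk : M `<=` O (u \o k).
    apply: Mmin => //; last exact: Oinv.
    rewrite ((closure_id M).1 Mcl); apply: closure_subset => _ [g Gg ->].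
    apply: (Minv (fun f : {ptws S -> S} => g \o f : {ptws S -> S})); first by exists g.
    by apply: (Minv (fun f : {ptws S -> S} => u \o f : {ptws S -> S})) => //; exists u.
  by have /ptws_closureP/(_ E e e0)[_ [g Gg ->] hg] := Muk k Mk; exists g.
exists (k a) => e e0.
have /ptws_closureP/(_ [:: a; b] e e0)[_ [g Gg ->] hg] := kO.
exists g => //; have := hg a; have := hg b; rewrite !inE !eqxx orbT /= hx hy -kab.
by move=> /(_ isT) ? /(_ isT) ?; rewrite !(chordalC _ (k a)).
Qed.
End Contraction.

(** * The abstract Hölder bound *)

(** The exponent a = ln(1/q) / ln K is the solution of K^a = 1/q, which turns the geometric rate q^m
    at scale d / K^m into a power of the distance. *)
Lemma geometric_holder (R : realType) (K q d : R) : 2 <= K -> 0 < q < 1 -> 0 < d ->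
  exists2 a : R, 0 < a & exists2 c : R, 0 < c &
  forall B D E : R, 0 <= B -> 0 <= D -> 0 <= E -> E <= B ->
   (forall m : nat, D < d / K ^+ m -> E <= B * q ^+ m) -> E <= c * B * D `^ a.
Proof.
move=> K2 /andP[q0 q1] d0.
have K0 : 0 < K by lra.
have lnKp : 0 < ln K by rewrite ln_gt0 //; lra.
have lnq : 0 < ln q^-1 by rewrite ln_gt0 // invf_gt1.
pose a := ln q^-1 / ln K; have a0 : 0 < a by rewrite divr_gt0.
have Ka : K `^ a = q^-1.
  rewrite /powR gt_eqF // /a divfK ?gt_eqF // lnK //.
  by rewrite posrE invr_gt0.
exists a => //; exists ((K / d) `^ a); first by rewrite powR_gt0 // divr_gt0.
move=> B D E B0 D0 E0 EB H.
have Kd0 : 0 <= K / d by rewrite divr_ge0 // ltW.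
rewrite mulrAC -powRM //.
have [D0'|Dn0] := eqVneq D 0.
  suff -> : E = 0 by rewrite mulr_ge0 // powR_ge0.
  apply/eqP; rewrite eq_le E0 andbT leNgt; apply/negP => Epos.
  have B1 : 0 < B by lra.
  have := @cvg_geometric R 1 q; rewrite ger0_norm ?(ltW q0) // => /(_ q1)/cvgrPdist_lt/(_ (E / B)).
  rewrite divr_gt0 // => /(_ isT)[n _ /(_ n (leqnn n))] /=.
  rewrite sub0r normrN mul1r ger0_norm ?exprn_ge0 ?(ltW q0) // ltr_pdivlMr // mulrC.
  by rewrite ltNge H // D0' divr_gt0 // exprn_gt0.
have Dpos : 0 < D by rewrite lt_def Dn0.
have [m0 m0P] : exists m : nat, d / K ^+ m <= D.
  exists (Num.bound (d / D)); rewrite ler_pdivrMr ?exprn_gt0 // mulrC -ler_pdivrMr //.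
  have h : d / D < (Num.bound (d / D))%:R by apply: archi_boundP; rewrite divr_ge0 // ltW.
  apply: le_trans (ltW h) _; apply: le_trans (_ : 2 ^+ Num.bound (d / D) <= _).
    by rewrite -natrX ler_nat ltnW // ltn_expl.
  by apply: lerXn2r => //; rewrite nnegrE // ltW.
(* The least scale not above D brackets it: d / K^(m+1) <= D < d / K^m. If this least index is 0,
   then D >= d and the trivial bound E <= B is enough. *)
case: (ex_minnP (ex_intro (fun m => d / K ^+ m <= D) m0 m0P)) => -[|m] mP mmin.
  rewrite expr0 divr1 in mP.
  have h1 : 1 <= K / d * D.
    by rewrite mulrAC ler_pdivlMr // mul1r; nra.
  have : 1 <= (K / d * D) `^ a.
    have E1 : 1 `^ a = 1 :> R by rewrite powR1.
    by rewrite -{1}E1; apply: ge0_ler_powR; rewrite ?nnegrE ?ler01 ?(ltW a0) //; lra.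
  by move=> h; rewrite -[leLHS]mul1r; apply: ler_pM.
have Dm : D < d / K ^+ m.
  by rewrite ltNge; apply/negP => /mmin; rewrite ltnn.
apply: le_trans (H m Dm) _; rewrite mulrC; apply: ler_wpM2r => //.
have Km : (K ^+ m)^-1 <= K / d * D.
  move: mP; rewrite ler_pdivrMr ?exprn_gt0 // exprS => mP.
  rewrite -[leLHS]div1r ler_pdivrMr ?exprn_gt0 //.
  have -> : K / d * D * K ^+ m = D * (K * K ^+ m) / d by field; rewrite gt_eqF.
  by rewrite ler_pdivlMr // mul1r.
apply: le_trans (_ : ((K ^+ m)^-1) `^ a <= _); last first.
  by apply: ge0_ler_powR; rewrite ?nnegrE ?(ltW a0) ?invr_ge0 ?exprn_ge0 // ?ltW // mulr_gt0 // divr_gt0.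
have e1 : (K ^+ m) `^ a = (q ^+ m)^-1.
  by rewrite -powR_mulrn ?(ltW K0) // -powRrM mulrC powRrM Ka powR_mulrn ?invr_ge0 ?(ltW q0) // exprVn.
have e2 : ((K ^+ m)^-1) `^ a * (K ^+ m) `^ a = 1.
  by rewrite -powRM ?invr_ge0 ?exprn_ge0 ?(ltW K0) // mulVf ?powR1 // gt_eqF // exprn_gt0.
have qm : q ^+ m != 0 by rewrite gt_eqF // exprn_gt0.
by have := congr1 (fun x => x * q ^+ m) e2; rewrite e1 /= mulfVK // mul1r => ->.
Qed.

Section HolderBound.
Variable R : realType.
Local Notation S := (sphere R).
Variable Gam : set (S -> S).
Local Notation G := (gen_semigroup Gam).
Hypothesis G_rat : forall g, G g -> chart_rational g.
Hypothesis G_kernel : forall p, exists2 g, G g & normal_at G (g p).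
Hypothesis G_julia : exists p, ~ normal_at G p.
Variable Lam : R.
Hypothesis Lam2 : 2 <= Lam.
Hypothesis Gam_lip : forall f, Gam f -> forall a b, chordal (f a) (f b) <= Lam * chordal a b.
Variable mass : (S -> S) -> R -> R.
Hypothesis mass_gt0 : forall g h, Gam g -> 0 < h -> 0 < mass g h.

Definition uniformly_near (f g : S -> S) (h : R) := forall z, chordal (f z) (g z) < h.

(** The averaging inequality without the measure: weight [mass g h] at level t, the remaining weight
    at level s. This separates the dynamics from measurability. *)
Definition submean (e : S -> S -> R) := forall x y g h s t, Gam g -> 0 < h -> t <= s ->
  (forall f, Gam f -> e (f x) (f y) <= s) ->
  (forall f, Gam f -> uniformly_near f g h -> e (f x) (f y) <= t) ->
  e x y <= s - (s - t) * mass g h.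

(** Suited to probabilities of events along orbits, for which no continuity at Julia pairs is at
    hand. *)
Definition small_near_diagonal (e : S -> S -> R) := forall eta : R, 0 < eta ->
  exists2 d : R, 0 < d & forall x y, chordal x y < d ->
    (forall g, G g -> chordal (g x) (g y) < d) -> e x y <= eta.

(** In the final induction the bound to be improved is known only for sufficiently close pairs, so
    its validity must be tracked along words of bounded length. *)
Fixpoint below (e : S -> S -> R) (s : R) n x y : Prop :=
  if n is m.+1 then e x y <= s /\ forall f, Gam f -> below e s m (f x) (f y) else e x y <= s.

Lemma below_le e s n x y : below e s n x y -> e x y <= s.
Proof. by case: n => // n []. Qed.

Lemma below_mono e s m n x y : (m <= n)%N -> below e s n x y -> below e s m x y.
Proof.
elim: n m x y => [|n IH] [|m] x y // mn; first by move=> [].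
by move=> [h1 h2]; split => // f Gf; apply: IH => //; exact: h2.
Qed.

(** Following the word u approximately has probability at least p, and probabilities multiply under
    composition. N, p and d are fixed before e, which makes the later constants uniform; M is the
    depth of validity left over after the word. *)
Lemma word_step u : G u -> forall x y (z : R), 0 < z ->
  exists (N : nat) (p d : R), [/\ 0 < p, 0 < d & forall e M x' y' s t, submean e ->
    chordal x x' < d -> chordal y y' < d -> t <= s -> below e s (N + M) x' y' ->
    (forall a b, chordal (u x) a < z -> chordal (u y) b < z -> below e s M a b -> e a b <= t) ->
    e x' y' <= s - (s - t) * p].
Proof.
elim => [g Gg x y z z0|g h Gg IHg Gh IHh x y z z0].
  have z20 : 0 < z / 2 by rewrite divr_gt0.
  have [d d0 hd] := continuous_uniform (chart_rational_continuous (G_rat (gen_base Gg))) z20.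
  exists 1%N, (mass g (z / 2)), d; split => //; first exact: mass_gt0.
  move=> e M x' y' s t se xx' yy' ts [_ be] ht; apply: se => //.
    by move=> f Gf; have := be f Gf; exact: below_le.
  move=> f Gf fg; apply: ht; last exact: be.
    have := hd _ _ xx'; have := fg x'; have := chordal_triangle (g x') (g x) (f x').
    rewrite (chordalC (g x')); lra.
  have := hd _ _ yy'; have := fg y'; have := chordal_triangle (g y') (g y) (f y').
  rewrite (chordalC (g y')); lra.
have [Ng [pg [dg [pg0 dg0 Hg]]]] := IHg (h x) (h y) z z0.
have [Nh [ph [dh [ph0 dh0 Hh]]]] := IHh x y dg dg0.
exists (Nh + Ng)%N, (ph * pg), dh; split => //; first exact: mulr_gt0.
move=> e M x' y' s t se xx' yy' ts be ht.
(* h acts first, so the bound already gained from g serves as the target level for the h-step. *)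
have -> : s - (s - t) * (ph * pg) = s - (s - (s - (s - t) * pg)) * ph by ring.
apply: (Hh e (Ng + M)%N) => //.
- by rewrite gerBl mulr_ge0 ?subr_ge0 // ltW.
- by rewrite addnA.
by move=> a b ha hb bab; exact: (Hg e M).
Qed.

Lemma Gam_nonempty : exists g, Gam g.
Proof.
have [g Gg _] := G_kernel None.
by elim: Gg => [g' ?|_ _ _ [g' ?] _ _]; exists g'.
Qed.

Lemma submean_le e x y s : submean e -> (forall f, Gam f -> e (f x) (f y) <= s) -> e x y <= s.
Proof.
move=> se h; have [g Gg] := Gam_nonempty.
have := se x y g 1 s s Gg ltr01 (lexx s) h (fun f Gf _ => h f Gf).
by rewrite subrr mul0r subr0.
Qed.

(** Near any accumulation pair of the orbit of (a, b), some word brings both points close to one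
    normal point, where e <= eta. Compactness of the space of pairs makes the gain uniform, so the
    supremum of e over the orbit cannot exceed eta. *)
Lemma vanish_near_normal p : normal_at G p -> exists2 r : R, 0 < r &
  forall a b, chordal p a < r -> chordal p b < r ->
  forall e B, (forall x y, e x y <= B) -> (forall x y, 0 <= e x y) -> submean e -> small_near_diagonal e ->
  e a b = 0.
Proof.
move=> np; have [r r0 Hr] := orbit_contraction G_rat (@gen_comp R Gam) G_kernel G_julia np.
exists r => // a b pa pb e B eB e0 se de.
apply/eqP; rewrite eq_le e0 andbT; apply/ler_addgt0Pl => eta eta0; rewrite addr0.
have [ep ep0 hep] := de eta eta0.
pose Z (q : S * S) := forall d : R, 0 < d -> exists2 g, G g & chordal q.1 (g a) < d /\ chordal q.2 (g b) < d.
have loc q : exists Npd : nat * R * R, [/\ 0 < Npd.1.2, 0 < Npd.2 & forall g, G g ->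
   chordal q.1 (g a) < Npd.2 -> chordal q.2 (g b) < Npd.2 ->
   forall s, eta <= s -> (forall n h, G h -> below e s n (h a) (h b)) ->
     e (g a) (g b) <= s - (s - eta) * Npd.1.2].
  have [Zq|nZ] := pselect (Z q); last first.
    have [d [d0 hd]] : exists d : R, 0 < d /\ forall g, G g -> chordal q.1 (g a) < d -> chordal q.2 (g b) < d -> False.
      apply: contrapT => h; apply: nZ => d d0; apply: contrapT => h2; apply: h.
      by exists d; split => // g Gg h3 h4; apply: h2; exists g.
    by exists (0%N, 1, d); split => //= g Gg h1 h2; have := hd g Gg h1 h2.
  have [c hc] := Hr a b pa pb q.1 q.2 Zq.
  have [v Gv nv] := G_kernel c.
  have [r1 r10 [L L0 HL]] := normal_lipschitz G_rat nv.
  (* Both points land within 2 rho of v c, so they are within 4 rho of each other and remain within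
     4 L rho under G; the fifths keep both quantities below [ep]. *)
  pose rho := Num.min (r1 / 2) (Num.min (ep / 5) (ep / 5 / L)).
  have rho0 : 0 < rho by rewrite !lt_min !divr_gt0.
  have rho1 : rho <= r1 / 2 by rewrite ge_min lexx.
  have rho2 : rho <= ep / 5 by rewrite !ge_min lexx orbT.
  have rho3 : L * rho <= ep / 5 by rewrite mulrC -ler_pdivlMr // !ge_min lexx !orbT.
  have [d1 d10 hd1] := continuous_uniform (chart_rational_continuous (G_rat Gv)) rho0.
  have [u Gu [up uq]] := hc d1 d10.
  have [N [pp [d [pp0 d0 Hw]]]] := word_step (gen_comp Gv Gu) q.1 q.2 rho0.
  exists (N, pp, d); split => //= g Gg h1 h2 s es bel.
  apply: (Hw e 0%N) => //; first exact: bel.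
  move=> a' b' /= va vb _.
  have ca : chordal (v c) a' < 2 * rho.
    have := hd1 _ _ up; rewrite (chordalC (v (u _))); have := chordal_triangle (v (u q.1)) (v c) a'; lra.
  have cb : chordal (v c) b' < 2 * rho.
    have := hd1 _ _ uq; rewrite (chordalC (v (u _))); have := chordal_triangle (v (u q.2)) (v c) b'; lra.
  have ab : chordal a' b' < 4 * rho.
    by have := chordal_triangle (v c) a' b'; rewrite (chordalC a' (v c)); lra.
  apply: hep; first by lra.
  move=> h Gh; apply: le_lt_trans (HL h Gh a' b' _ _) _; [lra|lra|].
  apply: lt_le_trans (_ : L * (4 * rho) <= _); last lra.
  by rewrite ltr_pM2l.
have [Npd hN] := choice loc.
have cSS : compact [set: S * S] by rewrite -setXTT; apply: compact_setX; exact: sphere_compact.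
have [|l [_ Hl]] := @compact_cover_seq _ [set: S * S]
   (fun q q' => chordal q.1 q'.1 < (Npd q).2 /\ chordal q.2 q'.2 < (Npd q).2) cSS.
  move=> q _; apply/nbhs_ballP; exists (Npd q).2; first by have [] := hN q.
  by move=> q' [/= + +]; rewrite !sphere_ballE.
have [|pm pm0 hpm] := @seq_min_gt0 R _ l (fun q => (Npd q).1.2); first by move=> q _; have [] := hN q.
pose A := [set e (g a) (g b) | g in G].
have [g0 Gg0 _] := G_kernel None.
have supA : has_sup A.
  by split; [exists (e (g0 a) (g0 b)), g0 | exists B => _ [g _ <-]].
have Asup g : G g -> e (g a) (g b) <= sup A by move=> Gg; apply: ub_le_sup; [case: supA|exists g].
(* The semigroup contains no formal identity, so (a, b) need not belong to its own orbit; one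
   application of the averaging inequality recovers it. *)
suff key : sup A <= eta.
  apply: submean_le => // f Gf; apply: le_trans key.
  exact: (Asup f (gen_base Gf)).
rewrite leNgt; apply/negP => lt.
have bel n : forall h, G h -> below e (sup A) n (h a) (h b).
  elim: n => [|n IH] h Gh /=; first exact: Asup.
  by split; [exact: Asup|move=> f Gf; apply: (IH (f \o h)); apply: gen_comp => //; exact: gen_base].
have : sup A <= sup A - (sup A - eta) * pm.
  apply: ge_sup; first by case: supA.
  move=> _ [g Gg <-]; have [q ql [h1 h2]] := Hl (g a, g b) I.
  have [_ _ /(_ g Gg h1 h2 (sup A) (ltW lt) bel)] := hN q.
  move/le_trans; apply; rewrite lerD2l lerN2 ler_wpM2l ?subr_ge0 ?(ltW lt) //.
  exact: hpm.
have h2 : 0 < (sup A - eta) * pm by rewrite mulr_gt0 ?subr_gt0.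
by rewrite lerDl oppr_ge0 leNgt h2.
Qed.

(** Every point is moved by some word to a normal point, near which e vanishes, so [word_step]
    applies with t = 0. A block of N letters then costs a factor Lam^N in distance and gains the
    factor 1 - p. *)
Theorem holder_bound : exists2 a : R, 0 < a & exists2 c : R, 0 < c &
  forall e B, (forall x y, e x y <= B) -> (forall x y, 0 <= e x y) -> submean e -> small_near_diagonal e ->
  forall x y, e x y <= c * B * (chordal x y) `^ a.
Proof.
have loc z : exists Npd : nat * R * R, [/\ 0 < Npd.1.2, 0 < Npd.2 & forall x y,
   chordal z x < Npd.2 -> chordal z y < Npd.2 ->
   forall e B s, (forall x y, e x y <= B) -> (forall x y, 0 <= e x y) -> submean e -> small_near_diagonal e ->
     0 <= s -> below e s Npd.1.1 x y -> e x y <= s - s * Npd.1.2].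
  have [w Gw nw] := G_kernel z.
  have [r r0 Hr] := vanish_near_normal nw.
  have [N [p [d [p0 d0 Hw]]]] := word_step Gw z z r0.
  exists (N, p, d); split => //= x y zx zy e B s eB e0 se de s0 bel.
  rewrite -{2}[s]subr0; apply: (Hw e 0%N) => //; first by rewrite addn0.
  by move=> a b wa wb _; rewrite (Hr a b wa wb e B).
have [Npd hN] := choice loc.
have [|l [_ Hl]] := @compact_cover_seq _ [set: S] (fun z z' => chordal z z' < (Npd z).2 / 2) (@sphere_compact R).
  move=> z _; apply/nbhs_chordal; exists ((Npd z).2 / 2) => //; rewrite divr_gt0 //.
  by have [] := hN z.
have [|p' p'0 hp'] := @seq_min_gt0 R _ l (fun z => (Npd z).1.2); first by move=> z _; have [] := hN z.
have [|d d0 hd] := @seq_min_gt0 R _ l (fun z => (Npd z).2 / 2).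
  by move=> z _; rewrite divr_gt0 //; have [] := hN z.
(* The cap 1/2 keeps the ratio 1 - p positive, as the logarithm in the exponent requires. *)
pose p := Num.min p' (1 / 2).
have p0 : 0 < p by rewrite lt_min p'0 divr_gt0.
have p1 : p <= 1 / 2 by rewrite ge_min lexx orbT.
have pp' : p <= p' by rewrite ge_min lexx.
(* The successor guarantees N >= 1, hence Lam^N >= 2. *)
pose N := (\max_(z <- l) (Npd z).1.1).+1.
have step e B s x y : (forall x y, e x y <= B) -> (forall x y, 0 <= e x y) -> submean e -> small_near_diagonal e ->
    0 <= s -> chordal x y < d -> below e s N x y -> e x y <= s * (1 - p).
  move=> eB e0 se de s0 xy bel; have [z zl zx] := Hl x I.
  have zd := hd z zl; have [pz0 dz0 Hz] := hN z.
  apply: le_trans (Hz x y _ _ e B s eB e0 se de s0 _) _.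
  - lra.
  - by have := chordal_triangle x z y; lra.
  - apply: below_mono bel; apply: leqW.
    by rewrite (big_rem z) //= leq_maxl.
  rewrite mulrBr mulr1 lerD2l lerN2 ler_wpM2l //; apply: le_trans pp' _; exact: hp'.
pose K := Lam ^+ N.
have Lam0 : 0 < Lam by exact: lt_le_trans Lam2.
have Lam1 : 1 <= Lam by apply: le_trans Lam2; rewrite ler1n.
have K2 : 2 <= K.
  rewrite /K exprS; apply: le_trans Lam2 _.
  by rewrite ler_peMr ?(ltW Lam0) // exprn_ege1.
have K0 : 0 < K by exact: lt_le_trans K2.
have K1 : 1 <= K by apply: le_trans K2; rewrite ler1n.
have q01 : 0 < 1 - p < 1 by apply/andP; split; lra.
have [a a0 [c c0 H]] := geometric_holder K2 q01 d0.
exists a => //; exists c => // e B eB e0 se de x y.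
have B0 : 0 <= B by apply: le_trans (eB x y).
apply: H => //; first exact: chordal_ge0.
move=> m; elim: m x y => [|m IH] x y xy; first by rewrite expr0 mulr1.
rewrite exprSr mulrA; apply: (step e B) => //.
- by rewrite mulr_ge0 // exprn_ge0 //; lra.
- apply: lt_le_trans xy _; rewrite ler_pdivrMr ?exprn_gt0 //.
  by rewrite ler_peMr ?(ltW d0) // exprn_ege1.
(* A pair that n letters cannot separate beyond scale m satisfies the m-th bound throughout those
   letters. *)
have : forall n x y, chordal x y * Lam ^+ n < d / K ^+ m -> below e (B * (1 - p) ^+ m) n x y.
  elim=> [|n IHn] x' y' h.
    by apply: IH; move: h; rewrite expr0 mulr1.
  split.
    apply: IH; apply: le_lt_trans h.
    by rewrite ler_peMr ?chordal_ge0 // exprn_ege1.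
  move=> f Gf; apply: IHn; apply: le_lt_trans h; rewrite exprS mulrA.
  apply: ler_wpM2r; first by rewrite exprn_ge0 // ltW.
  by rewrite mulrC; exact: Gam_lip.
apply; rewrite -/K; move: xy; rewrite exprS !ltr_pdivlMr ?mulr_gt0 ?exprn_gt0 //.
by rewrite mulrA.
Qed.
End HolderBound.

(** * The spherical distance *)

Section SphericalDistance.
Variable R : realType.
Local Notation S := (sphere R).

Lemma sin_MVT (t : R) : 0 <= t -> exists2 x : R, 0 <= x <= t & sin t = cos x * t.
Proof.
move=> t0; have [x xt E] := @MVT_segment R (@sin R) (@cos R) 0 t t0
  (fun x _ => is_derive_sin x) (continuous_subspaceT (@continuous_sin R)).
exists x; first by move: xt; rewrite in_itv.
by move: E; rewrite sin0 !subr0.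
Qed.

Lemma sin_le_id (t : R) : 0 <= t -> sin t <= t.
Proof.
move=> t0; have [x _ ->] := sin_MVT t0.
by rewrite -[leRHS]mul1r ler_wpM2r // cos_le1.
Qed.

(** Halving the angle: sin t >= t cos(t/2)^2 = t (1 + cos t) / 2, and the cosine is nonnegative on
    this range. *)
Lemma id_le_2sin (t : R) : 0 <= t <= pi / 2 -> t <= 2 * sin t.
Proof.
move=> /andP[t0 tp].
have t20 : 0 <= t / 2 by rewrite divr_ge0.
have pi0 : 0 < pi :> R := pi_gt0 R.
have [x /andP[x0 xt] E] := sin_MVT t20.
have ct : 0 <= cos t by apply: cos_ge0_pihalf; lra.
have c2 : 0 <= cos (t / 2) by apply: cos_ge0_pihalf; lra.
have cx : cos (t / 2) <= cos x.
  rewrite leNgt ltr_cos ?in_itv /= -?leNgt //; lra.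
have h1 : sin t = 2 * (cos x * (t / 2) * cos (t / 2)).
  rewrite {1}[t]splitr sinD E; ring.
have h2 : cos t = 2 * cos (t / 2) ^+ 2 - 1.
  rewrite {1}[t]splitr cosD; have := cos2Dsin2 (t / 2); move: (cos _) (sin _) => c s h; lra.
have h3 : cos (t / 2) ^+ 2 <= cos x * cos (t / 2) by rewrite expr2 ler_wpM2r.
rewrite h1; nra.
Qed.

Lemma half_chordal_itv (a b : S) : -1 <= chordal a b / 2 <= 1.
Proof. by have := chordal_ge0 a b; have := chordal_le2 a b => *; apply/andP; split; lra. Qed.

Lemma asin_half_itv (a b : S) : 0 <= asin (chordal a b / 2) <= pi / 2.
Proof.
have h := half_chordal_itv a b; rewrite asin_lepi2 // andbT leNgt; apply/negP => lt.
have pi0 : 0 < pi :> R := pi_gt0 R.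
have := asin_geNpi2 h => h2.
have : sin (asin (chordal a b / 2)) < sin 0.
  by rewrite ltr_sin // in_itv /= ?h2 /=; [lra|apply/andP; split; lra].
by rewrite sin0 asinK ?in_itv //= ltNge divr_ge0 // chordal_ge0.
Qed.

Lemma chordal_le_sdist (a b : S) : chordal a b <= sdist a b.
Proof.
have /andP[h _] := asin_half_itv a b; have := sin_le_id h.
by rewrite asinK ?in_itv /= ?half_chordal_itv // /sdist; lra.
Qed.

Lemma sdist_le_chordal (a b : S) : sdist a b <= 2 * chordal a b.
Proof.
have := id_le_2sin (asin_half_itv a b).
by rewrite asinK ?in_itv /= ?half_chordal_itv // /sdist; lra.
Qed.

Lemma sdist_ge0 (a b : S) : 0 <= sdist a b.
Proof. by apply: le_trans (chordal_le_sdist a b); exact: chordal_ge0. Qed.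

Lemma sdist_le4 (a b : S) : sdist a b <= 4.
Proof. by apply: le_trans (sdist_le_chordal a b) _; have := chordal_le2 a b; lra. Qed.

Lemma sdist_gt0 (a b : S) : a <> b -> 0 < sdist a b.
Proof.
move=> ab; apply: lt_le_trans (chordal_le_sdist a b).
by rewrite lt_def chordal_ge0 andbT; apply/eqP => /chordal_eq0.
Qed.

(** The spherical distance is an increasing function of the chordal one. Thus its sublevel
    conditions can be treated with the chordal triangle inequality, as in [kball_measurable]. *)
Lemma sdist_leP (q : R) : exists K : R, forall a b : S, (sdist a b <= q) = (chordal a b <= K).
Proof.
have pi0 : 0 < pi :> R := pi_gt0 R.
have [q0|q0] := ltrP q 0.
  exists (-1) => a b; rewrite !leNgt; congr (~~ _).
    have := sdist_ge0 a b; have := chordal_ge0 a b => h1 h2.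
  by rewrite (lt_le_trans q0 h2) (lt_le_trans _ h1) // ltrN10.
have [qp|qp] := lerP q pi; last first.
  exists 2 => a b; rewrite chordal_le2 /sdist; have /andP[_ h] := asin_half_itv a b; lra.
exists (2 * sin (q / 2)) => a b.
have -> : (sdist a b <= q) = (asin (chordal a b / 2) <= q / 2).
  by rewrite /sdist ler_pdivlMr // mulrC.
rewrite leNgt -ltr_sin ?in_itv /=; last 2 first.
- by lra.
- by have /andP[h1 h2] := asin_half_itv a b; rewrite h2 andbT; lra.
rewrite asinK ?in_itv /= ?half_chordal_itv // -leNgt.
by rewrite ler_pdivrMr // mulrC.
Qed.

Lemma kappa_ub (f g : RatT R) z : sdist (sval f z) (sval g z) <= kappa f g.
Proof.
apply: ub_le_sup; last by exists z.
by exists 4 => _ [w _ <-]; exact: sdist_le4.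
Qed.

Lemma kappa_le (f g : RatT R) (r : R) : (forall z, sdist (sval f z) (sval g z) <= r) -> kappa f g <= r.
Proof.
by move=> h; apply: ge_sup; [exists (sdist (sval f None) (sval g None)), None | move=> _ [z _ <-]].
Qed.

Lemma kappa_chordal (f g : RatT R) z : chordal (sval f z) (sval g z) <= kappa f g.
Proof. exact: le_trans (chordal_le_sdist _ _) (kappa_ub _ _ _). Qed.

Lemma kappa_le2 (f g : RatT R) (r : R) : (forall z, chordal (sval f z) (sval g z) <= r) -> kappa f g <= 2 * r.
Proof.
move=> h; apply: kappa_le => z; apply: le_trans (sdist_le_chordal _ _) _.
by rewrite ler_pM2l.
Qed.

(** Uniform chordal balls; the slack s < r makes them open for [kappa] by the chordal triangle
    inequality. *)
Definition near_set (f : S -> S) (r : R) : set (RatT R) :=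
  [set g | exists2 s, s < r & forall z, chordal (f z) (sval g z) <= s].

Lemma near_set_open f r : mopen (@kappa R) (near_set f r).
Proof.
move=> g [s sr hs]; exists ((r - s) / 2); first by rewrite divr_gt0 // subr_gt0.
move=> h gh; exists (s + (r - s) / 2); first lra.
move=> z; apply: le_trans (chordal_triangle (sval g z) _ _) _.
by apply: lerD => //; apply: le_trans (ltW gh); exact: kappa_chordal.
Qed.

Lemma semigroup_chart_rational (Gam : set (S -> S)) g :
  (forall f, Gam f -> isRat f) -> gen_semigroup Gam g -> chart_rational g.
Proof.
move=> hG Gg.
(* Only left composition by a generator is known to preserve the class, so the induction carries an
   arbitrary right factor h. *)
suff : forall h, chart_rational h -> chart_rational (g \o h) by move=> /(_ id (chart_rational_id R)).
elim: Gg => [f Gf|f1 f2 _ IH1 _ IH2] h rh.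
  by apply: chart_rational_form_comp rh; apply: isRat_form_rational; exact: hG.
exact: (IH1 (f2 \o h) (IH2 h rh)).
Qed.

Lemma fatou_normal (G : set (S -> S)) p : (forall g, G g -> chart_rational g) ->
  Fatou G p <-> normal_at G p.
Proof.
move=> hG; split=> [[r r0 hr]|np].
  have sp : sball p r p by rewrite /sball /= /sdist chordalxx mul0r -sin0 sinK ?mulr0 // in_itv /= oppr_le0 andbb divr_ge0 // pi_ge0.
  have [|dl dl0 hd] := hr p sp (1 / 8); first by rewrite divr_gt0.
  exists (Num.min r dl / 2); first by rewrite divr_gt0 // lt_min r0.
  move=> g Gg q pq; apply: le_lt_trans (chordal_le_sdist _ _) _.
  have : sdist p q < Num.min r dl by apply: le_lt_trans (sdist_le_chordal _ _) _; lra.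
  by rewrite lt_min => /andP[q1 q2]; exact: hd.
have [r r0 [L L0 H]] := normal_lipschitz hG np.
have cs x y (s : R) : sdist x y < s -> chordal x y < s by apply: le_lt_trans; exact: chordal_le_sdist.
exists r => // x /cs px e e0; exists (e / 2 / L); first by rewrite !divr_gt0.
move=> y /cs py /cs xy g Gg; apply: le_lt_trans (sdist_le_chordal _ _) _.
have := H g Gg x y px py; rewrite ltr_pdivlMr // mulrC in xy; lra.
Qed.

Lemma seq_max (T : eqType) (l : seq T) (F : T -> R) : exists2 L : R, 0 < L & forall x, x \in l -> F x <= L.
Proof.
elim: l => [|a l [L L0 h]]; first by exists 1.
exists (Num.max (F a) L); first by rewrite lt_max L0 orbT.
by move=> x; rewrite inE => /orP[/eqP->|/h]; rewrite le_max ?lexx // => ->; rewrite orbT.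
Qed.

(** Maps within 1/32 of f share its modulus: the oscillation is below 3/32 < 1/8, so they are all
    controlled with the same d. Pairs at distance at least s are covered by the diameter bound 2 =
    (2/s) s. *)
Lemma locally_uniformly_lipschitz (f : RatT R) : exists2 r : R, 0 < r & exists2 L : R, 0 < L &
  forall g, near_set (sval f) r g -> forall a b, chordal (sval g a) (sval g b) <= L * chordal a b.
Proof.
have rat (h : RatT R) : chart_rational (sval h).
  apply: (@chart_rational_form_comp R (sval h) id); last exact: chart_rational_id.
  by apply: isRat_form_rational; exact: (svalP h).
have e0 : 0 < 1 / 32 :> R by rewrite divr_gt0.
have [d d0 hd] := continuous_uniform (chart_rational_continuous (rat f)) e0.
have loc p : exists rL : R * R, [/\ 0 < rL.1, 0 < rL.2 &
  forall f, chart_rational f -> controlled f p d ->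
  forall a b, chordal p a < rL.1 -> chordal p b < rL.1 -> chordal (f a) (f b) <= rL.2 * chordal a b].
  by have [r r0 [L L0 H]] := controlled_lipschitz p d0; exists (r, L).
have [rL hrL] := choice loc.
have [|l [_ Hl]] := @compact_cover_seq _ [set: S] (fun z z' => chordal z z' < (rL z).1 / 2) (@sphere_compact R).
  move=> z _; apply/nbhs_chordal; exists ((rL z).1 / 2) => //; rewrite divr_gt0 //.
  by have [] := hrL z.
have [|s s0 hs] := @seq_min_gt0 R _ l (fun z => (rL z).1 / 2).
  by move=> z _; rewrite divr_gt0 //; have [] := hrL z.
have [L L0 hL] := seq_max l (fun z => (rL z).2).
exists (1 / 32) => //; exists (L + 2 / s); first by rewrite addr_gt0 // divr_gt0.
move=> g [t t1 ht] a b.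
have ab0 := chordal_ge0 a b.
have [ab|ab] := ltrP (chordal a b) s; last first.
  apply: le_trans (chordal_le2 _ _) _; rewrite mulrDl.
  have : 2 <= 2 / s * chordal a b by rewrite mulrAC ler_pdivlMr // ler_pM2l.
  have := mulr_ge0 (ltW L0) ab0; lra.
have [p pl pa] := Hl a I; have [r0' L0' H] := hrL p.
have cg : controlled (sval g) p d.
  move=> q /hd pq; have := ht p; have := ht q.
  have := chordal_triangle (sval f p) (sval g p) (sval g q).
  have := chordal_triangle (sval f q) (sval f p) (sval g q).
  rewrite (chordalC (sval g p) (sval f p)); lra.
have pb : chordal p b < (rL p).1.
  by have := chordal_triangle a p b; have := hs p pl; lra.
have pa' : chordal p a < (rL p).1 by lra.
apply: le_trans (H _ (rat g) cg a b pa' pb) _; apply: ler_wpM2r => //.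
have : 0 < 2 / s by rewrite divr_gt0.
have := hL p pl; lra.
Qed.

Lemma compact_uniformly_lipschitz (K : set (RatT R)) : mcompact (@kappa R) K ->
  exists2 L : R, 2 <= L & forall g, K g -> forall a b, chordal (sval g a) (sval g b) <= L * chordal a b.
Proof.
move=> cK.
pose lip (L : R) (U : set (RatT R)) := forall g, U g -> forall a b, chordal (sval g a) (sval g b) <= L * chordal a b.
have lip_le L L' U : L <= L' -> lip L U -> lip L' U.
  by move=> LL h g Ug a b; apply: le_trans (h g Ug a b) _; apply: ler_wpM2r LL; exact: chordal_ge0.
have [|f Kf|s [sF cov]] := cK [set U | mopen (@kappa R) U /\ exists L, lip L U].
- by move=> U [].
- have [r r0 [L L0 H]] := locally_uniformly_lipschitz f.
  exists (near_set (sval f) r).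
    by split; [exact: near_set_open|exists L].
  by exists 0 => // z; rewrite chordalxx.
have [L L2 hL] : exists2 L : R, 2 <= L & forall U, U \in s -> lip L U.
  elim: s {cov} sF => [|U s IH] sF; first by exists 2.
  have [|L L2 hL] := IH; first by move=> V Vs; apply: sF; rewrite inE Vs orbT.
  have [_ [L' hL']] := sF U (mem_head _ _).
  exists (Num.max L L'); first by rewrite le_max L2.
  move=> V; rewrite inE => /orP[/eqP->|/hL hV].
    by apply: lip_le hL'; rewrite le_max lexx orbT.
  by apply: lip_le hV; rewrite le_max lexx.
by exists L => // g /cov[U /hL hU Ug]; exact: hU.
Qed.
End SphericalDistance.

(** * Measures on the space of rational maps *)

Section RatMeasure.
Variable R : realType.
Local Notation S := (sphere R).

Lemma kopen_measurable (U : set (RatM R)) : mopen (@kappa R) U -> measurable U.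
Proof. by move=> oU; exact: sub_sigma_algebra. Qed.

Lemma near_set_measurable (f : S -> S) (r : R) : measurable (near_set f r : set (RatM R)).
Proof. by apply: kopen_measurable; exact: near_set_open. Qed.

Lemma kcontinuous_measurable (F : RatM R -> R) :
  (forall f (e : R), 0 < e -> exists2 d : R, 0 < d & forall g, kappa f g < d -> `|F f - F g| < e) ->
  measurable_fun setT F.
Proof.
move=> cF mT; apply: (measurability _ (RGenOInfty.measurableE R)) => //.
move=> _ [_ [x ->] <-]; rewrite setTI; apply: kopen_measurable => f /=.
rewrite in_itv /= andbT => xf.
have xf0 : 0 < F f - x by rewrite subr_gt0.
have [d d0 hd] := cF f _ xf0; exists d => // g /hd; rewrite in_itv /= andbT ltr_norml; lra.
Qed.

(** The support is defined by [kappa]-balls. Such a ball is a countable union of closed sets, each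
    given by a non-strict inequality at all points. *)
Lemma kball_measurable (f : RatT R) (r : R) : measurable ([set g | kappa f g < r] : set (RatM R)).
Proof.
pose A n : set (RatM R) := [set g | forall z, sdist (sval f z) (sval g z) <= r - n.+1%:R^-1].
have -> : [set g | kappa f g < r] = \bigcup_n A n.
  apply/seteqP; split=> [g /= fg|g [n _ /= h]].
    have [n hn] := ltr_add_invr fg; exists n => // z.
    by apply: le_trans (kappa_ub f g z) _; rewrite lerBrDr ltW.
  apply: le_lt_trans (kappa_le h) _.
  by rewrite gtrBl.
apply: bigcup_measurable => n _; rewrite -[A n]setCK; apply: measurableC.
apply: kopen_measurable => g /existsNP[z]; have [K hK] := sdist_leP (r - n.+1%:R^-1).
rewrite hK => /negP; rewrite -ltNge => Kz.
exists (chordal (sval f z) (sval g z) - K); first by rewrite subr_gt0.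
move=> h gh hA; have := hA z; rewrite hK.
have := kappa_chordal g h z; have := chordal_triangle (sval h z) (sval f z) (sval g z).
rewrite (chordalC (sval h z)); lra.
Qed.

Variable tau : probability (RatM R) R.
Local Notation Gam := (Gamma_tau tau).

Lemma near_set_gt0 f (r : R) : Gam f -> 0 < r -> (0 < tau (near_set (sval f) r))%E.
Proof.
move=> Gf r0; have r20 : 0 < r / 2 by rewrite divr_gt0.
apply: lt_le_trans (Gf _ r20) _; apply: le_measure; rewrite ?inE.
- exact: kball_measurable.
- exact: near_set_measurable.
move=> g /= fg; exists (r / 2); first lra.
by move=> z; apply: le_trans (kappa_chordal f g z) (ltW fg).
Qed.

Lemma kball_null f : ~ Gam f -> exists2 r : R, 0 < r & tau [set g : RatM R | kappa f g < r] = 0%E.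
Proof.
move=> nG; apply: contrapT => h; apply: nG => r r0.
rewrite lt_def measure_ge0 andbT; apply/eqP => E; apply: h; exists r => //.
Qed.

Lemma kball_null_sub (f : RatT R) (A : set (RatM R)) (r : R) : measurable A ->
  A `<=` [set g | kappa f g < r] -> tau [set g : RatM R | kappa f g < r] = 0%E -> tau A = 0%E.
Proof.
move=> mA sub E; apply/eqP; rewrite eq_le measure_ge0 andbT -E; apply: le_measure; rewrite ?inE //.
exact: kball_measurable.
Qed.

Lemma Gamma_closed : mopen (@kappa R) (~` Gam).
Proof.
move=> f /kball_null[r r0 Er]; exists (r / 8); first by rewrite divr_gt0.
move=> g fg Gg; have r80 : 0 < r / 8 by rewrite divr_gt0.
have := Gg _ r80; rewrite (kball_null_sub (kball_measurable g (r / 8)) _ Er) ?ltxx //.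
move=> h /= gh.
have : kappa f h <= 2 * (r / 8 + r / 8).
  apply: kappa_le2 => z; apply: le_trans (chordal_triangle (sval g z) _ _) _.
  by apply: lerD; apply: le_trans (kappa_chordal _ _ _) (ltW _).
lra.
Qed.

Lemma Gamma_measurable : measurable (Gam : set (RatM R)).
Proof.
by rewrite -[X in measurable X]setCK; apply: measurableC; apply: kopen_measurable; exact: Gamma_closed.
Qed.

(* Separability of Rat: a rational map is coded, up to 4/(k+1), by a modulus of continuity
   and its rounded values on a finite net. *)
Lemma Gamma_full : tau (~` (Gam : set (RatM R))) = 0%E.
Proof.
have kpos k : 0 < k.+1%:R^-1 :> R by [].
have nets k : exists l : seq S, forall p, exists2 q, q \in l & chordal p q < k.+1%:R^-1.
  by have [l hl] := sphere_net (kpos k); exists l.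
have [net hnet] := choice nets.
pose A (c : nat * (nat * seq nat)) : set (RatM R) := [set f |
  (forall p q, chordal p q < c.2.1.+1%:R^-1 -> chordal (sval f p) (sval f q) < c.1.+1%:R^-1) /\
  forall i, (i < size (net c.2.1))%N ->
     chordal (sval f (nth None (net c.2.1) i)) (nth None (net c.1) (nth 0%N c.2.2 i)) < c.1.+1%:R^-1].
have Aclose c f g z : A c f -> A c g -> chordal (sval f z) (sval g z) <= 4 * c.1.+1%:R^-1.
  move=> [f1 f2] [g1 g2]; have [q ql zq] := hnet c.2.1 z.
  have iq : (index q (net c.2.1) < size (net c.2.1))%N by rewrite index_mem.
  have := f2 _ iq; have := g2 _ iq; rewrite nth_index //.
  set v := nth None (net c.1) _ => gv fv.
  have fz := f1 _ _ zq; have gz := g1 _ _ zq.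
  have := chordal_triangle (sval f q) (sval f z) (sval g z).
  have := chordal_triangle v (sval f q) (sval g z).
  have := chordal_triangle (sval g q) v (sval g z).
  rewrite (chordalC v (sval g q)) (chordalC (sval g q) (sval g z)).
  move: (c.1.+1%:R^-1) fv gv fz gz => w; lra.
have Acover k f : exists c, c.1 = k /\ A c f.
  have rf : chart_rational (sval f).
    apply: (@chart_rational_form_comp R (sval f) id); last exact: chart_rational_id.
    by apply: isRat_form_rational; exact: (svalP f).
  have [d d0 hd] := continuous_uniform (chart_rational_continuous rf) (kpos k).
  have [n hn] := ltr_add_invr d0; rewrite add0r in hn.
  pose code p := find (fun q => chordal (sval f p) q < k.+1%:R^-1) (net k).
  exists (k, (n, [seq code p | p <- net n])); split=> //; split=> /=.
    by move=> p q pq; apply: hd; exact: lt_trans hn.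
  move=> i ni; rewrite (nth_map None) //.
  have has : has (fun q => chordal (sval f (nth None (net n) i)) q < k.+1%:R^-1) (net k).
    by have [q ql hq] := hnet k (sval f (nth None (net n) i)); apply/hasP; exists q.
  exact: (nth_find None has).
(* One null ball serves a whole cell: two maps of a cell are within 8/(k+1) in [kappa], below the
   radius 9/(k+1). Cells are coded by natural numbers, so countably many null balls cover the
   complement of the support. *)
have Bex c : exists B : set (RatM R), [/\ measurable B, tau B = 0%E &
   forall f, A c f -> tau [set g : RatM R | kappa f g < 9 * c.1.+1%:R^-1] = 0%E -> B f].
  have [[f0 [Af0 E0]]|h] := pselect (exists f0, A c f0 /\ tau [set g : RatM R | kappa f0 g < 9 * c.1.+1%:R^-1] = 0%E).
    exists [set g | kappa f0 g < 9 * c.1.+1%:R^-1]; split=> //; first exact: kball_measurable.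
    move=> f Af _ /=; have : kappa f0 f <= 2 * (4 * c.1.+1%:R^-1) by apply: kappa_le2 => z; exact: Aclose.
    have := kpos c.1; move: (c.1.+1%:R^-1) => w; lra.
  exists set0; split=> //.
  by move=> f Af Ef; apply: h; exists f.
have [B hB] := choice Bex.
pose F j : set (RatM R) := if unpickle j is Some c then B c else set0.
have F0 : tau.-negligible (\bigcup_j F j).
  apply: negligible_bigcup => j; rewrite /F; case: unpickle => [c|]; last exact: negligible_set0.
  by have [mB B0 _] := hB c; exists (B c); split.
apply: measure_negligible; first by apply: measurableC; exact: Gamma_measurable.
apply: negligibleS F0 => f /kball_null[r r0 Er].
have [k hk] : exists k : nat, 9 * k.+1%:R^-1 < r.
  have r90 : 0 < r / 9 by rewrite divr_gt0.
  have [k hk] := ltr_add_invr r90; exists k; rewrite add0r in hk.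
  by rewrite mulrC -ltr_pdivlMr.
have [c [ck Ac]] := Acover k f; have [_ _ Bc] := hB c.
exists (pickle c) => //; rewrite /F pickleK; apply: Bc => //.
apply: (kball_null_sub (kball_measurable _ _) _ Er) => g /= h.
by apply: lt_trans h _; rewrite ck.
Qed.

Definition tau_mass (g : S -> S) (h : R) : R := fine (tau (near_set g h)).

Lemma tau_massE g h : (tau_mass g h)%:E = tau (near_set g h).
Proof. by rewrite /tau_mass fineK // fin_num_measure //; exact: near_set_measurable. Qed.

Lemma tau_mass_gt0 f (r : R) : Gam f -> 0 < r -> 0 < tau_mass (sval f) r.
Proof. by move=> Gf r0; rewrite -lte_fin tau_massE; exact: near_set_gt0. Qed.

(** The integral is split over the support near f0, the support away from f0, and the null
    complement of the support. *)
Lemma integral_submean (e : S -> S -> R) (B : R) :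
  (forall x y, 0 <= e x y) -> (forall x y, e x y <= B) ->
  (forall x y, measurable_fun setT (fun f : RatM R => e (sval f x) (sval f y))) ->
  (forall x y, ((e x y)%:E <= \int[tau]_(f in setT) (e (sval f x) (sval f y))%:E)%E) ->
  submean [set sval f | f in Gam] tau_mass e.
Proof.
move=> e0 eB me ie x y g h s t [f0 Gf0 <-] h0 ts hs ht {g}.
have t0 : 0 <= t.
  apply: le_trans (e0 (sval f0 x) (sval f0 y)) _; apply: ht; first by exists f0.
  by move=> z; rewrite chordalxx.
have s0 : 0 <= s by exact: le_trans ts.
have B0 : 0 <= B by apply: le_trans (e0 x y) (eB x y).
pose O : set (RatM R) := near_set (sval f0) h.
have mO : measurable O by exact: near_set_measurable.
have mG := Gamma_measurable.
pose F (f : RatM R) := (e (sval f x) (sval f y))%:E.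
have mF (D : set (RatM R)) : measurable D -> measurable_fun D F.
  move=> mD; apply: measurable_funTS; apply/measurable_EFinP; exact: me.
have bnd (D : set (RatM R)) (u : R) : measurable D -> (forall f, D f -> e (sval f x) (sval f y) <= u) ->
    (\int[tau]_(f in D) F f <= u%:E * tau D)%E.
  move=> mD hu; rewrite -integral_cst //; apply: ge0_le_integral => //.
  - by move=> f _; rewrite lee_fin.
  - exact: mF.
have split1 (D E : set (RatM R)) : measurable D -> measurable E ->
    (\int[tau]_(f in D) F f = \int[tau]_(f in D `&` E) F f + \int[tau]_(f in D `\` E) F f)%E.
  move=> mD mE; rewrite -[in LHS](setUIDK D E) ge0_integral_setU //.
  - exact: measurableI.
  - exact: measurableD.
  - by apply: mF; apply: measurableU; [exact: measurableI|exact: measurableD].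
  - by move=> f _; rewrite lee_fin.
  - by apply/disj_setPS => f [[_ Ef] [_]].
have I1 : (\int[tau]_(f in setT) F f <= t%:E * tau (Gam `&` O) + s%:E * tau (Gam `\` O) + 0)%E.
  rewrite (split1 setT Gam) // setTI (split1 Gam O) //.
  apply: leeD; last first.
    rewrite -(mule0 B%:E) -Gamma_full setTD; apply: bnd; first exact: measurableC.
    by move=> f _; exact: eB.
  apply: leeD; apply: bnd.
  - exact: measurableI.
  - move=> f [Gf [r rh hr]]; apply: ht; first by exists f.
    by move=> z; rewrite chordalC; exact: le_lt_trans rh.
  - exact: measurableD.
  - by move=> f [Gf _]; apply: hs; exists f.
have m1 : (tau (Gam `&` O) <= (tau_mass (sval f0) h)%:E)%E.
  by rewrite tau_massE; apply: le_measure; rewrite ?inE //; exact: measurableI.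
have m2 : (tau (Gam `\` O) <= (1 - tau_mass (sval f0) h)%:E)%E.
  rewrite EFinB tau_massE -probability_setC //; apply: le_measure; rewrite ?inE //.
  - exact: measurableD.
  - exact: measurableC.
rewrite -lee_fin; apply: le_trans (ie x y) _; apply: le_trans I1 _; rewrite adde0.
apply: (@le_trans _ _ (t%:E * (tau_mass (sval f0) h)%:E + s%:E * (1 - tau_mass (sval f0) h)%:E)%E).
  by apply: leeD; apply: lee_wpmul2l; rewrite ?lee_fin.
rewrite -!EFinM -EFinD lee_fin; lra.
Qed.

Hypothesis Gam_compact : mcompact (@kappa R) Gam.
Hypothesis Jker_empty : Jker (G_tau tau) = set0.
Hypothesis Julia_nonempty : Julia (G_tau tau) !=set0.

Lemma G_tau_rational g : G_tau tau g -> chart_rational g.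
Proof.
by apply: semigroup_chart_rational => _ [f _ <-]; exact: (svalP f).
Qed.

Lemma integral_holder_bound : exists2 a : R, 0 < a & exists2 c : R, 0 < c &
  forall (e : S -> S -> R) (B : R), (forall x y, 0 <= e x y) -> (forall x y, e x y <= B) ->
  (forall x y, measurable_fun setT (fun f : RatM R => e (sval f x) (sval f y))) ->
  (forall x y, ((e x y)%:E <= \int[tau]_(f in setT) (e (sval f x) (sval f y))%:E)%E) ->
  small_near_diagonal [set sval f | f in Gam] e ->
  forall x y, e x y <= c * B * (chordal x y) `^ a.
Proof.
have [L L2 HL] := compact_uniformly_lipschitz Gam_compact.
have [||||a a0 [c c0 H]] := @holder_bound R [set sval f | f in Gam] G_tau_rational _ _ L L2 _ tau_mass _.
- move=> p; apply: contrapT => h.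
  have : Jker (G_tau tau) p.
    move=> g Gg Fg; apply: h; exists g => //; apply/fatou_normal => //; exact: G_tau_rational.
  by rewrite Jker_empty.
- have [p Jp] := Julia_nonempty; exists p => np; apply: Jp; apply/fatou_normal => //.
  exact: G_tau_rational.
- by move=> _ [f Gf <-]; exact: HL.
- by move=> _ h [f Gf <-]; exact: tau_mass_gt0.
exists a => //; exists c => // e B e0 eB me ie de; apply: H => //.
exact: integral_submean eB me ie.
Qed.
End RatMeasure.

(** * Peripheral eigenfunctions *)

Section Recurrence.
Variable R : realType.
Local Notation C := R[i].
Local Notation S := (sphere R).

(** Pigeonhole on the cells of a finite net. The bound K is uniform in a, which the simultaneous
    version relies on. *)
Lemma unimodular_recurrence1 (e : R) : 0 < e -> exists K : nat, forall a : C, cabs a = 1 ->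
  exists n : nat, (0 < n <= K)%N /\ cabs (a ^+ n - 1) < e.
Proof.
(* Powers in one cell are within e/4 chordally, and on the unit disc Euclidean distance is at most 4
   times chordal distance. *)
move=> e0; have e80 : 0 < e / 8 by rewrite divr_gt0.
have [l hl] := sphere_net e80.
have l0 : (0 < size l)%N by have [q] := hl None; case: (l).
exists (size l) => a a1.
have aX i : cabs (a ^+ i) = 1 by rewrite cabsX a1 expr1n.
pose cell (i : nat) := find (fun q => chordal (Some (a ^+ i)) q < e / 8) l.
have cell_lt i : (cell i < size l)%N.
  by rewrite -has_find; have [q ql h] := hl (Some (a ^+ i)); apply/hasP; exists q.
have close i j : cell i = cell j -> cabs (a ^+ i - a ^+ j) < e.
  move=> E; have hasc k : has (fun q => chordal (Some (a ^+ k)) q < e / 8) l by rewrite has_find cell_lt.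
  have h1 := nth_find None (hasc i); have h2 := nth_find None (hasc j).
  rewrite -/(cell i) in h1; rewrite -/(cell j) -E in h2.
  have := chordal_triangle (nth None l (cell i)) (Some (a ^+ i)) (Some (a ^+ j)).
  rewrite (chordalC (nth None l (cell i)) (Some (a ^+ j))) => tri.
  have ai1 : cabs (a ^+ i) <= 1 by rewrite aX.
  have aj1 : cabs (a ^+ j) <= 1 by rewrite aX.
  apply: le_lt_trans (cabs_le_chordal ai1 aj1) _.
  have -> : (1 + 1) ^+ 2 = 4 :> R by ring.
  lra.
pose f (i : 'I_(size l).+1) : 'I_(size l) := Ordinal (cell_lt i).
have [i [j [ij E]]] : exists i j : 'I_(size l).+1, (i < j)%N /\ cell i = cell j.
  apply: contrapT => h.
  have : injective f.
    move=> i j Eij; have E : cell i = cell j by exact: (congr1 (@nat_of_ord (size l)) Eij).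
    have [lt|lt|] := ltngtP i j; [case: h; exists i, j; by split| |exact: val_inj].
    by case: h; exists j, i; split.
  by move/leq_card; rewrite !card_ord ltnn.
exists (j - i)%N; split.
  by rewrite subn_gt0 ij /= leq_subLR -ltnS (leq_trans (ltn_ord j)) // ltnS leq_addl.
have := close j i (esym E); rewrite -{1}(subnKC (ltnW ij)) exprD -{2}[a ^+ i]mulr1 -mulrBr cabsM aX mul1r.
by [].
Qed.

Lemma unimodular_powB1 (a : C) k : cabs a = 1 -> cabs (a ^+ k - 1) <= k%:R * cabs (a - 1).
Proof.
move=> a1; elim: k => [|k IH]; first by rewrite expr0 subrr cabs0 mul0r.
have -> : a ^+ k.+1 - 1 = a ^+ k * (a - 1) + (a ^+ k - 1) by rewrite exprS; ring.
apply: le_trans (cabsD _ _) _; rewrite cabsM cabsX a1 expr1n mul1r -natr1 mulrDl mul1r addrC.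
by rewrite lerD2r.
Qed.

(** Passing to N-th powers forces n >= N. In the induction the tail returns within e/(K+1) at time
    n1, and a further factor n2 <= K, chosen for the head, multiplies that error by at most K. *)
Lemma unimodular_recurrence (l : seq C) (N : nat) (e : R) : (forall a, a \in l -> cabs a = 1) -> 0 < e ->
  exists n, (N <= n)%N /\ forall a, a \in l -> cabs (a ^+ n - 1) < e.
Proof.
move=> hl e0.
suff [n n0 hn] : exists2 n, (0 < n)%N & forall a, a \in map (fun a => a ^+ N) l -> cabs (a ^+ n - 1) < e.
  exists (N * n)%N; split; first by rewrite leq_pmulr.
  by move=> a al; rewrite exprM; apply: hn; apply: map_f.
have {hl} : forall a, a \in map (fun a => a ^+ N) l -> cabs a = 1.
  by move=> _ /mapP[a al ->]; rewrite cabsX hl // expr1n.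
elim: (map _ l) e e0 => {l N} [|a l IH] e e0 hl; first by exists 1%N.
have [K hK] := unimodular_recurrence1 e0.
have e'0 : 0 < e / K.+1%:R by rewrite divr_gt0.
have [|n1 n10 h1] := IH _ e'0; first by move=> b bl; apply: hl; rewrite inE bl orbT.
have [|n2 [/andP[n20 n2K] h2]] := hK (a ^+ n1).
  by rewrite cabsX hl ?mem_head // expr1n.
exists (n1 * n2)%N; first by rewrite muln_gt0 n10.
move=> b; rewrite inE exprM => /orP[/eqP->//|bl].
have b1 : cabs (b ^+ n1) = 1 by rewrite cabsX hl ?expr1n // inE bl orbT.
apply: le_lt_trans (unimodular_powB1 n2 b1) _.
have := h1 b bl; rewrite ltr_pdivlMr // mulrC => h.
apply: le_lt_trans h; apply: ler_wpM2r; first exact: cabs_ge0.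
by rewrite ler_nat leqW.
Qed.
End Recurrence.

(** * The averaging operator on continuous functions *)

Section TransitionOperator.
Variable R : realType.
Local Notation C := R[i].
Local Notation S := (sphere R).
Variable tau : probability (RatM R) R.
Local Notation M := (Mtau tau).
Local Notation Gam := (Gamma_tau tau).

Definition kgood (F : RatM R -> C) :=
  (forall f (e : R), 0 < e -> exists2 d : R, 0 < d & forall g, kappa f g < d -> cabs (F f - F g) < e) /\
  exists B : R, forall f, cabs (F f) <= B.

Lemma kcont_integrable (F : RatM R -> R) (B : R) :
  (forall f (e : R), 0 < e -> exists2 d : R, 0 < d & forall g, kappa f g < d -> `|F f - F g| < e) ->
  (forall f, `|F f| <= B) -> tau.-integrable setT (EFin \o F).
Proof.
move=> cF bF; apply: measurable_bounded_integrable => //.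
- by rewrite ltey_eq fin_num_measure.
- exact: kcontinuous_measurable.
exists B; split; first exact: num_real.
by move=> x Bx f _; apply: le_trans (bF f) (ltW Bx).
Qed.

Lemma kgood_Re F : kgood F -> tau.-integrable setT (EFin \o (fun f => complex.Re (F f))).
Proof.
move=> [cF [B bF]]; apply: (kcont_integrable (B := B)).
  move=> f e e0; have [d d0 hd] := cF f e e0; exists d => // g /hd; apply: le_lt_trans.
  by have := Re_le_cabs (F f - F g); rewrite raddfB.
by move=> f; apply: le_trans (Re_le_cabs _) (bF f).
Qed.

Lemma kgood_Im F : kgood F -> tau.-integrable setT (EFin \o (fun f => complex.Im (F f))).
Proof.
move=> [cF [B bF]]; apply: (kcont_integrable (B := B)).
  move=> f e e0; have [d d0 hd] := cF f e e0; exists d => // g /hd; apply: le_lt_trans.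
  by have := Im_le_cabs (F f - F g); rewrite raddfB.
by move=> f; apply: le_trans (Im_le_cabs _) (bF f).
Qed.

Lemma kgood_cabs F : kgood F -> tau.-integrable setT (EFin \o (fun f => cabs (F f))).
Proof.
move=> [cF [B bF]]; apply: (kcont_integrable (B := B)).
  move=> f e e0; have [d d0 hd] := cF f e e0; exists d => // g /hd; apply: le_lt_trans.
  rewrite ler_norml; have := cabs_lb (F f) (F g); have := cabs_lb (F g) (F f).
  by rewrite (cabsB (F g)) => *; apply/andP; split; lra.
by move=> f; rewrite ger0_norm ?cabs_ge0.
Qed.

Lemma kgood_add F H : kgood F -> kgood H -> kgood (fun f => F f + H f).
Proof.
move=> [cF [B bF]] [cH [B' bH]]; split.
  move=> f e e0; have e20 : 0 < e / 2 by rewrite divr_gt0.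
  have [d d0 hd] := cF f _ e20; have [d' d'0 hd'] := cH f _ e20.
  exists (Num.min d d'); first by rewrite lt_min d0.
  move=> g; rewrite lt_min => /andP[/hd h1 /hd' h2].
  have -> : F f + H f - (F g + H g) = (F f - F g) + (H f - H g) by ring.
  by apply: le_lt_trans (cabsD _ _) _; lra.
by exists (B + B') => f; apply: le_trans (cabsD _ _) (lerD (bF f) (bH f)).
Qed.

Lemma kgood_scale (k : C) F : kgood F -> kgood (fun f => k * F f).
Proof.
move=> [cF [B bF]]; split.
  move=> f e e0; have k0 : 0 < cabs k + 1 by have := cabs_ge0 k; lra.
  have [d d0 hd] := cF f (e / (cabs k + 1)) (divr_gt0 e0 k0).
  exists d => // g /hd; rewrite -mulrBr cabsM ltr_pdivlMr // mulrDr mulr1 mulrC.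
  by have := cabs_ge0 (F f - F g); lra.
by exists (cabs k * B) => f; rewrite cabsM; apply: ler_wpM2l => //; exact: cabs_ge0.
Qed.

Lemma cint_add F H : kgood F -> kgood H -> cint tau (fun f => F f + H f) = cint tau F + cint tau H.
Proof.
move=> gF gH; rewrite /cint; apply/eqP; rewrite eq_complex /=; apply/andP; split; apply/eqP.
  rewrite -RintegralD //; [|exact: kgood_Re|exact: kgood_Re].
  by apply: eq_Rintegral => f _; rewrite raddfD.
rewrite -RintegralD //; [|exact: kgood_Im|exact: kgood_Im].
by apply: eq_Rintegral => f _; rewrite raddfD.
Qed.

Lemma cint_scale (k : C) F : kgood F -> cint tau (fun f => k * F f) = k * cint tau F.
Proof.
move=> gF; have iR := kgood_Re gF; have iI := kgood_Im gF.
have Z (x : R) (H : RatM R -> R) : tau.-integrable setT (EFin \o H) ->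
   tau.-integrable setT (EFin \o (fun f => x * H f)).
  by move=> iH; have := integrableZl (measurableT) x iH; rewrite /= ; apply: eq_integrable => // f _.
case: k => a b; rewrite /cint; apply/eqP; rewrite eq_complex /=; apply/andP; split; apply/eqP.
  rewrite -!RintegralZl // -RintegralB //; [|exact: Z|exact: Z].
  by apply: eq_Rintegral => f _; case: (F f).
rewrite -!RintegralZl // -RintegralD //; [|exact: Z|exact: Z].
by apply: eq_Rintegral => f _; case: (F f) => u v /=.
Qed.

(** The integral is rotated onto the positive axis, which leaves only a comparison of real parts. *)
Lemma cint_cabs F : kgood F -> cabs (cint tau F) <= \int[tau]_(f in setT) cabs (F f).
Proof.
move=> gF; have [w0|w0] := eqVneq (cint tau F) 0.
  by rewrite w0 cabs0; apply: Rintegral_ge0 => f _; exact: cabs_ge0.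
pose w := cint tau F; pose th := (w^*)%C / ((cabs w)%:C)%C.
have cw : 0 < cabs w by rewrite cabs_gt0.
have th1 : cabs th = 1.
  by rewrite /th cabsM cabsV cabs_conj cabs_real ger0_norm ?cabs_ge0 // divff ?gt_eqF.
have E : th * w = ((cabs w)%:C)%C.
  rewrite /th mulrAC mul_conj expr2 rmorphM /= mulfK //.
  by rewrite -cabs_eq0 cabs_real ger0_norm ?cabs_ge0 // gt_eqF.
have gth := kgood_scale th gF.
have : complex.Re (cint tau (fun f => th * F f)) = cabs w by rewrite cint_scale // -/w E.
rewrite /= -/w => <-; apply: le_Rintegral => //.
- exact: kgood_Re.
- exact: kgood_cabs.
move=> f _; apply: le_trans (ler_norm _) _; apply: le_trans (Re_le_cabs _) _.
by rewrite cabsM th1 mul1r.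
Qed.

Lemma ccont_bounded (phi : S -> C) : ccont phi -> exists2 B : R, 0 <= B & forall z, cabs (phi z) <= B.
Proof.
move=> cphi.
have loc x : exists d : R, 0 < d /\ forall y, sdist x y < d -> cabs (phi x - phi y) < 1.
  by have [d d0 hd] := cphi x 1 ltr01; exists d.
have [d hd] := choice loc.
have [|l [_ Hl]] := @compact_cover_seq _ [set: S] (fun z z' => chordal z z' < d z / 2) (@sphere_compact R).
  by move=> z _; apply/nbhs_chordal; exists (d z / 2) => //; rewrite divr_gt0 //; case: (hd z).
have [L L0 hL] := seq_max l (fun z => cabs (phi z)).
exists (L + 1); first lra.
move=> z; have [x xl xz] := Hl z I; have [dx0 hx] := hd x.
have : cabs (phi x - phi z) < 1 by apply: hx; apply: le_lt_trans (sdist_le_chordal _ _) _; lra.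
have := hL x xl; have := cabs_lb (phi z) (phi x); rewrite cabsB; lra.
Qed.

Lemma ccont_uniform (phi : S -> C) (e : R) : ccont phi -> 0 < e ->
  exists2 d : R, 0 < d & forall x y, chordal x y < d -> cabs (phi x - phi y) < e.
Proof.
move=> cphi e0; have e20 : 0 < e / 2 by rewrite divr_gt0.
have loc x : exists d : R, 0 < d /\ forall y, sdist x y < d -> cabs (phi x - phi y) < e / 2.
  by have [d d0 hd] := cphi x _ e20; exists d.
have [d hd] := choice loc.
have [|l [_ Hl]] := @compact_cover_seq _ [set: S] (fun z z' => chordal z z' < d z / 4) (@sphere_compact R).
  by move=> z _; apply/nbhs_chordal; exists (d z / 4) => //; rewrite divr_gt0 //; case: (hd z).
have [|m m0 hm] := @seq_min_gt0 R _ l (fun z => d z / 4).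
  by move=> z _; rewrite divr_gt0 //; case: (hd z).
exists m => // x y xy; have [z zl zx] := Hl x I; have [dz0 hz] := hd z; have := hm z zl => mz.
have h1 : cabs (phi z - phi x) < e / 2 by apply: hz; apply: le_lt_trans (sdist_le_chordal _ _) _; lra.
have h2 : cabs (phi z - phi y) < e / 2.
  apply: hz; apply: le_lt_trans (sdist_le_chordal _ _) _.
  by have := chordal_triangle x z y; lra.
by have := cabs_tri (phi z) (phi x) (phi y); rewrite (cabsB (phi x) (phi z)); lra.
Qed.

Lemma kgood_ev (phi : S -> C) z : ccont phi -> kgood (fun f => phi (sval f z)).
Proof.
move=> cphi; split; last by have [B _ hB] := ccont_bounded cphi; exists B.
move=> f e e0; have [d d0 hd] := cphi (sval f z) e e0; exists d => // g fg.
by apply: hd; apply: le_lt_trans (kappa_ub f g z) fg.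
Qed.

Lemma ccont_add (phi psi : S -> C) : ccont phi -> ccont psi -> ccont (fun z => phi z + psi z).
Proof.
move=> c1 c2 x e e0; have e20 : 0 < e / 2 by rewrite divr_gt0.
have [d d0 hd] := c1 x _ e20; have [d' d'0 hd'] := c2 x _ e20.
exists (Num.min d d'); first by rewrite lt_min d0.
move=> y; rewrite lt_min => /andP[/hd h1 /hd' h2].
have -> : phi x + psi x - (phi y + psi y) = (phi x - phi y) + (psi x - psi y) by ring.
by apply: le_lt_trans (cabsD _ _) _; lra.
Qed.

Lemma ccont_scale (k : C) (phi : S -> C) : ccont phi -> ccont (fun z => k * phi z).
Proof.
move=> c1 x e e0; have k0 : 0 < cabs k + 1 by have := cabs_ge0 k; lra.
have [d d0 hd] := c1 x (e / (cabs k + 1)) (divr_gt0 e0 k0).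
exists d => // y /hd; rewrite -mulrBr cabsM ltr_pdivlMr // mulrDr mulr1 mulrC.
by have := cabs_ge0 (phi x - phi y); lra.
Qed.

Lemma ccont_sum (s : seq (C * (S -> C))) (k : C * (S -> C) -> C) : (forall p, p \in s -> ccont p.2) ->
  ccont (fun z => \sum_(p <- s) k p * p.2 z).
Proof.
elim: s => [|p s IH] h.
  by move=> x e e0; exists 1 => // y _; rewrite !big_nil subrr cabs0.
have -> : (fun z => \sum_(q <- p :: s) k q * q.2 z) = (fun z => k p * p.2 z + \sum_(q <- s) k q * q.2 z).
  by apply: funext => z; rewrite big_cons.
apply: ccont_add; first by apply: ccont_scale; apply: h; rewrite mem_head.
by apply: IH => q qs; apply: h; rewrite inE qs orbT.
Qed.

Lemma Mtau_add (phi psi : S -> C) z : ccont phi -> ccont psi ->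
  M (fun z => phi z + psi z) z = M phi z + M psi z.
Proof. by move=> c1 c2; apply: cint_add; exact: kgood_ev. Qed.

Lemma Mtau_scale (k : C) (phi : S -> C) z : ccont phi -> M (fun z => k * phi z) z = k * M phi z.
Proof. by move=> c1; apply: cint_scale; exact: kgood_ev. Qed.

Lemma Mtau_sum (s : seq (C * (S -> C))) (k : C * (S -> C) -> C) z : (forall p, p \in s -> ccont p.2) ->
  M (fun z => \sum_(p <- s) k p * p.2 z) z = \sum_(p <- s) k p * M p.2 z.
Proof.
elim: s => [|p s IH] h.
  rewrite big_nil; have -> : (fun z : S => \sum_(p <- [::]) k p * p.2 z) = (fun z => 0 * (fun=> 0) z).
    by apply: funext => w; rewrite big_nil mul0r.
  rewrite Mtau_scale ?mul0r //.
  by move=> x e e0; exists 1 => // y _; rewrite subrr cabs0.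
have -> : (fun z => \sum_(q <- p :: s) k q * q.2 z) = (fun z => k p * p.2 z + \sum_(q <- s) k q * q.2 z).
  by apply: funext => w; rewrite big_cons.
have cp : ccont p.2 by apply: h; rewrite mem_head.
have cs q : q \in s -> ccont q.2 by move=> qs; apply: h; rewrite inE qs orbT.
rewrite Mtau_add; [|exact: ccont_scale|exact: ccont_sum].
by rewrite Mtau_scale // IH // big_cons.
Qed.

Lemma cabs_Mtau_le (phi : S -> C) z (b : R) : ccont phi -> (forall z, cabs (phi z) <= b) ->
  cabs (M phi z) <= b.
Proof.
move=> cphi hb; apply: le_trans (cint_cabs (kgood_ev z cphi)) _.
have tT : tau [set: RatM R] = 1%E := probability_setT tau.
have -> : b = \int[tau]_(f in setT) b by rewrite Rintegral_cst // [X in fine X]tT mulr1.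
apply: le_Rintegral => //; first exact: kgood_cabs (kgood_ev z cphi).
exact: finite_measure_integrable_cst.
Qed.

Lemma Rintegral_le_Gamma (F : RatM R -> R) (B s : R) : tau.-integrable setT (EFin \o F) ->
  (forall f, 0 <= F f) -> (forall f, F f <= B) -> (forall f, Gam f -> F f <= s) ->
  \int[tau]_(f in setT) F f <= s.
Proof.
move=> iF F0 FB Fs.
have mG := Gamma_measurable tau.
have mGc : measurable (~` (Gam : set (RatM R))) by exact: measurableC.
have tG : fine (tau (Gam : set (RatM R))) = 1.
  have := probability_setC tau mGc; rewrite setCK Gamma_full => ->.
  by rewrite sube0.
rewrite -(setUv (Gam : set (RatM R))) Rintegral_setU //; last 2 first.
- by rewrite setUv.
- by apply/disj_setPS => f [].
have sub (D : set (RatM R)) : measurable D -> tau.-integrable D (EFin \o F).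
  by move=> mD; apply: integrableS iF.
have cst (D : set (RatM R)) (k : R) : measurable D -> tau.-integrable D (EFin \o (fun=> k)).
  by move=> mD; exact: finite_measure_integrable_cst.
have h1 : \int[tau]_(f in (Gam : set (RatM R))) F f <= s.
  have -> : s = \int[tau]_(f in (Gam : set (RatM R))) s by rewrite Rintegral_cst // tG mulr1.
  by apply: le_Rintegral => //; [exact: sub|exact: cst].
have h2 : \int[tau]_(f in ~` (Gam : set (RatM R))) F f <= 0.
  have -> : 0 = \int[tau]_(f in ~` (Gam : set (RatM R))) B.
    by rewrite Rintegral_cst // [X in fine X](Gamma_full tau) mulr0.
  by apply: le_Rintegral => //; [exact: sub|exact: cst].
lra.
Qed.

Lemma ccont_Mtau (phi : S -> C) : mcompact (@kappa R) Gam -> ccont phi -> ccont (M phi).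
Proof.
move=> cG cphi; have [L L2 HL] := compact_uniformly_lipschitz cG.
have [B B0 hB] := ccont_bounded cphi.
move=> x e e0; have e20 : 0 < e / 2 by rewrite divr_gt0.
have [d d0 hd] := ccont_uniform cphi e20.
have L0 : 0 < L by exact: lt_le_trans L2.
exists (d / L); first by rewrite divr_gt0.
move=> y xy; pose F (f : RatM R) := phi (sval f x) + (-1) * phi (sval f y).
have gF : kgood F by apply: kgood_add; [|apply: kgood_scale]; exact: kgood_ev.
have -> : M phi x - M phi y = cint tau F.
  rewrite /F cint_add; [|exact: kgood_ev|by apply: kgood_scale; exact: kgood_ev].
  by rewrite cint_scale ?mulN1r //; exact: kgood_ev.
apply: le_lt_trans (cint_cabs gF) _; apply: le_lt_trans (_ : e / 2 < e); last lra.
apply: (Rintegral_le_Gamma (B := B + B)).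
- exact: kgood_cabs.
- by move=> f; exact: cabs_ge0.
- by move=> f; apply: le_trans (cabsD _ _) _; rewrite mulN1r cabsN; exact: lerD.
move=> f Gf; rewrite /F mulN1r; apply: ltW; apply: hd.
apply: le_lt_trans (HL f Gf x y) _; rewrite mulrC -ltr_pdivlMr //.
by apply: le_lt_trans (chordal_le_sdist _ _) xy.
Qed.

Lemma iter_Mtau_add (phi psi : S -> C) (b : R) n : mcompact (@kappa R) Gam -> ccont phi -> ccont psi ->
  (forall z, cabs (phi z + psi z) <= b) ->
  forall z, cabs (iter n M phi z + iter n M psi z) <= b.
Proof.
move=> cG; elim: n phi psi => [//|n IH] phi psi c1 c2 hb z.
rewrite !iterSr; apply: IH; [exact: ccont_Mtau|exact: ccont_Mtau|].
move=> w; rewrite -Mtau_add //; apply: cabs_Mtau_le => //; exact: ccont_add.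
Qed.
End TransitionOperator.

Section PeripheralEigenfunctions.
Variable R : realType.
Local Notation C := R[i].
Local Notation S := (sphere R).
Variable tau : probability (RatM R) R.
Local Notation M := (Mtau tau).
Local Notation Gam := (Gamma_tau tau).

Definition integral_holder (a c : R) :=
  forall (e : S -> S -> R) (B : R), (forall x y, 0 <= e x y) -> (forall x y, e x y <= B) ->
  (forall x y, measurable_fun setT (fun f : RatM R => e (sval f x) (sval f y))) ->
  (forall x y, ((e x y)%:E <= \int[tau]_(f in setT) (e (sval f x) (sval f y))%:E)%E) ->
  small_near_diagonal [set sval f | f in Gam] e ->
  forall x y, e x y <= c * B * (chordal x y) `^ a.

Variables (s : seq (C * (S -> C))) (ev : C * (S -> C) -> C).
Hypothesis s_cont : forall p, p \in s -> ccont p.2.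
Hypothesis ev1 : forall p, p \in s -> cabs (ev p) = 1.
Hypothesis s_eigen : forall p, p \in s -> M p.2 = (fun z => ev p * p.2 z).

(** Entries of [s] are pairs of a coefficient and an eigenfunction, with eigenvalue [ev p]. This is
    Theta_n; [orbit_fwd n] is the n-th iterate of the operator on Theta_0. *)
Definition orbit_back (n : nat) (z : S) : C := \sum_(p <- s) (p.1 * (ev p)^-1 ^+ n) * p.2 z.
Definition orbit_fwd (n : nat) (z : S) : C := \sum_(p <- s) (p.1 * (ev p) ^+ n) * p.2 z.

Lemma ev_neq0 p : p \in s -> ev p != 0.
Proof. by move=> ps; rewrite -cabs_eq0 ev1 // oner_neq0. Qed.

Lemma cabs_evV p n : p \in s -> cabs ((ev p)^-1 ^+ n) = 1.
Proof. by move=> ps; rewrite cabsX cabsV ev1 // invr1 expr1n. Qed.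

Lemma ccont_back n : ccont (orbit_back n).
Proof. exact: (ccont_sum (fun p => p.1 * (ev p)^-1 ^+ n)). Qed.

Lemma Mtau_back n z : M (orbit_back n.+1) z = orbit_back n z.
Proof.
rewrite (@Mtau_sum R tau s (fun p => p.1 * (ev p)^-1 ^+ n.+1)) //; apply: eq_big_seq => p ps.
by rewrite s_eigen // exprSr -!mulrA mulKf ?ev_neq0.
Qed.

Lemma iter_Mtau_fwd n : iter n M (orbit_fwd 0) = orbit_fwd n.
Proof.
elim: n => [//|n IH]; rewrite iterS IH; apply: funext => z.
rewrite (@Mtau_sum R tau s (fun p => p.1 * (ev p) ^+ n)) //; apply: eq_big_seq => p ps.
by rewrite s_eigen // exprSr !mulrA.
Qed.

Lemma back_equicontinuous (e : R) : 0 < e -> exists2 d : R, 0 < d &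
  forall n x y, chordal x y < d -> cabs (orbit_back n x - orbit_back n y) <= e.
Proof.
move=> e0.
suff [d d0 hd] : exists2 d : R, 0 < d & forall x y, chordal x y < d ->
    \sum_(p <- s) cabs p.1 * cabs (p.2 x - p.2 y) <= e.
  exists d => // n x y /hd; apply: le_trans.
  rewrite -sumrB; apply: le_trans (cabs_sum _ _ _) _.
  rewrite !big_seq; apply: ler_sum => p ps.
  by rewrite -mulrBr !cabsM cabs_evV // mulr1.
elim: s e e0 s_cont => [|p s' IH] e e0 sc; first by exists 1 => // x y _; rewrite big_nil ltW.
have e20 : 0 < e / 2 by rewrite divr_gt0.
have [|d d0 hd] := IH _ e20; first by move=> q qs; apply: sc; rewrite inE qs orbT.
have k0 : 0 < cabs p.1 + 1 by have := cabs_ge0 p.1; lra.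
have [d' d'0 hd'] := ccont_uniform (sc p (mem_head _ _)) (divr_gt0 e20 k0).
exists (Num.min d d'); first by rewrite lt_min d0.
move=> x y; rewrite lt_min big_cons => /andP[/hd h1 /hd' h2].
rewrite ltr_pdivlMr // in h2.
by have := cabs_ge0 (p.2 x - p.2 y); lra.
Qed.

Lemma ccont_sum_bounded : exists2 K : R, 0 <= K & forall z, \sum_(p <- s) cabs p.1 * cabs (p.2 z) <= K.
Proof.
elim: s s_cont => [|p s' IH] sc; first by exists 0 => // z; rewrite big_nil.
have [|K K0 hK] := IH; first by move=> q qs; apply: sc; rewrite inE qs orbT.
have [B B0 hB] := ccont_bounded (sc p (mem_head _ _)).
exists (cabs p.1 * B + K); first by rewrite addr_ge0 // mulr_ge0 // cabs_ge0.
by move=> z; rewrite big_cons lerD // ler_wpM2l // cabs_ge0.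
Qed.

Lemma back_bounded : exists2 K : R, 0 <= K & forall n z, cabs (orbit_back n z) <= K.
Proof.
have [K K0 hK] := ccont_sum_bounded; exists K => // n z; apply: le_trans (cabs_sum _ _ _) (le_trans _ (hK z)).
by rewrite !big_seq; apply: ler_sum => p ps; rewrite !cabsM cabs_evV // mulr1.
Qed.

Lemma back_fwd0 : orbit_back 0 = orbit_fwd 0.
Proof. by apply: funext => z; apply: eq_bigr => p _; rewrite !expr0. Qed.

(* By almost periodicity, backward iterates of a combination of unimodular
   eigenfunctions are uniform limits of forward iterates. *)
Lemma back_le_of_near (phi : S -> C) (b : R) : mcompact (@kappa R) Gam ->
  (forall z, cabs (phi z) <= b) -> B0 tau (fun z => phi z - orbit_back 0 z) ->
  forall n z, cabs (orbit_back n z) <= b.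
Proof.
move=> cG phib [cchi hchi] m z; apply/ler_addgt0Pr => e e0.
have e20 : 0 < e / 2 by rewrite divr_gt0.
have [N hN] := hchi _ e20; have [K K0 hK] := ccont_sum_bounded.
have K10 : 0 < K + 1 by lra.
(* With a^n close to 1, a^-m is close to a^(n-m); n >= N + m places the forward time n - m where the
   iterates of phi - psi are already small. *)
have [|n [Nn hn]] := @unimodular_recurrence R (map ev s) (N + m)%N _ _ (divr_gt0 e20 K10).
  by move=> _ /mapP[p ps ->]; exact: ev1.
have fwd_le : cabs (orbit_fwd (n - m) z) <= b + e / 2.
  have Nnm : (N <= n - m)%N by rewrite leq_subRL ?(leq_trans (leq_addl _ _) Nn) // addnC.
  have h1 : cabs (iter (n - m) M (fun z => phi z - orbit_back 0 z) z) <= e / 2.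
    rewrite -lee_fin; apply: le_trans (hN _ Nnm); apply: ereal_sup_ubound; by exists z.
  have h2 : cabs (iter (n - m) M (fun z => phi z - orbit_back 0 z) z + iter (n - m) M (orbit_back 0) z) <= b.
    by apply: iter_Mtau_add => //; [exact: ccont_back|move=> w; rewrite subrK].
  rewrite [in X in _ + X]back_fwd0 iter_Mtau_fwd in h2.
  move: h1 h2; set u := iter _ _ _ _ => h1 h2.
  have -> : orbit_fwd (n - m) z = (u + orbit_fwd (n - m) z) - u by ring.
  by apply: le_trans (cabsD _ _) _; rewrite cabsN; lra.
have mn : (m <= n)%N by apply: leq_trans Nn; exact: leq_addl.
have close : cabs (orbit_back m z - orbit_fwd (n - m) z) <= e / 2.
  have -> : e / 2 = e / 2 / (K + 1) * (K + 1) by rewrite divfK ?gt_eqF.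
  apply: (@le_trans _ _ (e / 2 / (K + 1) * K)); last by rewrite ler_pM2l ?divr_gt0 //; lra.
  apply: le_trans (ler_wpM2l (ltW (divr_gt0 e20 K10)) (hK z)).
  rewrite -sumrB; apply: le_trans (cabs_sum _ _ _) _; rewrite mulr_sumr !big_seq.
  apply: ler_sum => p ps; have e1 : (ev p)^-1 ^+ m * ev p ^+ n = ev p ^+ (n - m).
    by rewrite -{1}(subnK mn) exprD mulrCA -exprMn mulVf ?ev_neq0 // expr1n mulr1.
  rewrite -e1; have -> : p.1 * (ev p)^-1 ^+ m * p.2 z - p.1 * ((ev p)^-1 ^+ m * ev p ^+ n) * p.2 z
    = (ev p)^-1 ^+ m * ((1 - ev p ^+ n) * (p.1 * p.2 z)) by ring.
  rewrite cabsM cabs_evV // mul1r !cabsM; apply: ler_wpM2r; first by rewrite mulr_ge0 // cabs_ge0.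
  by rewrite cabsB ltW // hn // map_f.
have -> : orbit_back m z = orbit_fwd (n - m) z + (orbit_back m z - orbit_fwd (n - m) z) by ring.
by apply: le_trans (cabsD _ _) _; lra.
Qed.

Variable b : R.
Hypothesis back_le : forall n z, cabs (orbit_back n z) <= b.

Definition back_osc (x y : S) : R := sup [set cabs (orbit_back n x - orbit_back n y) | n in [set: nat]].

Lemma back_osc_ub n x y : cabs (orbit_back n x - orbit_back n y) <= back_osc x y.
Proof.
apply: ub_le_sup; last by exists n.
exists (b + b) => _ [m _ <-]; apply: le_trans (cabsD _ _) _.
by rewrite cabsN; exact: lerD.
Qed.

Lemma back_osc_le k x y : (forall n, cabs (orbit_back n x - orbit_back n y) <= k) -> back_osc x y <= k.
Proof.
move=> h; apply: ge_sup; last by move=> _ [n _ <-].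
by exists (cabs (orbit_back 0 x - orbit_back 0 y)), 0%N.
Qed.

Lemma back_osc_cont x y (f : RatM R) (e : R) : 0 < e -> exists2 d : R, 0 < d &
  forall g, kappa f g < d -> `|back_osc (sval f x) (sval f y) - back_osc (sval g x) (sval g y)| < e.
Proof.
move=> e0; have e40 : 0 < e / 4 by rewrite divr_gt0.
have [d d0 hd] := back_equicontinuous e40; exists d => // g fg.
have h z n : cabs (orbit_back n (sval f z) - orbit_back n (sval g z)) <= e / 4.
  by apply: hd; apply: le_lt_trans (chordal_le_sdist _ _) (le_lt_trans (kappa_ub f g z) fg).
have h1 : back_osc (sval f x) (sval f y) <= back_osc (sval g x) (sval g y) + e / 2.
  apply: back_osc_le => n; have := back_osc_ub n (sval g x) (sval g y).
  have := cabs_tri (orbit_back n (sval g x)) (orbit_back n (sval f x)) (orbit_back n (sval f y)).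
  have := cabs_tri (orbit_back n (sval g y)) (orbit_back n (sval g x)) (orbit_back n (sval f y)).
  by have := h x n; have := h y n; rewrite (cabsB (orbit_back n (sval f y))) ; lra.
have h2 : back_osc (sval g x) (sval g y) <= back_osc (sval f x) (sval f y) + e / 2.
  apply: back_osc_le => n; have := back_osc_ub n (sval f x) (sval f y).
  have := cabs_tri (orbit_back n (sval f x)) (orbit_back n (sval g x)) (orbit_back n (sval g y)).
  have := cabs_tri (orbit_back n (sval f y)) (orbit_back n (sval f x)) (orbit_back n (sval g y)).
  by have := h x n; have := h y n; rewrite (cabsB (orbit_back n (sval f x)) (orbit_back n (sval g x))); lra.
by rewrite ltr_norml; apply/andP; split; lra.
Qed.

Lemma back_holder a c x y : integral_holder a c ->
  cabs (orbit_back 0 x - orbit_back 0 y) <= c * (b + b) * (chordal x y) `^ a.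
Proof.
move=> H; apply: le_trans (back_osc_ub 0 x y) _.
have b2 u v : back_osc u v <= b + b.
  by apply: back_osc_le => n; apply: le_trans (cabsD _ _) _; rewrite cabsN; exact: lerD.
have o0 u v : 0 <= back_osc u v by apply: le_trans (back_osc_ub 0 u v); exact: cabs_ge0.
apply: H => //.
- by move=> u v; apply: kcontinuous_measurable; exact: back_osc_cont.
- move=> u v.
  have iO : tau.-integrable setT (EFin \o (fun f : RatM R => back_osc (sval f u) (sval f v))).
    apply: (@kcont_integrable R tau _ (b + b)); first exact: back_osc_cont.
    by move=> f; rewrite ger0_norm.
  suff h : back_osc u v <= \int[tau]_(f in setT) back_osc (sval f u) (sval f v).
    by rewrite -[leRHS]fineK ?lee_fin //; exact: integrable_fin_num iO.
  apply: back_osc_le => n.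
  (* Theta_n is the average of Theta_(n+1), which also competes in the supremum defining [back_osc];
     hence the supremum is dominated by its average. *)
  pose F (f : RatM R) := orbit_back n.+1 (sval f u) + (-1) * orbit_back n.+1 (sval f v).
  have cb := ccont_back n.+1.
  have gF : kgood F by apply: kgood_add; [|apply: kgood_scale]; exact: kgood_ev.
  have -> : orbit_back n u - orbit_back n v = cint tau F.
    rewrite /F cint_add; [|exact: kgood_ev|by apply: kgood_scale; exact: kgood_ev].
    by rewrite cint_scale ?mulN1r -?Mtau_back //; exact: kgood_ev.
  apply: le_trans (cint_cabs tau gF) _; apply: le_Rintegral => //; first exact: kgood_cabs.
  by move=> f _; rewrite /F mulN1r; exact: back_osc_ub.
move=> eta eta0; have [d d0 hd] := back_equicontinuous eta0; exists d => // u v uv _.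
by apply: back_osc_le => n; exact: hd.
Qed.
End PeripheralEigenfunctions.

Section HolderNorm.
Variable R : realType.
Local Notation S := (sphere R).

(** The surplus exponent a - al is absorbed by the bound 4 on the spherical distance. *)
Lemma hnorm_le (V : zmodType) (nrm : V -> R) (phi : S -> V) (b K a al : R) :
  0 < al < a -> 0 <= K -> (forall z, nrm (phi z) <= b) ->
  (forall x y, nrm (phi x - phi y) <= K * (chordal x y) `^ a) ->
  (hnorm nrm al phi <= (b + K * 4 `^ a)%:E)%E.
Proof.
move=> /andP[al0 ala] K0 hb hK; rewrite EFinD; apply: leeD.
  by apply: ge_ereal_sup => _ [z _ <-]; rewrite lee_fin.
apply: ge_ereal_sup => _ [[x y] /= xy <-]; rewrite lee_fin.
have d0 : 0 < sdist x y by exact: sdist_gt0.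
rewrite ler_pdivrMr ?powR_gt0 // ; apply: le_trans (hK x y) _.
rewrite -mulrA; apply: ler_wpM2l => //.
apply: (@le_trans _ _ ((sdist x y) `^ a)).
  have a0 : 0 <= a by lra.
  by apply: (ge0_ler_powR a0 _ _ (chordal_le_sdist x y)); rewrite nnegrE ?chordal_ge0 // ltW.
have -> : a = (a - al) + al by lra.
rewrite powRD; last by rewrite (gt_eqF d0) implybT.
apply: ler_wpM2r; first exact: powR_ge0.
apply: (@le_trans _ _ (4 `^ (a - al))).
  apply: ge0_ler_powR; rewrite ?nnegrE; [lra|exact: ltW|lra|exact: sdist_le4].
by apply: ler_powR; lra.
Qed.
End HolderNorm.

Section LinearSpan.
Variable R : realType.
Local Notation C := R[i].
Local Notation S := (sphere R).
Variable tau : probability (RatM R) R.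
Local Notation Gam := (Gamma_tau tau).
Variables (a c : R).
Hypothesis c0 : 0 <= c.
Hypothesis Hac : integral_holder tau a c.

Lemma LS_eigendata psi : LS (Utau tau) psi -> exists (s : seq (C * (S -> C))) (ev : C * (S -> C) -> C),
  [/\ forall p, p \in s -> ccont p.2, forall p, p \in s -> cabs (ev p) = 1,
   forall p, p \in s -> Mtau tau p.2 = (fun z => ev p * p.2 z) & psi = orbit_back s ev 0].
Proof.
move=> [s [hs ->]].
have evex (p : C * (S -> C)) : exists k : C, p \in s -> cabs k = 1 /\ Mtau tau p.2 = (fun z => k * p.2 z).
  by have [ps|] := boolP (p \in s); [have [_ _ [k k1 hk]] := hs p ps; exists k|exists 0].
have [ev hev] := choice evex; exists s, ev; split.
- by move=> p /hs[].
- by move=> p /hev[].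
- by move=> p /hev[].
by apply: funext => z; apply: eq_bigr => p _; rewrite expr0 mulr1.
Qed.

Lemma LS_holder psi al : LS (Utau tau) psi -> 0 < al < a -> holder (@cabs R) al psi.
Proof.
move=> /LS_eigendata[s [ev [sc ev1 se ->]]] ala.
have [K K0 hK] := back_bounded sc ev1.
apply: le_lt_trans (hnorm_le ala _ (hK 0%N) _) (ltry _); last first.
  by move=> x y; exact: (back_holder sc ev1 se hK x y Hac).
by rewrite mulr_ge0 // addr_ge0.
Qed.

Lemma supnorm_fin (al : R) (phi : S -> C) : holder (@cabs R) al phi ->
  exists2 b : R, supnorm (@cabs R) phi = b%:E & forall z, cabs (phi z) <= b.
Proof.
move=> h.
have ub z : ((cabs (phi z))%:E <= supnorm (@cabs R) phi)%E by apply: ereal_sup_ubound; exists z.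
have q0 : (0 <= ereal_sup [set (cabs (phi xy.1 - phi xy.2) / powR (sdist xy.1 xy.2) al)%:E
             | xy in [set xy : S * S | xy.1 <> xy.2]])%E.
  (* The pair of infinity and 0 shows that the supremum of quotients is nonnegative, so finiteness
     of the sum gives finiteness of the sup norm. *)
  apply: (@le_trans _ _ (cabs (phi None - phi (Some 0)) / powR (sdist None (Some 0)) al)%:E).
    by rewrite lee_fin divr_ge0 ?cabs_ge0 ?powR_ge0.
  by apply: ereal_sup_ubound; exists (None, Some 0).
have : (supnorm (@cabs R) phi < +oo)%E.
  by apply: le_lt_trans h; rewrite /hnorm leeDl.
case E : (supnorm (@cabs R) phi) (ub) => [b| |] //= ub' _.
  by exists b => // z; rewrite -lee_fin.
by have := ub' None; rewrite leeNy_eq.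
Qed.

(** Here psi is the projection of phi. Its backward orbit is bounded by the sup norm b of phi alone,
    and b + c (b + b) 4^a is the stated multiple of b. *)
Lemma projection_bound (phi psi : S -> C) al : mcompact (@kappa R) Gam -> 0 < al < a ->
  holder (@cabs R) al phi -> LS (Utau tau) psi -> B0 tau (fun z => phi z - psi z) ->
  (hnorm (@cabs R) al psi <= (1 + c * 2 * 4 `^ a)%:E * supnorm (@cabs R) phi)%E.
Proof.
move=> cG ala /supnorm_fin[b -> phib] /LS_eigendata[s [ev [sc ev1 se ->]]] hB0.
have hb := back_le_of_near sc ev1 se cG phib hB0.
have b0 : 0 <= b by apply: le_trans (phib None); exact: cabs_ge0.
have K0 : 0 <= c * (b + b) by rewrite mulr_ge0 // addr_ge0.
apply: le_trans (hnorm_le ala K0 (hb 0%N) _) _.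
  by move=> x y; exact: (back_holder sc ev1 se hb x y Hac).
by rewrite -EFinM lee_fin le_eqVlt; apply/orP; left; apply/eqP; ring.
Qed.
End LinearSpan.

(** * Random orbits *)

Section OrbitMeasurability.
Variable R : realType.
Local Notation S := (sphere R).
Local Notation copen := (mopen (@chordal R)).

Definition cylinders : set (set (SeqM R)) := [set C | exists (n : nat) (A : nat -> set (RatM R)),
  (forall i, measurable (A i)) /\ C = [set g | forall i, (i < n)%N -> A i (g i)]].

Definition cylinder n (A : nat -> set (RatM R)) : set (SeqM R) :=
  [set g | forall i, (i < n)%N -> A i (g i)].

Lemma cylinder_measurable n A : (forall i, measurable (A i)) -> measurable (cylinder n A).
Proof. by move=> mA; apply: sub_sigma_algebra; exists n, A. Qed.

Lemma coord_measurable n (A : set (RatM R)) : measurable A -> measurable ([set g | A (g n)] : set (SeqM R)).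
Proof.
move=> mA; have -> : [set g : SeqM R | A (g n)] = cylinder n.+1 (fun i => if i == n then A else setT).
  apply/seteqP; split=> g /=; last by move/(_ n (ltnSn n)); rewrite eqxx.
  by move=> An i _; case: eqP => [->|].
by apply: cylinder_measurable => i; case: eqP.
Qed.

Lemma net_seq : exists net : nat -> nat -> S, forall k p, exists i, chordal p (net k i) < k.+1%:R^-1.
Proof.
have nets k : exists l : seq S, forall p, exists2 q, q \in l & chordal p q < k.+1%:R^-1.
  by have [|l hl] := @sphere_net R (k.+1%:R^-1); [by []|exists l].
have [net hnet] := choice nets; exists (fun k i => nth None (net k) i) => k p.
by have [q ql h] := hnet k p; exists (index q (net k)); rewrite nth_index.
Qed.

Lemma small_inv (e : R) : 0 < e -> exists k : nat, k.+1%:R^-1 < e.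
Proof. by move=> /ltr_add_invr[k]; rewrite add0r; exists k. Qed.

Section Generic.
Context {d : measure_display} {T : measurableType d}.

Definition omeas (X : T -> S) := forall U, copen U -> measurable [set t | U (X t)].

Lemma cball_open (q : S) (r : R) : copen [set p | chordal p q < r].
Proof.
move=> p /= pq; exists (r - chordal p q); first by rewrite subr_gt0.
move=> w pw /=; have := chordal_triangle p w q; rewrite (chordalC w p); lra.
Qed.

(** Separability: the condition is a countable union, over net points, of conditions on X and Y
    separately. *)
Lemma omeas_chordal (X Y : T -> S) (r : R) : omeas X -> omeas Y -> measurable [set t | chordal (X t) (Y t) < r].
Proof.
move=> mX mY; have [net hnet] := net_seq.
have -> : [set t | chordal (X t) (Y t) < r] = \bigcup_k \bigcup_i
   ([set t | chordal (X t) (net k i) < k.+1%:R^-1] `&` [set t | chordal (Y t) (net k i) < r - k.+1%:R^-1]).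
  apply/seteqP; split=> t /=.
    move=> h; have [|k hk] := @small_inv ((r - chordal (X t) (Y t)) / 2); first by rewrite divr_gt0 // subr_gt0.
    have [i hi] := hnet k (X t); exists k => //; exists i => //; split=> //=.
    have := chordal_triangle (X t) (Y t) (net k i); rewrite (chordalC (Y t) (X t)) (chordalC (Y t) (net k i)).
    move: hk hi; move: (_^-1) => w; lra.
  move=> [k _ [i _ [/= h1 h2]]]; have := chordal_triangle (net k i) (X t) (Y t).
  rewrite (chordalC (net k i) (Y t)).
  move: h1 h2; move: (_^-1) => w; lra.
apply: bigcup_measurable => k _; apply: bigcup_measurable => i _; apply: measurableI.
  exact: (mX _ (@cball_open _ _)).
exact: (mY _ (@cball_open _ _)).
Qed.
End Generic.

(** The margin eta makes this an open condition on g. It lets [eval_omeas] separate the random map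
    from the random point when the former is evaluated at the latter. *)
Definition robust_into (U : set S) (q : S) (r : R) : set (RatM R) :=
  [set g | exists2 eta : R, 0 < eta & forall p w, chordal p q < r -> chordal (sval g p) w < eta -> U w].

Lemma robust_into_measurable U q r : measurable (robust_into U q r).
Proof.
apply: kopen_measurable => g [eta eta0 h]; exists (eta / 2); first by rewrite divr_gt0.
move=> g' gg'; exists (eta / 2); first by rewrite divr_gt0.
move=> p w pq pw; apply: (h p w pq).
have := chordal_triangle (sval g' p) (sval g p) w; have := kappa_chordal g g' p; lra.
Qed.

Lemma rat_uniform (g : RatT R) (e : R) : 0 < e ->
  exists2 d : R, 0 < d & forall p q, chordal p q < d -> chordal (sval g p) (sval g q) < e.
Proof.
apply: continuous_uniform; apply: chart_rational_continuous.
apply: (@chart_rational_form_comp R (sval g) id); last exact: chart_rational_id.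
by apply: isRat_form_rational; exact: (svalP g).
Qed.

Lemma eval_omeas n (X : SeqM R -> S) : omeas X -> omeas (fun g : SeqM R => sval (g n) (X g)).
Proof.
move=> mX U oU; have [net hnet] := net_seq.
have -> : [set g : SeqM R | U (sval (g n) (X g))] = \bigcup_k \bigcup_i
   ([set g | chordal (X g) (net k i) < k.+1%:R^-1] `&` [set g | robust_into U (net k i) (k.+1%:R^-1) (g n)]).
  apply/seteqP; split=> g /=.
    move=> Ug; have [e e0 he] := oU _ Ug; have e20 : 0 < e / 2 by rewrite divr_gt0.
    have [dl dl0 hdl] := rat_uniform (g n) e20.
    have [|k hk] := @small_inv (dl / 2); first by rewrite divr_gt0.
    have [i hi] := hnet k (X g); exists k => //; exists i => //; split=> //=.
    exists (e / 2) => // p w pq pw; apply: he.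
    have : chordal (X g) p < dl.
      have := chordal_triangle (net k i) (X g) p; rewrite (chordalC (net k i) p).
      move: hk hi pq; move: (_^-1) => v; lra.
    by move=> /hdl; have := chordal_triangle (sval (g n) p) (sval (g n) (X g)) w; lra.
  move=> [k _ [i _ [/= h1 [eta eta0 h2]]]]; apply: (h2 (X g)) => //.
  by rewrite chordalxx.
apply: bigcup_measurable => k _; apply: bigcup_measurable => i _; apply: measurableI.
  exact: (mX _ (@cball_open _ _)).
by apply: coord_measurable; exact: robust_into_measurable.
Qed.

Lemma itcomp_omeas n x : omeas (fun g : SeqM R => itcomp g n x).
Proof.
elim: n => [|n IH]; last exact: eval_omeas.
move=> U oU /=; have [Ux|Ux] := pselect (U x).
  have -> : [set _ : SeqM R | U x] = setT by apply/seteqP; split.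
  exact: measurableT.
have -> : [set _ : SeqM R | U x] = set0 by apply/seteqP; split.
exact: measurable0.
Qed.

Definition far_often (k : nat) (x y : S) : set (SeqM R) :=
  [set g | forall N, exists2 n, (N <= n)%N & k.+1%:R^-1 <= chordal (itcomp g n x) (itcomp g n y)].

Lemma far_often_measurable k x y : measurable (far_often k x y).
Proof.
have -> : far_often k x y = \bigcap_N \bigcup_(n in [set n | (N <= n)%N])
    ~` [set g | chordal (itcomp g n x) (itcomp g n y) < k.+1%:R^-1].
  apply/seteqP; split=> g /=.
    by move=> h N _; have [n Nn hn] := h N; exists n => //=; apply/negP; rewrite -leNgt.
  by move=> h N; have [n Nn /= /negP] := h N I; rewrite -leNgt => hn; exists n.
apply: bigcap_measurable => [|N _]; first by exists 0%N.
apply: bigcup_measurable => n _; apply: measurableC; apply: omeas_chordal; exact: itcomp_omeas.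
Qed.

Definition scons (fg : RatM R * SeqM R) : SeqM R := fun n => if n is m.+1 then fg.2 m else fg.1.

Lemma itcomp_scons f g n x : itcomp (scons (f, g)) n.+1 x = itcomp g n (sval f x).
Proof. by elim: n => [//|n IH]; rewrite /= -IH. Qed.

(** An infinitely-often event ignores the first letter; this is what makes [far_prob] equal to its
    own average. *)
Lemma far_often_scons k x y f g : far_often k x y (scons (f, g)) <-> far_often k (sval f x) (sval f y) g.
Proof.
split=> h N.
  have [[//|n] Nn] := h N.+1; rewrite !itcomp_scons => hn; by exists n.
have [n Nn hn] := h N; exists n.+1; first exact: leqW.
by rewrite !itcomp_scons.
Qed.

Lemma scons_cylinder n A : scons @^-1` (cylinder n.+1 A) = A 0%N `*` cylinder n (fun i => A i.+1).
Proof.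
apply/seteqP; split=> -[f g] /= h.
  by split; [exact: (h 0%N)|move=> i ni; exact: (h i.+1)].
by case: h => h1 h2 [_|i ni] //; exact: h2.
Qed.

Lemma scons_measurable : measurable_fun [set: RatM R * SeqM R] scons.
Proof.
apply: (@measurability _ _ _ _ _ _ cylinders erefl) => _ [_ [[|n] [A [mA ->]]] <-]; rewrite setTI.
  rewrite (_ : _ @^-1` _ = setT) //; apply/seteqP; by split.
rewrite -/(cylinder n.+1 A) scons_cylinder; apply: measurableX => //.
by apply: cylinder_measurable => i /=.
Qed.
End OrbitMeasurability.

(** * Shift structure of the product measure and Hölder bounds for limit probabilities *)

Section ProductMeasure.
Variable R : realType.
Local Notation S := (sphere R).
Variables (tau : probability (RatM R) R) (P : probability (SeqM R) R).
Hypothesis P_prod : is_prod_tau tau P.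
Local Notation Gam := (Gamma_tau tau).

Lemma cylinder_prob n (A : nat -> set (RatM R)) : (forall i, measurable (A i)) ->
  P (cylinder n A) = (\prod_(i < n) tau (A i))%E.
Proof. exact: P_prod. Qed.

Lemma cylinders_setI : setI_closed (@cylinders R).
Proof.
move=> _ _ [n [A [mA ->]]] [m [B [mB ->]]].
exists (maxn n m), (fun i => (if (i < n)%N then A i else setT) `&` (if (i < m)%N then B i else setT)); split.
  by move=> i; apply: measurableI; case: ifP.
apply/seteqP; split=> g /=.
  by move=> [h1 h2] i _; split; case: ifP => // hi; [exact: h1|exact: h2].
move=> h; split=> i hi.
  by have [] := h i (leq_trans hi (leq_maxl _ _)); rewrite hi.
by have [] := h i (leq_trans hi (leq_maxr _ _)); rewrite hi.
Qed.

Lemma scons_preimage_measurable (E : set (SeqM R)) : measurable E -> measurable (@scons R @^-1` E).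
Proof. by move=> mE; rewrite -[X in measurable X]setTI; apply: scons_measurable. Qed.

(** Prepending an independent letter preserves P: both measures agree on cylinders, which are stable
    under intersection and generate the sigma-algebra. *)
Lemma prod_tau_scons (E : set (SeqM R)) : measurable E -> P E = (tau \x P)%E (@scons R @^-1` E).
Proof.
move=> mE.
rewrite -/(pushforward (tau \x P)%E (@scons R) E).
unshelve eapply (@measure_unique _ _ _ (@cylinders R) (fun=> setT) _ _ _ _ P (pushforward (tau \x P)%E (@scons R))).
- by [].
- exact: cylinders_setI.
- by move=> i; exists 0%N, (fun=> setT); split=> //; apply/seteqP; split.
- by rewrite bigcup_const.
- exact: scons_measurable.
- move=> _ [n [A [mA ->]]]; rewrite [LHS](cylinder_prob n mA).
  change (\prod_(i < n) tau (A i) = (tau \x P) (@scons R @^-1` cylinder n A))%E.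
  case: n => [|n].
    rewrite big_ord0 (_ : _ @^-1` _ = setT `*` setT); last by apply/seteqP; split=> // -[f g] _ i.
    rewrite [RHS]product_measure1E // -[LHS]mule1.
    by congr (_ * _)%E; apply/esym; exact: probability_setT.
  have mA' i : measurable (A i.+1) by [].
  rewrite scons_cylinder product_measure1E //; last exact: cylinder_measurable.
  by rewrite [X in (_ * X)%E](cylinder_prob n mA') big_ord_recl.
- by move=> _; rewrite ltey_eq fin_num_measure.
- by [].
Qed.

Lemma orbit_in_support : P.-negligible [set g | exists i, ~ Gam (g i)].
Proof.
have -> : [set g : SeqM R | exists i, ~ Gam (g i)] = \bigcup_i [set g | (~` Gam) (g i)].
  by apply/seteqP; split=> g; [move=> [i hi]; exists i|move=> [i _ hi]; exists i].
apply: negligible_bigcup => i.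
have mG : measurable (~` (Gam : set (RatM R))) by apply: measurableC; exact: Gamma_measurable.
exists [set g | (~` Gam) (g i)]; split=> //; first exact: (coord_measurable i mG).
have -> : [set g : SeqM R | (~` Gam) (g i)] = cylinder i.+1 (fun j => if j == i then ~` Gam else setT).
  apply/seteqP; split=> g /=; last by move/(_ i (ltnSn i)); rewrite eqxx.
  by move=> An j _; case: eqP => [->|].
rewrite [LHS]cylinder_prob; last by move=> j; case: eqP.
by rewrite big_ord_recr /= eqxx [X in (_ * X)%E]Gamma_full mule0.
Qed.

Definition far_prob (k : nat) (x y : S) : R := fine (P (far_often k x y)).

Lemma far_probE k x y : (far_prob k x y)%:E = P (far_often k x y).
Proof. by rewrite /far_prob fineK // fin_num_measure //; exact: far_often_measurable. Qed.

Lemma itcomp_semigroup (g : SeqM R) n : (forall i, Gam (g i)) ->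
  exists2 h, G_tau tau h & forall x, itcomp g n.+1 x = h x.
Proof.
move=> Gg; elim: n => [|n [h Gh hE]].
  by exists (sval (g 0%N)) => //; apply: gen_base; exists (g 0%N).
exists (sval (g n.+1) \o h); last by move=> z; rewrite /= -hE.
by apply: gen_comp => //; apply: gen_base; exists (g n.+1).
Qed.

Lemma far_prob_small k : small_near_diagonal [set sval f | f in Gam] (far_prob k).
Proof.
move=> eta eta0; exists k.+1%:R^-1 => // x y xy hxy.
suff -> : far_prob k x y = 0 by exact: ltW.
rewrite /far_prob (_ : P _ = 0%E) //; apply: measure_negligible; first exact: far_often_measurable.
apply: negligibleS orbit_in_support => g hg /=; apply: contrapT => h.
have Gg i : Gam (g i) by apply: contrapT => ?; apply: h; exists i.
(* A time at least 1 is requested because only non-empty words are elements of the semigroup. *)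
have [[//|n] _] := hg 1%N; have [u Gu uE] := itcomp_semigroup n Gg; rewrite !uE.
by apply/negP; rewrite -ltNge; exact: hxy.
Qed.

Lemma far_prob_section k x y (f : RatM R) :
  (far_prob k (sval f x) (sval f y))%:E = P (xsection (@scons R @^-1` (far_often k x y)) f).
Proof.
rewrite far_probE; congr (P _); apply/seteqP; split=> g.
  by move=> h; apply/xsectionP; apply/far_often_scons.
by move/xsectionP => /far_often_scons.
Qed.

(** Probabilities are bounded by B = 1, so the constant c does not depend on k, and k may tend to
    infinity. *)
Lemma far_prob_holder a c k x y : integral_holder tau a c -> far_prob k x y <= c * (chordal x y) `^ a.
Proof.
move=> H; rewrite -[c]mulr1; apply: H.
- by move=> u v; rewrite -lee_fin far_probE.
- by move=> u v; rewrite -lee_fin far_probE; exact: probability_le1 (far_often_measurable _ _ _).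
- move=> u v; apply/measurable_EFinP.
  have mE := scons_preimage_measurable (far_often_measurable k u v).
  have := measurable_fun_xsection P mE.
  by apply: eq_measurable_fun => f _; rewrite /= far_prob_section.
- move=> u v; rewrite far_probE prod_tau_scons; last exact: far_often_measurable.
  rewrite /product_measure1 le_eqVlt; apply/orP; left; apply/eqP.
  by apply: eq_integral => f _; rewrite far_prob_section.
exact: far_prob_small.
Qed.

Definition attracted (L : set S) (x : S) : set (SeqM R) :=
  [set g | forall e : R, 0 < e -> exists N : nat,
               forall n, (N <= n)%N -> distset (itcomp g n x) L < e].

Definition near_to (L : set S) (j : nat) : set S := [set z | exists2 w, L w & chordal z w < j.+1%:R^-1].

Lemma near_to_open L j : mopen (@chordal R) (near_to L j).
Proof.
move=> z [w Lw zw]; exists (j.+1%:R^-1 - chordal z w); first by rewrite subr_gt0.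
move=> z' zz'; exists w => //; have := chordal_triangle z z' w; rewrite (chordalC z' z).
by move: zw zz'; move: (_^-1) => u; lra.
Qed.

Lemma attractedP (L : set S) x g : L !=set0 ->
  attracted L x g <-> forall j, exists N, forall n, (N <= n)%N -> near_to L j (itcomp g n x).
Proof.
move=> [w0 Lw0].
have hi z : has_inf [set sdist z w | w in L].
  by split; [exists (sdist z w0), w0|exists 0 => _ [w _ <-]; exact: sdist_ge0].
split=> h.
  move=> j; have [|N hN] := h (j.+1%:R^-1); first by [].
  exists N => n /hN; rewrite /distset => /(inf_lt (hi _).1)[_ [w Lw <-] hw]; exists w => //.
  exact: le_lt_trans (chordal_le_sdist _ _) hw.
move=> e e0; have [|j hj] := @small_inv R (e / 2); first by rewrite divr_gt0.
have [N hN] := h j; exists N => n /hN[w Lw hw].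
apply: (@le_lt_trans _ _ (sdist (itcomp g n x) w)).
  by apply: ge_inf; [exact: (hi _).2|exists w].
apply: le_lt_trans (sdist_le_chordal _ _) _.
by move: hw hj; move: (_^-1) => u; lra.
Qed.

Lemma attracted_measurable (L : set S) x : L !=set0 -> measurable (attracted L x).
Proof.
move=> L0; have -> : attracted L x = \bigcap_j \bigcup_N \bigcap_(n in [set n | (N <= n)%N])
    [set g | near_to L j (itcomp g n x)].
  apply/seteqP; split=> g /=.
    by move=> /(attractedP _ _ L0) h j _; have [N hN] := h j; exists N.
  by move=> h; apply/(attractedP _ _ L0) => j; have [N _ hN] := h j I; exists N.
apply: bigcap_measurable => [|j _]; first by exists 0%N.
apply: bigcup_measurable => N _; apply: bigcap_measurable => [|n _]; first by exists N => /=.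
by apply: itcomp_omeas; exact: near_to_open.
Qed.

(** If the two orbits are not infinitely often apart at any scale, their distance tends to 0, and
    attraction to L passes from one to the other. *)
Lemma attracted_sub (L : set S) x y : L !=set0 ->
  attracted L x `<=` attracted L y `|` \bigcup_k far_often k x y.
Proof.
move=> L0 g Ax; have [far|nfar] := pselect ((\bigcup_k far_often k x y) g); [by right|left].
apply/(attractedP _ _ L0) => j.
have [|k hk] := @small_inv R (j.+1%:R^-1 / 2); first by rewrite divr_gt0.
have [N1 h1] := (attractedP x g L0).1 Ax k.
have [N2 h2] : exists N, forall n, (N <= n)%N -> chordal (itcomp g n x) (itcomp g n y) < k.+1%:R^-1.
  apply: contrapT => h; apply: nfar; exists k => // N; apply: contrapT => h'.
  by apply: h; exists N => n Nn; rewrite ltNge; apply/negP => hn; apply: h'; exists n.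
exists (maxn N1 N2) => n; rewrite geq_max => /andP[/h1[w Lw hw] /h2 hn]; exists w => //.
have := chordal_triangle (itcomp g n x) (itcomp g n y) w; rewrite (chordalC (itcomp g n y) (itcomp g n x)).
by move: hw hn hk; move: (k.+1%:R^-1) (j.+1%:R^-1) => u v; lra.
Qed.

(** The events increase with k, so continuity from below applies. *)
Lemma far_often_limit x y (b : R) : (forall k, far_prob k x y <= b) ->
  (P (\bigcup_k far_often k x y) <= b%:E)%E.
Proof.
move=> hb; have mF k := far_often_measurable k x y.
have nd : nondecreasing_seq (fun k => far_often k x y).
  move=> k l kl; apply/subsetPset => g h N; have [n Nn hn] := h N; exists n => //.
  by apply: le_trans hn; rewrite lef_pV2 ?posrE // ler_nat.
have cv := @nondecreasing_cvg_mu _ _ _ P _ mF (bigcup_measurable (fun k _ => mF k)) nd.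
rewrite -(cvg_lim (@ereal_hausdorff R) cv); apply: lime_le; first by apply/cvg_ex; eexists; exact: cv.
by apply: nearW => k /=; rewrite -far_probE lee_fin.
Qed.

Lemma TtauE (L : set S) z : L !=set0 -> (Ttau P L z)%:E = P (attracted L z).
Proof. by move=> L0; apply: fineK; apply: fin_num_measure; exact: attracted_measurable. Qed.

Lemma Ttau_holder_le (L : set S) a c x y : L !=set0 -> integral_holder tau a c ->
  `|Ttau P L x - Ttau P L y| <= c * (chordal x y) `^ a.
Proof.
move=> L0 H.
have half u v : Ttau P L u <= Ttau P L v + c * (chordal u v) `^ a.
  rewrite -lee_fin EFinD !TtauE //.
  have mA z := attracted_measurable z L0.
  have mU : measurable (\bigcup_k far_often k u v).
    by apply: bigcup_measurable => k _; exact: far_often_measurable.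
  apply: (@le_trans _ _ (P (attracted L v `|` \bigcup_k far_often k u v))).
    by apply: le_measure; rewrite ?inE //; [exact: measurableU|exact: attracted_sub].
  apply: (@le_trans _ _ (P (attracted L v) + P (\bigcup_k far_often k u v))%E).
    exact: measureU2.
  by apply: leeD => //; apply: far_often_limit => k; exact: far_prob_holder.
rewrite ler_norml; have := half x y; have := half y x; rewrite (chordalC y x) => *.
by apply/andP; split; lra.
Qed.

Lemma Ttau_holder (L : set S) a c al : L !=set0 -> 0 <= c -> integral_holder tau a c -> 0 < al < a ->
  holder (@Num.norm R R) al (Ttau P L).
Proof.
move=> L0 c0 H ala.
apply: le_lt_trans (hnorm_le ala c0 (_ : forall z, `|Ttau P L z| <= 1) _) (ltry _).
  move=> z; have mA := attracted_measurable z L0.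
  by rewrite ger0_norm -lee_fin TtauE //; exact: probability_le1.
by move=> x y; exact: Ttau_holder_le.
Qed.
End ProductMeasure.

Theorem mainTheorem11 (R : realType) (tau : probability (RatM R) R) :
  mcompact (@kappa R) (Gamma_tau tau) ->
  Jker (G_tau tau) = set0 ->
  Julia (G_tau tau) !=set0 ->
  exists2 alpha0 : R, 0 < alpha0 &
    forall alpha : R, 0 < alpha < alpha0 ->
    [/\ (forall psi, LS (Utau tau) psi -> holder (@cabs R) alpha psi),
        (exists2 E : R, 0 < E &
           forall phi psi : sphere R -> R[i],
             holder (@cabs R) alpha phi ->
             LS (Utau tau) psi -> B0 tau (fun z => phi z - psi z) ->
             (hnorm (@cabs R) alpha psi <= E%:E * supnorm (@cabs R) phi)%E) &
        (forall L : set (sphere R), Minset (G_tau tau) L ->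
           forall P : probability (SeqM R) R, is_prod_tau tau P ->
           holder (@Num.norm R R) alpha (Ttau P L))].
Proof.
move=> cG jk jn; have [a a0 [c c0 Hac]] := integral_holder_bound cG jk jn.
exists a => // al ala; split.
- by move=> psi hpsi; exact: (LS_holder (ltW c0) Hac hpsi ala).
- exists (1 + c * 2 * 4 `^ a).
    by rewrite addr_gt0 // !mulr_gt0 // powR_gt0.
  by move=> phi psi hphi hpsi hB; exact: (projection_bound (ltW c0) Hac cG ala hphi hpsi hB).
by move=> L [L0 _ _ _] P hP; exact: (Ttau_holder hP L0 (ltW c0) Hac ala).
Qed.
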